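(* Let $p\ge 3$ and $q\ge 1$ be integers and let $n$ be sufficiently large. If $G$ is an $n$-vertex non-$p$-partite $B_{p,q}$-free graph, then $\rho(G)\le \rho(Y_p(n))$, with equality if and only if $G\cong Y_p(n)$.
   Context: $\rho(G)$ denotes the spectral radius (largest eigenvalue of the adjacency matrix) of $G$. For integers $p\ge 2$, $q\ge 1$, $B_{p,q}=K_p\nabla qK_1$ is the join of a clique $K_p$ with an independent set of $q$ vertices; $B_{p,q}$-free means containing no subgraph isomorphic to $B_{p,q}$. A graph is non-$p$-partite if its chromatic number exceeds $p$. $T_{m,p}$ is the Turán graph (complete $p$-partite graph on $m$ vertices with parts as equal as possible). $Y_p(n)$: let $T_1,\dots,T_p$ be the color classes of $T_{n-1,p}$ with $\lfloor\frac{n-1}{p}\rfloor=|T_1|\le\cdots\le|T_p|=\lceil\frac{n-1}{p}\rceil$, pick $u_1\in T_1$, $u_2\in T_2$; $Y_p(n)$ is obtained from $T_{n-1,p}$ by deleting the edge $u_1u_2$ and adding a new vertex $u_0$ adjacent to all vertices of $(T_3\cup\cdots\cup T_p)\cup\{u_1,u_2\}$. *)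

(* Defs.v *)
From HB Require Import structures.
From mathcomp Require Import all_boot all_order all_algebra.
From mathcomp Require Import polyrcf.
From mathcomp Require Import reals.
Set Implicit Arguments. Unset Strict Implicit. Unset Printing Implicit Defensive.
Import Order.TTheory GRing.Theory Num.Theory.

Definition simple_graph n (e : rel 'I_n) : Prop :=
  (forall x, ~~ e x x) /\ (forall x y, e x y = e y x).

Definition adj_mx (R : realType) n (e : rel 'I_n) : 'M[R]_n :=
  \matrix_(i, j) ((e i j)%:R)%R.

(* Spectral radius = largest eigenvalue of the adjacency matrix:
   the largest (real) root of its characteristic polynomial
   (rootsR lists the real roots in increasing order). *)
Definition spec_rad (R : realType) n (e : rel 'I_n) : R :=
  last 0%R (rootsR (char_poly (adj_mx R e))).

Definition contains_subgraph m n (h : rel 'I_m) (g : rel 'I_n) : Prop :=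
  exists f : 'I_m -> 'I_n, injective f /\ (forall x y, h x y -> g (f x) (f y)).

Definition graph_iso n (e1 e2 : rel 'I_n) : Prop :=
  exists f : 'I_n -> 'I_n, bijective f /\ (forall x y, e2 (f x) (f y) = e1 x y).

Definition colorable n (e : rel 'I_n) (k : nat) : Prop :=
  exists c : 'I_n -> 'I_k, forall x y, e x y -> c x != c y.

Definition non_partite n (e : rel 'I_n) (p : nat) : Prop := ~ colorable e p.

(* B_{p,q} = K_p join qK_1 on vertices 'I_(p+q); vertices < p form the clique. *)
Definition B_adj (p q : nat) : rel 'I_(p + q) :=
  fun x y => (x != y) && ((x < p) || (y < p)).

(* Y_p(n).  Vertices 0..n-2 form T_{n-1,p}, vertex i lying in part i %% p;
   part sizes are non-increasing in the class index, so class p-1 is a smallest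
   part (T_1) and class p-2 the next smallest (T_2).  u1 := p-1 (in T_1),
   u2 := p-2 (in T_2), u0 := n-1.  The edge u1u2 is deleted and u0 is joined to
   all vertices of classes 0..p-3 (= T_3 u ... u T_p) and to u1, u2. *)
Definition Y_adj (p n : nat) : rel 'I_n :=
  fun x y =>
    let u0 := n.-1 in let u1 := p.-1 in let u2 := p.-2 in
    let nbr0 (z : nat) := (z %% p < p.-2) || (z == u1) || (z == u2) in
    if (x == u0 :> nat) then (y != u0 :> nat) && nbr0 y
    else if (y == u0 :> nat) then nbr0 x
    else (x %% p != y %% p) &&
         ~~ ([&& x == u1 :> nat & y == u2 :> nat] || [&& x == u2 :> nat & y == u1 :> nat]).

(* Main.v *)
Require Import Defs.
From HB Require Import structures.
From mathcomp Require Import all_boot all_order all_algebra all_fingroup.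
From mathcomp Require Import polyrcf reals.
From mathcomp Require Import ring lra zify.
From mathcomp Require boolp classical_sets topology normedtype derive.
Set Implicit Arguments. Unset Strict Implicit. Unset Printing Implicit Defensive.
Import Order.TTheory GRing.Theory Num.Theory.
Local Open Scope ring_scope.

(* Suppose rho(G) >= rho(Y_p(n)).  In a B_{p,q}-free graph a p-clique has fewer than q common
   neighbours.  With the Perron vector as weight, the weighted Moon-Moser inequalities are therefore
   tight up to O(1/n): the Perron vector is close to constant, and some p-clique K is such that all
   but O(1) vertices are adjacent to all but one vertex of K.  This splits V(G) into p classes of
   internal degree less than q.  The vertices of almost full weight embed greedily like those of a
   complete p-partite graph, so edges inside a class come with about n/p missing edges between
   classes.  Since rho(Y_p(n)) falls short of (1 - 1/p)n by only the loss caused by one vertex which misses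
   one class, there is room for fewer than 7/5 n/p missing edges at any four vertices.  Hence the
   edges inside classes form a star, and for p >= 3 this makes G a subgraph of a blow-up of the join
   of a 5-cycle and K_{p-2}, with no empty class because G is not p-partite.  Among such blow-ups
   moving a single vertex increases rho unless three consecutive classes of the 5-cycle are
   singletons and the others are balanced, and this describes Y_p(n). *)


(** * The Rayleigh principle *)

(** The numbers come from one comparison. Put N = n/p and m = 1/(p-1). The vertex u0 of Y_p(n) loses
    a share m of its neighbours, so its Perron weight is about 1-m and it costs 1-(1-m)^2 in the
    order; this is what a competitor may spend. An edge inside a class needs about N missing edges
    at its ends, two disjoint such edges need 2N, and a triangle of them needs 3N/2, since every two
    of its vertices miss N. Room for 7/5 N, just below 3/2 N, therefore forces a star, and the
    concavity estimate reaches 7/5 because m is at most 1/2, which is p >= 3. The obstacle is the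
    bounded set of exceptional vertices, whose weights and degrees are uncontrolled and at which
    most missing edges may sit. Deleting the worst of them leaves a p-partite graph, and the
    eigenvalue equation prices the deletion at 1-mu^2 per vertex. The last part computes no spectral
    radius exactly. A best blow-up exists by finiteness, Rayleigh quotients exclude all but one list
    of class sizes, and only Y_p(n) itself is estimated, with a test vector. *)

Section QuadraticForm.
Variables (R : realFieldType) (T : finType).
Implicit Types (e : rel T) (x y z : T -> R).

Definition nbsum e x (i : T) : R := \sum_(j | e i j) x j.
Definition qform e x : R := \sum_i x i * nbsum e x i.
Definition sqn x : R := \sum_i x i ^+ 2.

Lemma sqn_ge0 x : 0 <= sqn x.
Proof. by apply: sumr_ge0 => i _; rewrite sqr_ge0. Qed.

Lemma sqn_eq0 x : sqn x = 0 -> forall i, x i = 0.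
Proof.
move=> /eqP; rewrite psumr_eq0 => [/allP h i|i _]; last by rewrite sqr_ge0.
by have := h i (mem_index_enum i); rewrite /= sqrf_eq0 => /eqP.
Qed.

Lemma qform_abs e x : qform e x <= qform e (fun i => `|x i|).
Proof.
apply: ler_sum => i _; apply: le_trans (ler_norm _) _.
by rewrite normrM ler_wpM2l// ler_norm_sum.
Qed.

Lemma sqn_abs x : sqn (fun i => `|x i|) = sqn x.
Proof. by apply: eq_bigr => i _; rewrite real_normK// num_real. Qed.

Lemma nbsum_symm e x y : symmetric e ->
  \sum_i x i * nbsum e y i = \sum_i y i * nbsum e x i.
Proof.
move=> es; under eq_bigr do rewrite big_distrr /= big_mkcond /=.
rewrite exchange_big /=; apply: eq_bigr => j _.
rewrite big_distrr /= [RHS]big_mkcond /=; apply: eq_bigr => i _.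
by rewrite es; case: ifP => // _; rewrite mulrC.
Qed.

Lemma nbsumD e x y i : nbsum e (fun j => x j + y j) i = nbsum e x i + nbsum e y i.
Proof. by rewrite /nbsum big_split. Qed.

Lemma nbsumZ e a x i : nbsum e (fun j => a * x j) i = a * nbsum e x i.
Proof. by rewrite /nbsum mulr_sumr. Qed.

Lemma qformD e x y : symmetric e ->
  qform e (fun j => x j + y j) = qform e x + 2 * (\sum_i y i * nbsum e x i) + qform e y.
Proof.
move=> es; rewrite /qform.
under eq_bigr do rewrite nbsumD mulrDl !mulrDr.
rewrite !big_split /= (nbsum_symm x y es); ring.
Qed.

Lemma qform_delta e x i (t : R) : symmetric e -> irreflexive e ->
  qform e (fun j => x j + t * (j == i)%:R) = qform e x + 2 * t * nbsum e x i.
Proof.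
move=> es ei; rewrite qformD//.
have d (f : T -> R) : \sum_j t * (j == i)%:R * f j = t * f i.
  rewrite (bigD1 i)//= eqxx mulr1 big1 ?addr0// => j /negbTE->.
  by rewrite mulr0 mul0r.
rewrite d (_ : qform e (fun j => t * (j == i)%:R) = 0); first by ring.
rewrite /qform d /nbsum big1 ?mulr0// => j eij.
by case: eqP eij => [->|_ _]; rewrite ?ei ?mulr0.
Qed.

Lemma sqn_delta x i (t : R) :
  sqn (fun j => x j + t * (j == i)%:R) = sqn x + 2 * t * x i + t ^+ 2.
Proof.
rewrite /sqn (bigD1 i)//= [in RHS](bigD1 i)//= eqxx mulr1.
rewrite (eq_bigr (fun j => x j ^+ 2)); last first.
  by move=> j /negbTE->; rewrite mulr0 addr0.
by ring.
Qed.

(** First-order condition at a maximum. As [e] has no loops, changing coordinate [i] by t alters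
    [qform] linearly in t, so a nonzero residual [D] would let a small step of the right sign exceed
    the maximum. *)
Lemma qform_max_eigen e (l : R) x : symmetric e -> irreflexive e ->
  (forall y, qform e y <= l * sqn y) -> qform e x = l * sqn x ->
  forall i, nbsum e x i = l * x i.
Proof.
move=> es ei max xE i; apply/eqP; rewrite eq_sym -subr_eq0; apply/negPn/negP => D0.
(* [L] exceeds both 0 and [l], so the step -D/L is short enough whatever the sign of [l]. *)
set D := _ - _ in D0; pose L := `|l| + 1.
have L0 : 0 < L by rewrite ltr_pwDr.
have lL : l < L by rewrite (le_lt_trans (ler_norm l))// ltrDl.
pose t := - D / L.
have := max (fun j => x j + t * (j == i)%:R).
rewrite qform_delta// sqn_delta xE => h.
have {}h : 0 <= 2 * t * D + l * t ^+ 2 by rewrite /D; lra.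
have D2 : 0 < D ^+ 2 by rewrite exprn_even_gt0.
have : (2 * t * D + l * t ^+ 2) * L ^+ 2 < 0.
  have -> : (2 * t * D + l * t ^+ 2) * L ^+ 2 = D ^+ 2 * (l - L - L).
    by rewrite /t; field; rewrite gt_eqF.
  by rewrite pmulr_rlt0//; lra.
by rewrite ltNge mulr_ge0// exprn_ge0// ltW.
Qed.

End QuadraticForm.

Section Maximum.
Import boolp classical_sets topology normedtype derive.
Import numFieldNormedType.Exports.
Local Open Scope classical_set_scope.
Variables (R : realType) (n : nat).

Lemma qform_max_exists (e : rel 'I_n) : (0 < n)%N ->
  exists x : 'I_n -> R, sqn x = 1 /\ forall y, qform e y <= qform e x * sqn y.
Proof.
move=> n0.
pose f (v : 'rV[R]_n) : R := qform e (fun i => v ord0 i).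
pose g (v : 'rV[R]_n) : R := sqn (fun i => v ord0 i).
have cc i : continuous (fun v : 'rV[R]_n => v ord0 i : R).
  exact: coord_continuous.
have cg : continuous g.
  apply: continuous_big => [|i _ v]; first exact: add_continuous.
  exact: (cvgM (cc i v) (cc i v)).
have cf : continuous f.
  apply: continuous_big => [|i _ v]; first exact: add_continuous.
  have cn : continuous (fun v : 'rV[R]_n => nbsum e (fun k => v ord0 k) i).
    by apply: continuous_big => [|j _]; [exact: add_continuous|exact: cc].
  exact: (cvgM (cc i v) (cn v)).
pose A : set 'rV[R]_n := [set v | g v = 1].
have cA : compact A.
  apply: bounded_closed_compact; last first.
    have -> : A = g @^-1` [set 1] by [].
    by apply: preimage_closed; [move=> v _; exact: cg|exact: closed_eq].
  exists 1; split => // M M1 v /= vA.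
  rewrite /Num.Def.normr /= mx_normrE; apply/bigmax_leP; split => [|[i j] _ /=].
    by apply: ltW; apply: lt_trans M1.
  rewrite (le_trans _ (ltW M1))// -(@ler_pXn2r _ 2)// ?nnegrE// expr1n -vA.
  rewrite real_normK ?num_real// (ord1 i) /g /sqn (bigD1 j)//= lerDl.
  by apply: sumr_ge0 => k _; rewrite sqr_ge0.
have A0 : A !=set0.
  exists (delta_mx ord0 (Ordinal n0)); rewrite /A /g /sqn /= (bigD1 (Ordinal n0))//=.
  rewrite mxE !eqxx expr1n big1 ?addr0// => j /negbTE jn.
  by rewrite mxE jn andbF expr0n.
have [v vA vmax] := compact_EVT_max A0 cA (continuous_subspaceT cf).
rewrite inE in vA; exists (fun i => v ord0 i); split=> // y.
have [y0|y0] := eqVneq (sqn y) 0.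
  rewrite y0 mulr0 /qform big1// => i _.
  by rewrite (sqn_eq0 y0) mul0r.
have sy : 0 < sqn y by rewrite lt_def y0 sqn_ge0.
pose s := (Num.sqrt (sqn y))^-1.
have s0 : 0 < s by rewrite invr_gt0 sqrtr_gt0.
have s2 : s ^+ 2 * sqn y = 1.
  by rewrite /s exprVn sqr_sqrtr ?sqn_ge0// mulVf.
have := vmax (\row_i (s * y i)).
have gE : g (\row_i (s * y i)) = 1.
  by rewrite -s2 /g /sqn mulr_sumr; apply: eq_bigr => i _; rewrite mxE exprMn.
rewrite inE => /(_ gE).
have -> : f (\row_i (s * y i)) = s ^+ 2 * qform e y.
  rewrite /f /qform mulr_sumr; apply: eq_bigr => i _.
  rewrite mxE /nbsum !mulr_sumr; apply: eq_bigr => j _; rewrite mxE; ring.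
move=> h; rewrite -(ler_pM2l (exprn_gt0 2 s0)) mulrCA s2 mulr1; exact: h.
Qed.

End Maximum.

Section SpectralRadius.
Variables (R : realType) (n : nat) (e : rel 'I_n).
Hypotheses (es : symmetric e) (ei : irreflexive e) (n0 : (0 < n)%N).
Local Notation rho := (spec_rad R e).

(** Ties the last real root of the characteristic polynomial to the Rayleigh quotient. A maximiser
    is an eigenvector, so [l] is a root; any root has an eigenvector, whose quotient is at most [l];
    and [rootsR] is increasing. *)
Lemma spec_rad_max (l : R) (x : 'I_n -> R) : sqn x = 1 ->
  (forall y, qform e y <= l * sqn y) -> qform e x = l -> rho = l.
Proof.
move=> x1 max xl.
have eig i : nbsum e x i = l * x i by apply: qform_max_eigen => //; rewrite x1 mulr1.
have p0 : char_poly (adj_mx R e) != 0 by rewrite monic_neq0 ?char_poly_monic.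
have mulE (v : 'rV[R]_n) j : (v *m adj_mx R e) ord0 j = nbsum e (fun i => v ord0 i) j.
  rewrite mxE /nbsum [RHS]big_mkcond; apply: eq_bigr => i _.
  by rewrite mxE es; case: ifP; rewrite ?mulr1 ?mulr0.
have lr : root (char_poly (adj_mx R e)) l.
  rewrite -eigenvalue_root_char; apply/eigenvalueP; exists (\row_i x i).
    apply/rowP => j; rewrite mulE 2!mxE -eig; apply: eq_bigr => i _; by rewrite mxE.
  apply/eqP => /rowP h; have : sqn x = 0.
    by rewrite /sqn big1// => i _; have := h i; rewrite !mxE => ->; rewrite expr0n.
  by rewrite x1 => /eqP; rewrite oner_eq0.
have rl a : root (char_poly (adj_mx R e)) a -> a <= l.
  rewrite -eigenvalue_root_char => /eigenvalueP[v va vn].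
  have sv : 0 < sqn (fun i => v ord0 i).
    rewrite lt_def sqn_ge0 andbT; apply: contra vn => /eqP/sqn_eq0 h.
    by apply/eqP/rowP => j; rewrite h mxE.
  rewrite -(ler_pM2r sv); apply: le_trans (max _).
  rewrite /qform /sqn mulr_sumr; apply: ler_sum => i _.
  by rewrite -mulE va mxE [leRHS]mulrCA -expr2.
have rE a : (a \in rootsR (char_poly (adj_mx R e))) = root (char_poly (adj_mx R e)) a.
  have := roots_on_rootsR p0 => /(_ a) <-.
  by rewrite in_itv.
rewrite /spec_rad.
have so := @sorted_roots R (- cauchy_bound (char_poly (adj_mx R e)))
   (cauchy_bound (char_poly (adj_mx R e))) (char_poly (adj_mx R e)).
rewrite -/(rootsR _) in so.
have lin : l \in rootsR (char_poly (adj_mx R e)) by rewrite rE.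
case: (lastP (rootsR (char_poly (adj_mx R e)))) so lin rE => // s a so lin rE.
rewrite last_rcons; apply/eqP; rewrite eq_le rl /=; last by rewrite -rE mem_rcons inE eqxx.
move: lin; rewrite mem_rcons in_cons => /orP[/eqP->//|ls].
move: so; rewrite lt_sorted_pairwise pairwise_rcons => /andP[/allP/(_ _ ls)/ltW].
by [].
Qed.

Lemma rayleigh (y : 'I_n -> R) : qform e y <= rho * sqn y.
Proof.
have [x [x1 max]] := qform_max_exists R e n0.
by rewrite (spec_rad_max x1 max).
Qed.

(** The source of strictness and uniqueness in [move_vertex] and [subgraph_blow]: a vector with the
    best quotient satisfies every eigenvalue equation, so one violated equation suffices. *)
Lemma rayleigh_eq (x : 'I_n -> R) : qform e x = rho * sqn x ->
  forall i, nbsum e x i = rho * x i.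
Proof. by apply: qform_max_eigen => //; exact: rayleigh. Qed.

(** Absolute values do not decrease the quotient, so those of a maximiser form a maximiser again.
    Only nonnegativity comes out, since [e] may be disconnected; positivity is regained for blow-ups
    in [blow_eigen_pos]. *)
Lemma perron : exists x : 'I_n -> R,
  [/\ forall i, 0 <= x i, sqn x = 1 & forall i, nbsum e x i = rho * x i].
Proof.
have [x [x1 max]] := qform_max_exists R e n0.
exists (fun i => `|x i|); split=> //; first by rewrite sqn_abs.
apply: rayleigh_eq; apply/eqP; rewrite eq_le rayleigh sqn_abs x1 mulr1.
by rewrite (spec_rad_max x1 max) ?qform_abs.
Qed.

End SpectralRadius.

Lemma qform_eigen (R : realFieldType) (T : finType) (e : rel T) (x : T -> R) l :
  (forall i, nbsum e x i = l * x i) -> qform e x = l * sqn x.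
Proof.
move=> h; rewrite /qform /sqn mulr_sumr; apply: eq_bigr => i _.
by rewrite h mulrCA -expr2.
Qed.

Lemma spec_rad_iso_le (R : realType) n (e1 e2 : rel 'I_n) (f : 'I_n -> 'I_n) :
  symmetric e1 -> irreflexive e1 -> symmetric e2 -> irreflexive e2 -> (0 < n)%N ->
  bijective f -> (forall x y, e2 (f x) (f y) = e1 x y) ->
  spec_rad R e2 <= spec_rad R e1.
Proof.
move=> s1 i1 s2 i2 n0 bf fe.
have [x [_ x1 xe]] := perron R s2 i2 n0.
have := rayleigh s1 i1 n0 (x \o f).
have -> : sqn (x \o f) = 1.
  by rewrite -x1 /sqn [RHS](reindex f) //=; exact: onW_bij.
rewrite mulr1; apply: le_trans.
rewrite -[leLHS]mulr1 -x1 -(qform_eigen xe) /qform (reindex f) /=; last exact: onW_bij.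
apply: ler_sum => i _; rewrite le_eqVlt; apply/orP; left; apply/eqP; congr (_ * _).
rewrite /nbsum (reindex f) /=; last exact: onW_bij.
by apply: eq_bigl => j; rewrite fe.
Qed.

Lemma spec_rad_iso (R : realType) n (e1 e2 : rel 'I_n) :
  symmetric e1 -> irreflexive e1 -> symmetric e2 -> irreflexive e2 -> (0 < n)%N ->
  graph_iso e1 e2 -> spec_rad R e1 = spec_rad R e2.
Proof.
move=> s1 i1 s2 i2 n0 [f [bf fe]]; apply/eqP; rewrite eq_le.
rewrite (spec_rad_iso_le R s1 i1 s2 i2 n0 bf fe) andbT.
have [g gf fg] := bf.
apply: (spec_rad_iso_le R s2 i2 s1 i1 n0 (f := g)); first by exists f.
by move=> x y; rewrite -fe !fg.
Qed.

(** * The weighted Moon-Moser inequality *)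

Section CauchySchwarz.
Variables (R : realFieldType) (I : finType) (P : pred I).

Lemma cauchy_schwarz_wgt (w d : I -> R) : (forall i, 0 <= w i) ->
  (\sum_(i | P i) w i * d i) ^+ 2 <=
  (\sum_(i | P i) w i) * (\sum_(i | P i) w i * d i ^+ 2).
Proof.
move=> w0; set W := \sum_(i | P i) w i; set S := \sum_(i | P i) w i * d i.
set Q := \sum_(i | P i) w i * d i ^+ 2.
have W0 : 0 <= W by apply: sumr_ge0 => i _.
have key t : 0 <= t ^+ 2 * W - 2 * t * S + Q.
  suff <- : \sum_(i | P i) w i * (t - d i) ^+ 2 = t ^+ 2 * W - 2 * t * S + Q.
    by apply: sumr_ge0 => i _; rewrite mulr_ge0 ?sqr_ge0.
  rewrite /W /S /Q !mulr_sumr -sumrB -big_split /=.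
  by apply: eq_bigr => i _; ring.
have [W_0|W_neq0] := eqVneq W 0.
  rewrite W_0 mul0r /S big1 ?expr0n// => i Pi.
  move/eqP: W_0; rewrite psumr_eq0// => /allP/(_ i (mem_index_enum i)).
  by rewrite Pi /= => /eqP->; rewrite mul0r.
have Wp : 0 < W by rewrite lt_def W_neq0.
have := key (S / W); rewrite -(pmulr_rge0 _ Wp).
have -> : W * ((S / W) ^+ 2 * W - 2 * (S / W) * S + Q) = W * Q - S ^+ 2 by field.
by rewrite subr_ge0.
Qed.

End CauchySchwarz.

Section MoonMoser.
Variables (R : realFieldType) (T : finType) (e : rel T) (y : T -> R).
Hypotheses (es : symmetric e) (ei : irreflexive e).
Hypotheses (y_ge0 : forall v, 0 <= y v) (y_sum1 : \sum_v y v = 1).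

Definition clique (K : {set T}) := [forall u in K, forall v in K, (u != v) ==> e u v].
Definition cnb (K : {set T}) v := [forall u in K, e u v].

Lemma cliqueP (K : {set T}) :
  reflect {in K &, forall u v, u != v -> e u v} (clique K).
Proof.
apply: (iffP idP) => [/forall_inP h u v uK vK uv|h].
  by have /forall_inP/(_ v vK)/implyP/(_ uv) := h u uK.
by apply/forall_inP => u uK; apply/forall_inP => v vK; apply/implyP; exact: h.
Qed.

Lemma cnbP (K : {set T}) v : reflect {in K, forall u, e u v} (cnb K v).
Proof. exact: forall_inP. Qed.

Lemma cnb_notin (K : {set T}) v : cnb K v -> v \notin K.
Proof. by move=> /cnbP h; apply/negP => /h; rewrite ei. Qed.

Lemma cliqueU1 (K : {set T}) v : clique K -> cnb K v -> clique (v |: K).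
Proof.
move=> /cliqueP cK /cnbP nv; apply/cliqueP => a b; rewrite !inE.
move=> /orP[/eqP->|aK] /orP[/eqP->|bK]; rewrite ?eqxx//; last exact: cK.
  by rewrite es nv.
by rewrite nv.
Qed.

Lemma cliqueD1 (K : {set T}) v : clique K -> v \in K -> clique (K :\ v) && cnb (K :\ v) v.
Proof.
move=> /cliqueP cK vK; apply/andP; split.
  by apply/cliqueP => a b; rewrite !inE => /andP[_ aK] /andP[_ bK]; exact: cK.
by apply/cnbP => a; rewrite !inE => /andP[av aK]; exact: cK.
Qed.

Definition wgt (K : {set T}) : R := \prod_(v in K) y v.
Definition cdeg (K : {set T}) : R := \sum_(v | cnb K v) y v.
(** The clique polynomial of the graph at the point [y]. For uniform [y] it is the number of
    s-cliques divided by n^s. *)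
Definition csum s : R := \sum_(K : {set T} | clique K && (#|K| == s)) wgt K.

Lemma wgt_ge0 K : 0 <= wgt K.
Proof. by apply: prodr_ge0. Qed.

Lemma cdeg_ge0 K : 0 <= cdeg K.
Proof. by apply: sumr_ge0. Qed.

Lemma csum_ge0 s : 0 <= csum s.
Proof. by apply: sumr_ge0 => K _; exact: wgt_ge0. Qed.

(** Double counting: a clique with a common neighbour v is the same thing as a clique one larger
    with a marked vertex v. *)
Lemma clique_ext_sum s (F : {set T} -> T -> R) :
  \sum_(K : {set T} | clique K && (#|K| == s)) \sum_(v | cnb K v) F K v =
  \sum_(K : {set T} | clique K && (#|K| == s.+1)) \sum_(v in K) F (K :\ v) v.
Proof.
rewrite !pair_big_dep /=.
rewrite [RHS](reindex_onto (fun p : {set T} * T => (p.2 |: p.1, p.2))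
                           (fun p : {set T} * T => (p.1 :\ p.2, p.2))) /=; last first.
  by case=> K v /=/andP[_ vK]; rewrite setD1K.
apply: eq_big => [[K v]|[K v]] /=; last first.
  move=> /andP[_ cv]; congr (F _ _); rewrite setU1K//; exact: cnb_notin.
rewrite setU11 andbT xpair_eqE eqxx andbT; apply/idP/idP.
  move=> /andP[/andP[cK sK] cv]; have vK := cnb_notin cv.
  by rewrite cliqueU1// cardsU1 vK (eqP sK) setU1K ?eqxx.
move=> /andP[/andP[cK sK] /eqP dK].
have vK : v \notin K by rewrite -dK setD11.
have := cliqueD1 cK (setU11 v K); rewrite setU1K// => /andP[-> ->].
by move: sK; rewrite cardsU1 vK eqSS => ->.
Qed.

Lemma wgtD1 (K : {set T}) v : v \in K -> wgt K = y v * wgt (K :\ v).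
Proof.
move=> vK; rewrite /wgt (bigD1 v)//=; congr (_ * _).
by apply: eq_bigl => u; rewrite !inE andbC.
Qed.

Lemma csum_cdeg s :
  \sum_(K : {set T} | clique K && (#|K| == s)) wgt K * cdeg K = s.+1%:R * csum s.+1.
Proof.
under eq_bigr do rewrite /cdeg mulr_sumr.
rewrite clique_ext_sum /csum mulr_sumr; apply: eq_bigr => K /andP[_ /eqP sK].
rewrite (eq_bigr (fun=> wgt K)); last by move=> v vK; rewrite mulrC -wgtD1.
by rewrite sumr_const sK mulr_natl.
Qed.

Lemma csum_cdeg2 s :
  \sum_(K : {set T} | clique K && (#|K| == s)) wgt K * cdeg K ^+ 2 =
  \sum_(K : {set T} | clique K && (#|K| == s.+1)) wgt K * \sum_(v in K) cdeg (K :\ v).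
Proof.
under eq_bigr do rewrite expr2 {1}/cdeg mulr_suml mulr_sumr.
rewrite (clique_ext_sum s (fun K v => wgt K * (y v * cdeg K))).
apply: eq_bigr => K _; rewrite mulr_sumr; apply: eq_bigr => v vK.
by rewrite (wgtD1 vK); ring.
Qed.

(* A vertex which is not joined to all of K extends at most one of the K :\ v. *)
Lemma cdegD1_sum (K : {set T}) s : #|K| = s.+1 ->
  \sum_(v in K) cdeg (K :\ v) <= 1 + s%:R * cdeg K.
Proof.
move=> sK; rewrite /cdeg.
under eq_bigr do rewrite big_mkcond /=.
rewrite exchange_big /= -[X in _ <= X + _]y_sum1 (big_mkcond (cnb K)) mulr_sumr -big_split /=.
apply: ler_sum => u _; rewrite -big_mkcondr /= sumr_const.
case: ifP => [_|/negP ncu].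
  apply: (@le_trans _ _ (y u *+ s.+1)); last by rewrite mulrSr addrC mulr_natl.
  by apply: ler_wpMn2l => //; rewrite -sK; apply: subset_leq_card; apply/subsetP => v /andP[].
rewrite mulr0 addr0 -[leRHS]mulr1n; apply: ler_wpMn2l => //.
have [v vK nv] : exists2 v, v \in K & ~~ e v u.
  by apply/exists_inP; rewrite -[X in is_true X]negbK negb_exists_in; apply/negP => h;
     apply: ncu; apply/forall_inP => v /(forall_inP h); rewrite negbK.
rewrite -(card1 v); apply: subset_leq_card; apply/subsetP => w /andP[wK /cnbP cw].
rewrite !inE; apply: contraR nv => vw; apply: cw; by rewrite !inE eq_sym vw.
Qed.

(** Cauchy-Schwarz compares the first and second moments of [cdeg] over s-cliques. The second moment
    becomes a sum over (s+1)-cliques of [cdeg (K :\ v)], where [cdegD1_sum] applies. *)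
Lemma moon_moser s :
  (s.+1%:R * csum s.+1) ^+ 2 <= csum s * (csum s.+1 + s%:R * s.+2%:R * csum s.+2).
Proof.
rewrite -(csum_cdeg s); apply: le_trans (cauchy_schwarz_wgt _ _ wgt_ge0) _.
rewrite -/(csum s) csum_cdeg2; apply: ler_wpM2l; first exact: csum_ge0.
rewrite -mulrA -(csum_cdeg s.+1) /csum mulr_sumr -big_split /=.
apply: ler_sum => K /andP[_ /eqP sK]; rewrite mulrCA -[X in _ <= X + _]mulr1 -mulrDr.
by apply: ler_wpM2l; [exact: wgt_ge0|exact: cdegD1_sum].
Qed.

Lemma csum1 : csum 1 = 1.
Proof.
have := csum_cdeg 0; rewrite mul1r => <-.
rewrite (bigD1 set0) /=; last first.
  by rewrite cards0 eqxx andbT; apply/cliqueP => u v; rewrite inE.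
rewrite big1 ?addr0 => [|K /andP[/andP[_]]]; last first.
  by rewrite cards_eq0 => /eqP->; rewrite eqxx.
rewrite /wgt big_set0 mul1r -y_sum1 /cdeg; apply: eq_bigl => v.
by apply/cnbP => u; rewrite inE.
Qed.

(** One minus the Motzkin-Straus form. The balanced complete p-partite graph with uniform [y] has
    defect 1/p; it turns [csum_ratio] into an equality, whose two sides vanish at s = p. *)
Definition defect : R := 1 - qform e y.

Lemma csum2 : 2%:R * csum 2 = 1 - defect.
Proof.
have -> : 1 - defect = qform e y by rewrite /defect; ring.
rewrite -(csum_cdeg 1).
have := clique_ext_sum 0 (fun K v => y v * cdeg (v |: K)).
rewrite (bigD1 set0) /=; last first.
  by rewrite cards0 eqxx andbT; apply/cliqueP => u v; rewrite inE.
rewrite [X in _ + X]big1 ?addr0 => [|K /andP[/andP[_]]]; last first.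
  by rewrite cards_eq0 => /eqP->; rewrite eqxx.
have -> : \sum_(v | cnb set0 v) y v * cdeg (v |: set0) = qform e y.
  rewrite /qform; apply: eq_big => [v|v _]; first by apply/cnbP => u; rewrite inE.
  congr (_ * _); apply: eq_bigl => w; rewrite setU0; apply/cnbP/idP => [h|vw u].
    by apply: h; rewrite inE.
  by rewrite inE => /eqP->.
move=> ->; apply: eq_bigr => K /andP[_ /cards1P[v ->]].
by rewrite big_set1 setD1K ?set11// /wgt big_set1.
Qed.

(** For the ratio r_s = (s+1) csum(s+1) / csum(s), [moon_moser] reads (s+1) r_s <= 1 + s r_(s+1).
    Starting from r_1 = 1 - defect, each step loses one more defect, and positivity carries along as
    long as the bound is positive. *)
Lemma csum_ratio s : (0 < s)%N -> s%:R * defect < 1 ->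
  0 < csum s /\ (1 - s%:R * defect) * csum s <= s.+1%:R * csum s.+1.
Proof.
elim: s => // -[_ _ _|s IH _ lt1].
  by rewrite csum1 csum2 mul1r mulr1 ltr01.
have d1 : s.+1%:R * defect < 1.
  have [d0|d0] := lerP defect 0; first by rewrite (@le_lt_trans _ _ 0) ?mulr_ge0_le0.
  by apply: lt_trans lt1; rewrite ltr_pM2r// ltr_nat.
have [E0 IHs] := IH isT d1.
have mm := moon_moser s.+1.
set E1 := csum s.+1 in E0 IHs mm *; set E2 := csum s.+2 in IHs mm *.
set E3 := csum s.+3 in mm *; set a := s.+1%:R : R in d1 IHs mm.
have a0 : 0 < a by rewrite ltr0n.
have b0 : (0 : R) < s.+2%:R by rewrite ltr0n.
have E20 : 0 < E2.
  by rewrite -(pmulr_rgt0 _ b0); apply: lt_le_trans IHs; rewrite mulr_gt0// subr_gt0.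
split=> //.
have E30 : 0 <= E3 by exact: csum_ge0.
have bE : s.+2%:R = a + 1 :> R by rewrite -natr1.
have cE : s.+3%:R = a + 2 :> R by rewrite -[LHS]natr1 bE -addrA.
rewrite bE in IHs mm *; rewrite cE in mm *.
have h1 : (1 - a * defect) * ((a + 1) * E2) ^+ 2 <=
          (a + 1) * E2 * (E2 + a * (a + 2) * E3).
  apply: le_trans (_ : (1 - a * defect) * (E1 * (E2 + a * (a + 2) * E3)) <= _).
    by rewrite ler_wpM2l// subr_ge0 ltW.
  have a2 : 0 < a + 2 by lra.
  by rewrite mulrA ler_wpM2r// addr_ge0 ?(ltW E20)// mulr_ge0// mulr_ge0// ltW.
rewrite -(ler_pM2l (mulr_gt0 (mulr_gt0 (addr_gt0 a0 ltr01) E20) a0)).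
lra.
Qed.

(** Cauchy-Schwarz over (p-1)-cliques bounds the average of this sum over p-cliques from below, and
    some clique reaches the average. For defect near 1/p the bound is near 1, so once few vertices
    see all of K, nearly all weight sees all but one vertex of K. *)
Lemma exists_spread_clique p : (1 < p)%N -> p.-1%:R * defect < 1 ->
  exists K : {set T}, [/\ clique K, #|K| = p &
    p%:R * (1 - p.-1%:R * defect) <= \sum_(v in K) cdeg (K :\ v)].
Proof.
case: p => // -[//|s] _; rewrite -pred_Sn => lt1.
have [E1 r] := csum_ratio (ltn0Sn s) lt1.
have d0 : 0 < 1 - s.+1%:R * defect by rewrite subr_gt0.
have E2 : 0 < csum s.+2.
  by rewrite -(@pmulr_rgt0 _ s.+2%:R) ?ltr0n//; apply: lt_le_trans r; rewrite mulr_gt0.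
have cs := cauchy_schwarz_wgt (fun K : {set T} => clique K && (#|K| == s.+1)) cdeg wgt_ge0.
rewrite csum_cdeg -/(csum _) csum_cdeg2 in cs.
set S := \sum_(K : {set T} | _) wgt K * \sum_(v in K) _ in cs.
set X := s.+2%:R * (1 - s.+1%:R * defect).
have SX : csum s.+2 * X <= S.
  have bE : (0 : R) < s.+2%:R * csum s.+2 by rewrite mulr_gt0 ?ltr0n.
  rewrite -(ler_pM2l bE); apply: le_trans (_ : (1 - s.+1%:R * defect) * (csum s.+1 * S) <= _).
    apply: le_trans (ler_wpM2l (ltW d0) cs); rewrite /X; lra.
  rewrite mulrA; apply: ler_wpM2r => //.
  by apply: sumr_ge0 => K _; rewrite mulr_ge0 ?wgt_ge0// sumr_ge0// => v _; exact: cdeg_ge0.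
have [/existsP[K /andP[/andP[cK /eqP sK] h]]|noK] := boolP
  [exists K : {set T}, (clique K && (#|K| == s.+2)) && (X <= \sum_(v in K) cdeg (K :\ v))].
  by exists K.
(* If no clique reached the bound, a sum of nonnegative terms would be at most 0, so every p-clique
   would have weight 0. *)
suff E20 : csum s.+2 = 0 by rewrite E20 ltxx in E2.
have lt K : clique K && (#|K| == s.+2) -> \sum_(v in K) cdeg (K :\ v) < X.
  by move=> hK; rewrite ltNge; apply: contra noK => h; apply/existsP; exists K; rewrite hK.
have z : \sum_(K : {set T} | clique K && (#|K| == s.+2))
    wgt K * (X - \sum_(v in K) cdeg (K :\ v)) = 0.
  apply/eqP; rewrite eq_le sumr_ge0 ?andbT => [|K hK]; last first.
    by rewrite mulr_ge0 ?wgt_ge0// subr_ge0 ltW// lt.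
  under eq_bigr do rewrite mulrBr.
  by rewrite sumrB -mulr_suml -/(csum _) -/S subr_le0.
move/eqP: z; rewrite psumr_eq0 => [/allP z|K hK]; last first.
  by rewrite mulr_ge0 ?wgt_ge0// subr_ge0 ltW// lt.
rewrite /csum big1// => K hK; have := z K (mem_index_enum K); rewrite hK /=.
by rewrite mulf_eq0 subr_eq0 [X == _](gt_eqF (lt K hK)) orbF => /eqP.
Qed.

(** The average of [cdeg] over p-cliques is the ratio r_p of [csum_ratio], hence at least 1 - p
    defect; and no average exceeds [b]. *)
Lemma defect_lower p b : (0 < p)%N -> (forall K, clique K -> #|K| = p -> cdeg K <= b) ->
  p%:R * defect < 1 -> 1 - b <= p%:R * defect.
Proof.
move=> p0 hb lt1; have [E1 r] := csum_ratio p0 lt1.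
suff : (1 - p%:R * defect) * csum p <= b * csum p by rewrite ler_pM2r//; lra.
apply: le_trans r _; rewrite -csum_cdeg /csum mulr_sumr; apply: ler_sum => K /andP[cK /eqP sK].
by rewrite mulrC ler_wpM2r ?wgt_ge0 ?hb.
Qed.

End MoonMoser.

(** * Spectral stability *)

Lemma book_free_cnb p q n (e : rel 'I_n) : simple_graph e ->
  ~ contains_subgraph (@B_adj p q) e ->
  forall K : {set 'I_n}, clique e K -> #|K| = p -> (#|[set v | cnb e K v]| < q)%N.
Proof.
move=> [ei es] nB K cK sK; rewrite ltnNge; apply/negP => hq; apply: nB.
set Z := [set v | cnb e K v] in hq.
pose fK (i : 'I_p) : 'I_n := enum_val (cast_ord (esym sK) i).
pose fZ (j : 'I_q) : 'I_n := enum_val (widen_ord hq j).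
pose f (x : 'I_(p + q)) := match split x with inl i => fK i | inr j => fZ j end.
have fKK i : fK i \in K by apply: enum_valP.
have fZZ j : cnb e K (fZ j) by have := enum_valP (widen_ord hq j); rewrite inE.
have KZ i j : e (fK i) (fZ j) by have /cnbP := fZZ j; apply.
have fKi : injective fK by move=> i j /enum_val_inj/cast_ord_inj.
have fZi : injective fZ.
  by move=> i j /enum_val_inj /(congr1 val)/= h; apply: val_inj.
exists f; split=> [x y|x y].
  rewrite /f; case: splitP => i xi; case: splitP => j yj.
  - by move=> /fKi ij; apply: val_inj; rewrite /= xi yj ij.
  - by move=> h; have := KZ i j; rewrite h (negbTE (ei _)).
  - by move=> h; have := KZ j i; rewrite h (negbTE (ei _)).
  - by move=> /fZi ij; apply: val_inj; rewrite /= xi yj ij.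
rewrite /B_adj /f => /andP[xy]; case: splitP => i xi; case: splitP => j yj xp.
- move/cliqueP: cK; apply=> //; apply: contra xy => /eqP/fKi ij.
  by apply/eqP/val_inj; rewrite /= xi yj ij.
- exact: KZ.
- by rewrite es; exact: KZ.
- by [].
Qed.

Section Stability.
Variables (R : realFieldType) (T : finType) (e : rel T) (p q : nat).
Hypotheses (es : symmetric e) (ei : irreflexive e) (p3 : (3 <= p)%N).
Hypothesis few_cnb : forall K : {set T}, clique e K -> #|K| = p ->
  (#|[set v | cnb e K v]| < q)%N.
Variables (rho : R) (mu : T -> R).
Local Notation nn := (#|T|%:R : R).
Local Notation P := (p%:R : R).
Local Notation Q := (q%:R : R).
Hypothesis mu_ge0 : forall v, 0 <= mu v.
Hypothesis mu_sqn : sqn mu = nn.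
Hypothesis mu_eig : forall v, nbsum e mu v = rho * mu v.
Hypothesis rho_ge : (P - 1) * nn - P <= P * rho.
Hypothesis n_ge : P * P + 6 < nn.

Local Notation sigma := (\sum_v mu v).

Let P3 : 3 <= P. Proof. by rewrite ler_nat. Qed.
Let Q0 : 0 <= Q. Proof. exact: ler0n. Qed.
Let nn6 : 15 < nn. Proof. by have := P3; have := n_ge; nra. Qed.

Lemma rho_ge_half : nn / 2 <= rho.
Proof. have := P3; have := rho_ge; have := nn6; nra. Qed.

(** With [mu] scaled to squared norm n, a constant vector has entries 1. The identity turns a lower
    bound on the sum of the entries into an L2 distance from constant. *)
Lemma sqn_sub1 : \sum_v (mu v - 1) ^+ 2 = 2 * (nn - sigma).
Proof.
transitivity (\sum_v (mu v ^+ 2 + (1 - 2 * mu v))); first by apply: eq_bigr => v _; ring.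
rewrite big_split /= sumrB -/(sqn mu) mu_sqn -mulr_sumr sumr_const; ring.
Qed.

Lemma sigma_le : sigma <= nn.
Proof.
have : 0 <= \sum_v (mu v - 1) ^+ 2 by apply: sumr_ge0 => v _; exact: sqr_ge0.
by rewrite sqn_sub1; lra.
Qed.

Lemma mu_le2 v : mu v <= 2.
Proof.
have h : rho * mu v <= nn.
  rewrite -mu_eig; apply: le_trans sigma_le; rewrite /nbsum [leRHS](bigID (e v)) /=.
  by rewrite lerDl sumr_ge0.
have r := rho_ge_half; have m0 := mu_ge0 v; have := nn6; nra.
Qed.

Lemma sigma_ge : nn / 2 <= sigma.
Proof.
rewrite -mu_sqn /sqn mulr_suml; apply: ler_sum => v _.
have := mu_le2 v; have := mu_ge0 v; nra.
Qed.

Local Notation y := (fun v => mu v / sigma).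

Let s0 : 0 < sigma. Proof. by have := sigma_ge; have := nn6; lra. Qed.

Lemma y_ge0 v : 0 <= y v.
Proof. by rewrite divr_ge0// ltW. Qed.

Lemma y_sum1 : \sum_v y v = 1.
Proof. by rewrite -mulr_suml divff// gt_eqF. Qed.

Lemma y_le v : y v <= 4 / nn.
Proof.
have n0 : 0 < nn by have := nn6; lra.
rewrite ler_pdivrMr// mulrAC ler_pdivlMr//.
have := mu_le2 v; have := mu_ge0 v; have := sigma_ge; have := nn6; nra.
Qed.

Lemma defectE : defect e y = 1 - rho * nn / sigma ^+ 2.
Proof.
rewrite /defect; congr (_ - _); rewrite -mu_sqn /sqn /qform mulr_sumr mulr_suml.
apply: eq_bigr => v _; have -> : nbsum e y v = nbsum e mu v / sigma.
  by rewrite /nbsum mulr_suml.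
by rewrite mu_eig; field; rewrite gt_eqF.
Qed.

Lemma cdeg_clique_le K : clique e K -> #|K| = p -> cdeg e y K <= Q * (4 / nn).
Proof.
move=> cK sK; rewrite /cdeg; apply: le_trans (_ : \sum_(v | cnb e K v) (4 / nn) <= _).
  by apply: ler_sum => v _; exact: y_le.
rewrite sumr_const -[leLHS]mulr_natl; apply: ler_wpM2r.
  by rewrite divr_ge0.
by rewrite ler_nat ltnW// -cardsE few_cnb.
Qed.

(** Few common neighbours give p defect >= 1 - O(1/n), while defect = 1 - rho n / sigma^2 and rho >=
    (1-1/p)n - 1. Together they put sigma within a constant of n, so the L2 distance is bounded
    uniformly in n. *)
Lemma sum_dev_le : \sum_v (mu v - 1) ^+ 2 <= 8 * Q + 2 * P.
Proof.
rewrite sqn_sub1.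
have h : 1 - Q * (4 / nn) <= P * defect e y.
  have [l1|] := ltP (P * defect e y) 1; last by have : 0 <= Q * (4 / nn); [rewrite mulr_ge0 ?divr_ge0|lra].
  apply: (defect_lower es ei y_ge0 y_sum1) => //; first by rewrite (leq_trans _ p3).
  exact: cdeg_clique_le.
rewrite defectE in h.
have ss := sigma_le; have sg := sigma_ge; have n6 := nn6.
have s20 : 0 < sigma ^+ 2 by rewrite exprn_gt0.
move: h; rewrite -(ler_pM2r s20).
have -> : P * (1 - rho * nn / sigma ^+ 2) * sigma ^+ 2 = P * sigma ^+ 2 - P * rho * nn.
  by field; rewrite gt_eqF.
have h1 : Q * (4 / nn) * sigma ^+ 2 <= 4 * Q * nn.
  have -> : 4 * Q * nn = Q * (4 / nn) * nn ^+ 2 by field; lra.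
  apply: ler_wpM2l; first by rewrite mulr_ge0 ?divr_ge0.
  by rewrite -subr_ge0 subr_sqr mulr_ge0//; lra.
have h2 : ((P - 1) * nn - P) * nn <= P * rho * nn by rewrite ler_wpM2r//; lra.
move=> h; have h3 : (P - 1) * ((nn - sigma) * (nn + sigma)) <= (4 * Q + P) * nn by lra.
have h4 : (nn - sigma) * nn <= (P - 1) * ((nn - sigma) * (nn + sigma)).
  rewrite mulrCA; apply: ler_wpM2l; first lra. have := P3; nra.
have h5 : (nn - sigma) * nn <= (4 * Q + P) * nn by apply: le_trans h3.
move: h5; rewrite ler_pM2r; lra.
Qed.

(** [rho * mu v] is the sum of [mu] over the neighbours of v. Replacing each entry by 1 costs O(sqrt
    n) by Cauchy-Schwarz, so entries are governed by degrees. *)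
Lemma deg_dev v : (rho * mu v - #|[set u | e v u]|%:R) ^+ 2 <= nn * (8 * Q + 2 * P).
Proof.
rewrite -mu_eig /nbsum cardsE -sum1_card natr_sum -sumrB.
have := @cauchy_schwarz_wgt _ _ (e v) (fun=> 1) (fun u => mu u - 1) (fun=> ler01).
under eq_bigr do rewrite mul1r.
under [X in _ <= _ * X -> _]eq_bigr do rewrite mul1r.
move=> h; apply: le_trans h _; apply: ler_pM.
- exact: sumr_ge0.
- by apply: sumr_ge0 => u _; exact: sqr_ge0.
- by rewrite sumr_const ler_nat max_card.
- apply: le_trans sum_dev_le; rewrite [leRHS](bigID (e v)) /= lerDl.
  by apply: sumr_ge0 => u _; exact: sqr_ge0.
Qed.

Lemma defect_upper : P * defect e y <= 1 + P / nn.
Proof.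
have n0 : 0 < nn by have := nn6; lra.
have s20 : 0 < sigma ^+ 2 by rewrite exprn_gt0.
have r0 : 0 <= rho by have := rho_ge_half; lra.
have : rho / nn <= rho * nn / sigma ^+ 2.
  rewrite -mulrA; apply: ler_wpM2l => //; rewrite ler_pdivlMr// mulrC ler_pdivrMr//.
  by rewrite -expr2 -subr_ge0 subr_sqr mulr_ge0//; have := sigma_le; have := s0; lra.
rewrite defectE => h; apply: le_trans (_ : P * (1 - rho / nn) <= _).
  by rewrite ler_wpM2l//; have := P3; lra.
rewrite -(ler_pM2r n0); have -> : P * (1 - rho / nn) * nn = P * nn - P * rho by field; rewrite gt_eqF.
have -> : (1 + P / nn) * nn = nn + P by field; rewrite gt_eqF.
by have := rho_ge; lra.
Qed.

(** A covered vertex misses at most one vertex of K, and it will join the class of that vertex. *)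
Definition covered (K : {set T}) u := [exists v in K, cnb e (K :\ v) u].

(** In the sum of [exists_spread_clique] a covered vertex counts once, or p times if it is joined to
    all of K, which happens for fewer than q vertices. The sum is at least 1 - p^2/n, so uncovered
    vertices carry only O(1) of [mu]. *)
Lemma spread_clique : exists K : {set T}, [/\ clique e K, #|K| = p &
  \sum_(u | ~~ covered K u) mu u <= P ^+ 2 + 4 * P * Q].
Proof.
have n0 : 0 < nn by have := nn6; lra.
have dl := defect_upper; have p3' := P3.
have pm : p.-1%:R = P - 1 :> R by rewrite -subn1 natrB// (leq_trans _ p3).
have sm : P / nn < 1 / P by rewrite ltr_pdivrMr// mulrAC ltr_pdivlMr; have := n_ge; lra.
have d0 : defect e y <= (1 + P / nn) / P by rewrite ler_pdivlMr; lra.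
have d1 : (P - 1) * defect e y < 1.
  apply: le_lt_trans (ler_wpM2l _ d0) _; first by lra.
  rewrite mulrA ltr_pdivrMr; last lra.
  have : P * (P / nn) < 1 by rewrite mulrC -ltr_pdivlMr; lra.
  have : 0 <= P / nn by rewrite divr_ge0//; lra.
  lra.
have [||K [cK sK hK]] := exists_spread_clique es ei y_ge0 y_sum1 (p := p); first by rewrite (leq_trans _ p3).
  by rewrite pm.
exists K; split=> //.
have h1 : 1 - P ^+ 2 / nn <= \sum_(v in K) cdeg e y (K :\ v).
  apply: le_trans hK; rewrite pm.
  have : (P - 1) * (P * defect e y) <= (P - 1) * (1 + P / nn) by rewrite ler_wpM2l//; lra.
  have : 0 <= P / nn by rewrite divr_ge0//; lra.
  by rewrite expr2; lra.
have h2 : \sum_(v in K) cdeg e y (K :\ v) <=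
    \sum_(u | covered K u) y u + P * \sum_(u | cnb e K u) y u.
  rewrite /cdeg; under eq_bigr do rewrite big_mkcond /=.
  rewrite exchange_big /= (big_mkcond (covered K)) (big_mkcond (cnb e K)) mulr_sumr -big_split /=.
  apply: ler_sum => u _; rewrite -big_mkcondr /= sumr_const.
  have yu := y_ge0 u; rewrite -[leLHS]mulr_natl.
  have le1 (c : nat) (a : R) : c%:R <= a -> c%:R * (mu u / sigma) <= a * (mu u / sigma).
    by move=> ca; rewrite ler_wpM2r.
  case: ifP => [cu|cu]; case: ifP => [ku|ku].
  - apply: le_trans (le1 _ P _) _; last by rewrite lerDr.
    by rewrite ler_nat -sK; apply: subset_leq_card; apply/subsetP => v /andP[].
  - rewrite mulr0 addr0 -[leRHS]mul1r; apply: le1; rewrite (ler_nat _ _ 1).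
    have [v vK nv] : exists2 v, v \in K & ~~ e v u.
      by move/negbT: ku; rewrite negb_forall => /existsP[v]; rewrite negb_imply => /andP[]; exists v.
    rewrite -(card1 v); apply: subset_leq_card; apply/subsetP => w /andP[wK /cnbP cw].
    by rewrite !inE; apply: contraR nv => vw; apply: cw; rewrite !inE eq_sym vw.
  - case/negP: (negbT cu); have [v vK] : exists v, v \in K by apply/set0Pn; rewrite -card_gt0 sK (leq_trans _ p3).
    rewrite /covered; apply/exists_inP; exists v => //; apply/cnbP => w; rewrite inE => /andP[_ wK].
    by move/cnbP: ku; apply.
  - rewrite mulr0 addr0 (_ : #|_| = 0%N) ?mul0r//; apply: eq_card0 => v; apply/negP => /andP[vK cv].
    by case/negP: (negbT cu); rewrite /covered; apply/exists_inP; exists v.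
have h3 : \sum_(u | cnb e K u) y u <= Q * (4 / nn) by exact: cdeg_clique_le.
have h4 : \sum_(u | covered K u) y u + \sum_(u | ~~ covered K u) y u = 1.
  by rewrite -y_sum1 [RHS](bigID (covered K)).
have h5 : \sum_(u | ~~ covered K u) y u <= (P ^+ 2 + 4 * P * Q) / nn.
  have : P * \sum_(u | cnb e K u) y u <= P * (Q * (4 / nn)) by rewrite ler_wpM2l//; lra.
  by lra.
have -> : \sum_(u | ~~ covered K u) mu u = sigma * \sum_(u | ~~ covered K u) y u.
  by rewrite -mulr_suml mulrCA divff ?mulr1// gt_eqF.
apply: le_trans (ler_wpM2l (ltW s0) h5) _; rewrite mulrCA -[leRHS]mulr1.
apply: ler_wpM2l; first by rewrite addr_ge0 ?mulr_ge0 ?exprn_ge0//; lra.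
by rewrite ler_pdivrMr// mul1r sigma_le.
Qed.

(** Colour a covered vertex v by the vertex of K that it may miss. Exchanging that vertex for v
    gives another p-clique, and the neighbours of v in its own class are common neighbours of this
    clique. Vertices outside [G] are few, by Chebyshev for small entries and by Markov for uncovered
    vertices. *)
Lemma stable_colouring (eps : R) : 0 < eps -> eps <= 1 / 2 ->
  exists (c : T -> 'I_p) (G : {set T}),
  [/\ #|~: G|%:R <= (8 * Q + 2 * P) / eps ^+ 2 + 2 * (P ^+ 2 + 4 * P * Q),
      {in G, forall v, 1 - eps <= mu v} &
      {in G, forall v, (#|[set u in G | (c u == c v) && e v u]| <= q)%N}].
Proof.
move=> eps0 epsh; have [K [cK sK hK]] := spread_clique.
have p0 : (0 < p)%N by rewrite (leq_trans _ p3).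
pose k (i : 'I_p) : T := enum_val (cast_ord (esym sK) i).
have kK i : k i \in K by exact: enum_valP.
(* Uncovered vertices get colour 0 and are kept out of [G]. *)
pose c u : 'I_p := odflt (Ordinal p0) [pick i | cnb e (K :\ k i) u].
have cP u : covered K u -> cnb e (K :\ k (c u)) u.
  rewrite /covered => /exists_inP[v vK cv]; rewrite /c; case: pickP => //= /(_ (cast_ord sK (enum_rank_in vK v))).
  by rewrite /k cast_ordK enum_rankK_in// cv.
pose G := [set u | covered K u && (1 - eps <= mu u)].
exists c, G; split.
- pose A := [set u | mu u < 1 - eps]; pose B := [set u | ~~ covered K u & 1 / 2 <= mu u].
  have sub : ~: G \subset A :|: B.
    apply/subsetP => u; rewrite !inE negb_and -ltNge => /orP[->|->//].
    by have [h|h] := ltP (mu u) (1 - eps) => //=; lra.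
  apply: le_trans (_ : (#|A| + #|B|)%:R <= _).
    by rewrite ler_nat (leq_trans (subset_leq_card sub))// cardsU leq_subr.
  rewrite natrD; apply: lerD.
    rewrite ler_pdivlMr ?exprn_gt0//; apply: le_trans sum_dev_le.
    rewrite [leRHS](bigID (mem A)) /= -[leLHS]addr0; apply: lerD; last first.
      by apply: sumr_ge0 => u _; exact: sqr_ge0.
    rewrite mulrC mulr_natr -sumr_const; apply: ler_sum => u; rewrite inE => h.
    by rewrite -subr_ge0 subr_sqr -[leRHS]mulrNN mulr_ge0//; lra.
  rewrite -ler_pdivrMl//; apply: le_trans hK.
  rewrite [leRHS](bigID (fun u => u \in B)) /= -[leLHS]addr0; apply: lerD; last exact: sumr_ge0.
  rewrite mulr_natr -sumr_const [leRHS](eq_bigl (mem B)); last first.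
    by move=> u; rewrite !inE; case: covered.
  by apply: ler_sum => u; rewrite !inE => /andP[_]; lra.
- by move=> v; rewrite inE => /andP[].
- move=> v; rewrite inE => /andP[/cP cv _].
  have cK' : clique e (v |: K :\ k (c v)).
    by apply: cliqueU1 => //; have /andP[] := cliqueD1 cK (kK (c v)).
  have sK' : #|v |: K :\ k (c v)| = p.
    rewrite cardsU1 (cnb_notin ei cv); have := cardsD1 (k (c v)) K; by rewrite kK sK => <-.
  apply: leq_trans (ltnW (few_cnb cK' sK')); apply: subset_leq_card; apply/subsetP => u.
  rewrite !inE => /andP[/andP[/cP cu _] /andP[/eqP cuv vu]].
  apply/cnbP => w; rewrite !inE => /orP[/eqP->//|h].
  by move/cnbP: cu; apply; rewrite !inE cuv.
Qed.

End Stability.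

(** * Greedy embedding and missing edges *)

Section Greedy.
Variables (R : realFieldType) (T : finType) (e : rel T) (p q : nat).
Hypotheses (es : symmetric e) (ei : irreflexive e) (p3 : (3 <= p)%N).
Hypothesis few_cnb : forall K : {set T}, clique e K -> #|K| = p ->
  (#|[set v | cnb e K v]| < q)%N.
Variables (c0 : T -> 'I_p) (G : {set T}) (N u : R).
Local Notation nn := (#|T|%:R : R).
Local Notation P := (p%:R : R).
Local Notation Q := (q%:R : R).
Hypothesis nnE : nn = P * N.
Hypothesis uE : N = 6000 * P ^+ 2 * u.
Hypothesis u_ge : Q + #|~: G|%:R + 1 <= u.
Hypothesis deg_ge : {in G, forall v, nn - N - 3 * u <= #|[set w | e v w]|%:R}.
Hypothesis inner_le :
  {in G, forall v, (#|[set w in G | (c0 w == c0 v) && e v w]| <= q)%N}.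

Local Notation d1 := (6 * P * u).
Local Notation d2 := (12 * P ^+ 2 * u).

Definition gclass (c : T -> 'I_p) i := [set v in G | c v == i].

Lemma P_ge3 : 3 <= P. Proof. by rewrite ler_nat. Qed.
Lemma u_ge1 : 1 <= u.
Proof. by have := ler0n R q; have := ler0n R #|~: G|; have := u_ge; lra. Qed.
Lemma Pu_ge : 3 * u <= P * u.
Proof. by rewrite ler_wpM2r ?P_ge3//; have := u_ge1; lra. Qed.
Lemma PPu_ge : 3 * (P * u) <= P ^+ 2 * u.
Proof.
rewrite expr2 -mulrA; apply: ler_wpM2r; last exact: P_ge3.
by have := Pu_ge; have := u_ge1; lra.
Qed.
Lemma Q_le : Q <= u - 1.
Proof. by have := ler0n R #|~: G|; have := u_ge; lra. Qed.

Lemma card_le_cover (A B D : {set T}) : A \subset B :|: D ->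
  #|A|%:R <= #|B|%:R + #|D|%:R :> R.
Proof.
move=> /subset_leq_card h; rewrite -natrD ler_nat (leq_trans h)// cardsU leq_subr//.
Qed.

Lemma card_setC (A : {set T}) : #|~: A|%:R = nn - #|A|%:R :> R.
Proof. by rewrite -(cardsC A) natrD; ring. Qed.

(** A good vertex misses only about N vertices, among them all but q of its own class. The unit [u],
    a tiny multiple of n, absorbs all bounded errors; [d2] is N/500. *)
Lemma gclass_le i : #|gclass c0 i|%:R <= N + 4 * u.
Proof.
have [E|[v]] := set_0Vmem (gclass c0 i).
  by rewrite E cards0; have := uE; have := u_ge1; have := PPu_ge; have := Pu_ge; lra.
rewrite inE => /andP[vG /eqP vi].
have h := @card_le_cover [set w | e v w] (~: gclass c0 i)
   [set w in G | (c0 w == c0 v) && e v w].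
have {h}h : #|[set w | e v w]|%:R <= nn - #|gclass c0 i|%:R + Q.
  apply: le_trans (h _) _; last by rewrite card_setC lerD2l ler_nat inner_le.
  by apply/subsetP => w; rewrite !inE vi => ->; rewrite andbT orNb.
by have := deg_ge vG; have := Q_le; lra.
Qed.

Lemma sum_gclass (c : T -> 'I_p) : \sum_i #|gclass c i|%:R = #|G|%:R :> R.
Proof.
rewrite -natr_sum -sum1_card (partition_big c predT)//=; congr _%:R.
by apply: eq_bigr => i _; rewrite -sum1_card; apply: eq_bigl => v; rewrite inE.
Qed.

Lemma gclass_ge i : N - 4 * P * u <= #|gclass c0 i|%:R.
Proof.
have := sum_gclass c0; rewrite (bigD1 i)//=.
have : \sum_(j | j != i) #|gclass c0 j|%:R <= (P - 1) * (N + 4 * u).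
  apply: le_trans (ler_sum _ (fun j _ => gclass_le j)) _.
  rewrite sumr_const cardC1 card_ord -[leLHS]mulr_natl -subn1 natrB//.
  by rewrite (leq_trans _ p3).
have := card_setC G; have := u_ge; have := u_ge1; have := nnE; have := ler0n R q; lra.
Qed.

Lemma cross_miss v : v \in G ->
  #|[set w in G | (c0 w != c0 v) && ~~ e v w]|%:R <= d1.
Proof.
move=> vG; set A := [set w in G | _].
have h : #|[set w | e v w]|%:R <= #|~: (A :|: gclass c0 (c0 v))|%:R + Q.
  apply: le_trans (_ : _ <= #|~: (A :|: gclass c0 (c0 v))|%:R +
     #|[set w in G | (c0 w == c0 v) && e v w]|%:R) _; last first.
    by rewrite lerD2l ler_nat inner_le.
  apply: card_le_cover; apply/subsetP => w; rewrite !inE => ->.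
  by rewrite /= !andbF andbT /= orNb.
rewrite card_setC cardsU (_ : A :&: _ = set0) ?cards0 ?subn0 ?natrD in h; last first.
  by apply/setP => w; rewrite !inE; case: (c0 w == c0 v); rewrite ?andbF.
have := deg_ge vG; have := gclass_ge (c0 v); have := Q_le; have := Pu_ge; have := u_ge1; lra.
Qed.

(** Pick a vertex from each class of J in turn. Each pick is good and spoils at most [d1] candidates
    in a later class, hence the supply of [#|J|] times [d1]; at the last class K has p vertices and
    still too many common neighbours. The starting clique may contain exceptional vertices. *)
Lemma greedy (J : {set 'I_p}) (K : {set T}) : clique e K -> (#|K| + #|J| = p.+1)%N ->
  (0 < #|J|)%N ->
  ~ {in J, forall j, #|J|%:R * d1 + Q <= #|[set v in gclass c0 j | cnb e K v]|%:R}.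
Proof.
have [m] := ubnP #|J|; elim: m J K => // m IH J K Jm cK KJ J0 hJ.
have [j jJ] : exists j, j \in J by apply/set0Pn; rewrite -card_gt0.
have d0 : 0 < d1 by have := Pu_ge; have := u_ge1; lra.
have d1J : d1 <= #|J|%:R * d1 by rewrite ler_peMl ?ler1n// ltW.
have [J1|J1] := eqVneq #|J| 1%N.
  have sK : #|K| = p by move: KJ; rewrite J1 addn1 => -[].
  have := hJ _ jJ; rewrite leNgt => /negP; apply.
  apply: le_lt_trans (_ : _ <= Q) _; last lra.
  rewrite ler_nat (leq_trans _ (ltnW (few_cnb cK sK)))//; apply: subset_leq_card.
  by apply/subsetP => v; rewrite !inE => /andP[].
have [v] : exists v, v \in [set v in gclass c0 j | cnb e K v].
  apply/set0Pn; rewrite -card_gt0 -(ltr_nat R); apply: lt_le_trans (hJ _ jJ).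
  by have := ler0n R q; lra.
rewrite !inE => /andP[/andP[vG /eqP vj] vK].
have sJ : #|J| = #|J :\ j|.+1 by rewrite (cardsD1 j J) jJ.
apply: (IH (J :\ j) (v |: K)).
- by move: Jm; rewrite sJ ltnS.
- exact: cliqueU1.
- by rewrite cardsU1 (cnb_notin ei vK) add1n addSn -KJ sJ addnS.
- by rewrite lt0n; apply: contra J1; rewrite sJ => /eqP->.
- move=> i; rewrite !inE => /andP[ij iJ].
  have := hJ _ iJ; rewrite sJ -natr1 mulrDl mul1r => h.
  have h2 := @card_le_cover [set w in gclass c0 i | cnb e K w]
    [set w in gclass c0 i | cnb e (v |: K) w] [set w in G | (c0 w != c0 v) && ~~ e v w].
  have h3 := cross_miss vG.
  apply: (@le_trans _ _ (#|[set w in gclass c0 i | cnb e K w]|%:R - d1)); first by lra.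
  rewrite lerBlDr; apply: le_trans (h2 _) _; last by rewrite lerD2l.
  apply/subsetP => w; rewrite !inE => /andP[/andP[wG /eqP wi] wK].
  rewrite wG wi eqxx vj ij /=; have [vw|nvw] := boolP (e v w); last by rewrite orbT.
  rewrite orbF; apply/cnbP => x; rewrite !inE => /orP[/eqP->//|xK].
  by move/cnbP: wK; apply.
Qed.

Lemma few_common (J : {set 'I_p}) (K : {set T}) : clique e K -> (#|K| + #|J| = p.+1)%N ->
  (#|K| <= p)%N ->
  exists2 j, j \in J & #|[set v in gclass c0 j | cnb e K v]|%:R < d2.
Proof.
move=> cK KJ Kp.
have J0 : (0 < #|J|)%N by rewrite -(ltn_add2l #|K|) addn0 KJ ltnS.
have [/exists_inP[j jJ h]|no] := boolP [exists j in J,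
   #|[set v in gclass c0 j | cnb e K v]|%:R < d2]; first by exists j.
case: (greedy cK KJ J0) => j jJ.
have := no; rewrite negb_exists_in => /forall_inP/(_ j jJ); rewrite -leNgt; apply: le_trans.
have Jp : #|J|%:R <= P by rewrite ler_nat -[X in (_ <= X)%N]card_ord max_card.
have : #|J|%:R * d1 <= P * d1.
  by rewrite ler_wpM2r//; have := Pu_ge; have := u_ge1; lra.
by have := Q_le; have := PPu_ge; have := Pu_ge; have := u_ge1; rewrite expr2; lra.
Qed.

(** Two good ends of an inner edge share almost all of every other class, against [few_common]. *)
Lemma gclass_indep v w : v \in G -> w \in G -> c0 v = c0 w -> ~~ e v w.
Proof.
move=> vG wG cvw; apply/negP => vw.
have cK : clique e [set v; w].
  by apply/cliqueP => a b; rewrite !inE => /orP[]/eqP-> /orP[]/eqP->; rewrite ?eqxx// es.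
have vw' : v != w by apply: contraTneq vw => ->; rewrite ei.
have [||j] := few_common (J := ~: [set c0 v]) cK.
- by rewrite cards2 vw' cardsC1 card_ord add2n prednK// (leq_trans _ p3).
- by rewrite cards2 vw' (leq_trans _ p3).
rewrite !inE => jv; apply/negP; rewrite -leNgt.
set C := [set x in gclass c0 j | cnb e [set v; w] x].
pose A1 := [set x in G | (c0 x != c0 v) && ~~ e v x].
pose A2 := [set x in G | (c0 x != c0 w) && ~~ e w x].
have h : #|gclass c0 j|%:R <= #|C|%:R + (#|A1|%:R + #|A2|%:R) :> R.
  apply: (@le_trans _ _ (#|C|%:R + #|A1 :|: A2|%:R)); last by rewrite lerD2l card_le_cover.
  apply: card_le_cover.
  apply/subsetP => x; rewrite !inE.
  move=> /andP[xG /eqP xj]; rewrite xG xj eqxx -cvw jv /=.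
  have [vx|] := boolP (e v x); last by rewrite orbT.
  have [wx|] := boolP (e w x); last by rewrite !orbT.
  by rewrite orbF; apply/cnbP => a; rewrite !inE => /orP[]/eqP->.
have := cross_miss vG; have := cross_miss wG; have := gclass_ge j; rewrite -/A1 -/A2.
by move: h; have := uE; have := PPu_ge; have := Pu_ge; have := u_ge1; lra.
Qed.

(** An exceptional vertex goes to a class in which it has fewer than [d2] good neighbours;
    [few_common], for this vertex against all p classes, supplies one. *)
Lemma full_colouring : exists c : T -> 'I_p,
  [/\ forall i, N - 4 * P * u <= #|gclass c i|%:R,
      {in G &, forall v w, c v = c w -> ~~ e v w},
      forall v, #|[set w in gclass c (c v) | e v w]|%:R <= d2,
      {in G, forall v, #|[set w in G | (c w != c v) && ~~ e v w]|%:R <= d1} &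
      forall (J : {set 'I_p}) (K : {set T}), clique e K -> (#|K| + #|J| = p.+1)%N ->
        (#|K| <= p)%N ->
        exists2 j, j \in J & #|[set v in gclass c j | cnb e K v]|%:R < d2].
Proof.
pose c v : 'I_p := if v \in G then c0 v else
  odflt (c0 v) [pick j | #|[set w in gclass c0 j | e v w]|%:R < d2].
have cG v : v \in G -> c v = c0 v by rewrite /c => ->.
have gE i : gclass c i = gclass c0 i.
  by apply/setP => v; rewrite !inE; have [vG|//] := boolP (v \in G); rewrite cG.
have d20 : 0 <= d2 by have := PPu_ge; have := Pu_ge; have := u_ge1; lra.
exists c; split.
- by move=> i; rewrite gE gclass_ge.
- by move=> v w vG wG; rewrite !cG//; exact: gclass_indep.
- move=> v; have [vG|vG] := boolP (v \in G).
    rewrite (_ : [set w in _ | _] = set0) ?cards0//; apply/setP => w; rewrite !inE.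
    apply/negP => /andP[/andP[wG /eqP cwv] vw]; rewrite !cG// in cwv.
    by have := gclass_indep wG vG cwv; rewrite es vw.
  rewrite gE; rewrite /c (negbTE vG); case: pickP => [j /ltW//|h] /=.
  have [|||j _] := few_common (J := setT) (K := [set v]).
  - by apply/cliqueP => a b; rewrite !inE => /eqP-> /eqP->; rewrite eqxx.
  - by rewrite cards1 cardsT card_ord.
  - by rewrite cards1 (leq_trans _ p3).
  rewrite (_ : [set w in gclass c0 j | cnb e [set v] w] = [set w in gclass c0 j | e v w]) ?h//.
  apply/setP => w; rewrite !inE; congr (_ && _); apply/cnbP/idP => [H|vw a].
    by apply: H; rewrite inE.
  by rewrite inE => /eqP->.
- move=> v vG; rewrite (_ : [set w in G | _] = [set w in G | (c0 w != c0 v) && ~~ e v w]).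
    exact: cross_miss.
  by apply/setP => w; rewrite !inE; have [wG|//] := boolP (w \in G); rewrite !cG.
- move=> J K cK KJ Kp; have [j jJ h] := few_common cK KJ Kp; exists j => //.
  by rewrite gE.
Qed.

End Greedy.

Section Missing.
Variables (R : realFieldType) (T : finType) (e : rel T) (p : nat).
Hypothesis p3 : (3 <= p)%N.
Variables (c : T -> 'I_p) (G : {set T}) (N u : R).
Local Notation nn := (#|T|%:R : R).
Local Notation P := (p%:R : R).
Local Notation d2 := (12 * P ^+ 2 * u).
Hypothesis u_ge : #|~: G|%:R + 1 <= u.
Hypothesis size_ge : forall i, N - 4 * P * u <= #|gclass G c i|%:R.
Hypothesis own_le : forall v, #|[set w in gclass G c (c v) | e v w]|%:R <= d2.
Hypothesis few_common : forall (J : {set 'I_p}) (K : {set T}), clique e K ->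
  (#|K| + #|J| = p.+1)%N -> (#|K| <= p)%N ->
  exists2 j, j \in J & #|[set v in gclass G c j | cnb e K v]|%:R < d2.

Definition missing j v := #|[set w in gclass G c j | ~~ e v w]|.
Definition defic v := (\sum_(j | j != c v) missing j v)%N.

Let u1 : 1 <= u. Proof. by have := ler0n R #|~: G|; have := u_ge; lra. Qed.
Let Pu : 3 * u <= P * u.
Proof. by rewrite ler_wpM2r ?P_ge3//; have := u1; lra. Qed.
Let PPu : 3 * (P * u) <= P ^+ 2 * u.
Proof.
rewrite expr2 -mulrA; apply: ler_wpM2r; last exact: P_ge3.
by have := Pu; have := u1; lra.
Qed.

(** Class j has about N good vertices, of which fewer than [d2] are common neighbours of K, so the
    vertices of K together miss nearly all of it. *)
Lemma conflict (J : {set 'I_p}) (K : {set T}) : clique e K ->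
  (#|K| + #|J| = p.+1)%N -> (#|K| <= p)%N ->
  exists2 j, j \in J & N - 2 * d2 <= \sum_(v in K) (missing j v)%:R.
Proof.
move=> cK KJ Kp; have [j jJ hlt] := few_common cK KJ Kp; exists j => //.
pose C := [set v in gclass G c j | cnb e K v].
have {}h : (#|gclass G c j| <= #|C| + \sum_(v in K) missing j v)%N.
  rewrite -leq_subLR -(cardsID C) (setIidPr _) ?addKn; last first.
    by apply/subsetP => w; rewrite inE => /andP[].
  apply: leq_trans (_ : #|\bigcup_(v in K) [set w in gclass G c j | ~~ e v w]| <= _)%N.
    apply: subset_leq_card; apply/subsetP => w; rewrite !inE => /andP[wC wj].
    move: wC; rewrite wj /= /cnb negb_forall_in => /exists_inP[v vK nvw].
    by apply/bigcupP; exists v => //; rewrite !inE wj.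
  elim/big_rec2: _ => [|v m A _ IH]; first by rewrite cards0.
  by rewrite cardsU (leq_trans (leq_subr _ _))// leq_add2l.
rewrite -(ler_nat R) natrD natr_sum in h.
move: h; have := size_ge j; have := Pu; have := PPu; have := u1.
by move: hlt; rewrite -/C; lra.
Qed.

Lemma defic_card v : defic v = #|[set w in G | (c w != c v) && ~~ e v w]|.
Proof.
rewrite -sum1_card (partition_big c (fun j => j != c v)) /=; last first.
  by move=> w; rewrite !inE => /andP[_ /andP[]].
apply: eq_bigr => j jv; rewrite /missing -sum1_card; apply: eq_bigl => w; rewrite !inE.
by case: (c w =P j) => [->|_]; rewrite ?andbF// jv !andbT.
Qed.

Lemma missing_le j v : j != c v -> (missing j v <= defic v)%N.
Proof. by move=> jv; rewrite /defic (bigD1 j)//= leq_addr. Qed.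

Lemma deg_le v : #|[set w | e v w]|%:R <= nn - N - (defic v)%:R + 2 * d2.
Proof.
pose O := [set w in gclass G c (c v) | e v w].
pose D := [set w in G | (c w != c v) && e v w].
have h1 : #|[set w | e v w]|%:R <= #|~: G|%:R + (#|O|%:R + #|D|%:R) :> R.
  apply: (@le_trans _ _ (#|~: G|%:R + #|O :|: D|%:R)); last by rewrite lerD2l card_le_cover.
  apply: card_le_cover; apply/subsetP => w; rewrite !inE => ->.
  by case: (w \in G); case: (c w == c v).
have h2 : (#|D| + defic v + #|gclass G c (c v)| = #|G|)%N.
  rewrite defic_card -(cardsID (gclass G c (c v)) G) addnC; congr (_ + _)%N.
    by apply: eq_card => w; rewrite !inE; case: (w \in G).
  rewrite -(cardsID [set w | e v w] (G :\: _)); congr (_ + _)%N;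
    by apply: eq_card => w; rewrite !inE; case: (w \in G); case: (c w == c v); rewrite ?andbF ?andbT.
have {}h2 : #|D|%:R + (defic v)%:R + #|gclass G c (c v)|%:R = nn - #|~: G|%:R :> R.
  by rewrite -!natrD h2 -(cardsC G) natrD addrK.
have := own_le v; rewrite -/O; have := size_ge (c v); have := ler0n R #|~: G|.
by move: h1 h2; have := u_ge; have := u1; have := Pu; have := PPu; lra.
Qed.

End Missing.

(** * Weighted Turan bound and the price of deleting vertices *)

Section PartiteForm.
Variables (R : realFieldType) (T : finType) (e : rel T) (p : nat).
Local Notation P := (p%:R : R).

Lemma sum_sqr_le (I : finType) (A : {pred I}) (x : I -> R) :
  (\sum_(i in A) x i) ^+ 2 <= #|A|%:R * \sum_(i in A) x i ^+ 2.
Proof.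
have := cauchy_schwarz_wgt A x (fun=> ler01 : 0 <= (1 : R)).
under eq_bigr do rewrite mul1r.
by under [X in _ <= _ * X -> _]eq_bigr do rewrite mul1r; rewrite sumr_const.
Qed.

(** The Motzkin-Straus bound of p-partite graphs, by Cauchy-Schwarz on the p class sums. Inner edges
    are allowed where weights vanish, so that vertices can be deleted by giving them weight 0. *)
Lemma partite_qform (c : T -> 'I_p) (x : T -> R) : (forall v, 0 <= x v) ->
  (forall u v, e u v -> c u = c v -> x u * x v = 0) ->
  P * qform e x <= (P - 1) * (\sum_v x v) ^+ 2.
Proof.
move=> x0 xc; set S := \sum_v x v; pose s i := \sum_(v | c v == i) x v.
have sS : \sum_i s i = S by rewrite /S (partition_big c predT).
have h1 : qform e x <= \sum_u x u * (S - s (c u)).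
  apply: ler_sum => u _; rewrite /nbsum.
  have -> : S - s (c u) = \sum_(v | c v != c u) x v.
    by rewrite /S (bigID (fun v => c v == c u)) /= addrAC subrr add0r.
  rewrite !mulr_sumr [leLHS]big_mkcond [leRHS]big_mkcond; apply: ler_sum => v _.
  have [uv|_] := boolP (e u v); last by case: ifP => // _; rewrite mulr_ge0.
  by have [cvu|//] := eqVneq (c v) (c u); rewrite xc.
have h2 : \sum_u x u * (S - s (c u)) = S ^+ 2 - \sum_i s i ^+ 2.
  under eq_bigr do rewrite mulrBr.
  rewrite sumrB -mulr_suml -/S -expr2; congr (_ - _).
  rewrite (partition_big c predT)//=; apply: eq_bigr => i _.
  by rewrite expr2 mulr_suml; apply: eq_bigr => v /eqP->.
have h3 : S ^+ 2 <= P * \sum_i s i ^+ 2.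
  by have := sum_sqr_le 'I_p s; rewrite -sS card_ord.
have : P * qform e x <= P * (S ^+ 2 - \sum_i s i ^+ 2) by rewrite ler_wpM2l// -h2.
lra.
Qed.

End PartiteForm.

Section Removal.
Variables (R : realFieldType) (T : finType) (e : rel T) (p : nat).
Hypothesis es : symmetric e.
Variables (rho : R) (mu : T -> R).
Local Notation nn := (#|T|%:R : R).
Local Notation P := (p%:R : R).
Hypothesis p0 : (0 < p)%N.
Hypothesis mu_ge0 : forall v, 0 <= mu v.
Hypothesis mu_sqn : sqn mu = nn.
Hypothesis mu_eig : forall v, nbsum e mu v = rho * mu v.

(** Split [mu] into x off L and y on L. By the eigenvalue equation the edges meeting L contribute at
    most 2 rho times the squared weight of L, and the rest is p-partite. *)
Lemma removal (c : T -> 'I_p) (L : {set T}) :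
  (forall u v, u \notin L -> v \notin L -> e u v -> c u != c v) ->
  P * rho * (nn - 2 * \sum_(v in L) mu v ^+ 2) <=
  (P - 1) * ((nn - #|L|%:R) * (nn - \sum_(v in L) mu v ^+ 2)).
Proof.
move=> Lc; set X := \sum_(v in L) _.
pose x v := if v \in L then 0 else mu v; pose y v := if v \in L then mu v else 0.
have x0 v : 0 <= x v by rewrite /x; case: ifP.
have y0 v : 0 <= y v by rewrite /y; case: ifP.
have qmu : qform e mu = rho * nn by rewrite (qform_eigen mu_eig) mu_sqn.
have qxy : qform e mu = qform e x + 2 * (\sum_i y i * nbsum e x i) + qform e y.
  rewrite -qformD// /qform; apply: eq_bigr => v _.
  have E w : mu w = x w + y w by rewrite /x /y; case: ifP; rewrite ?add0r ?addr0.
  by rewrite -E; congr (_ * _); apply: eq_bigr => w _; exact: E.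
have yX : \sum_i y i * nbsum e x i + qform e y = rho * X.
  rewrite /qform -big_split /= /X mulr_sumr [RHS]big_mkcond; apply: eq_bigr => v _.
  rewrite -mulrDr -nbsumD (_ : nbsum e _ v = nbsum e mu v); last first.
    by apply: eq_bigr => w _; rewrite /x /y; case: ifP; rewrite ?add0r ?addr0.
  by rewrite mu_eig /y; case: ifP => _; rewrite ?mul0r// mulrCA expr2.
have qy : 0 <= qform e y.
  by apply: sumr_ge0 => v _; rewrite mulr_ge0// sumr_ge0.
have qx : P * qform e x <= (P - 1) * (\sum_v x v) ^+ 2.
  apply: (@partite_qform _ _ _ _ c) => // u v uv cuv; rewrite /x.
  case: ifPn => uL; rewrite ?mul0r//; case: ifPn => vL; rewrite ?mulr0//.
  by have := Lc _ _ uL vL uv; rewrite cuv eqxx.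
have P1 : 1 <= P by rewrite ler1n.
have sx : (\sum_v x v) ^+ 2 <= (nn - #|L|%:R) * (nn - X).
  have -> : \sum_v x v = \sum_(v in ~: L) mu v.
    by rewrite [RHS]big_mkcond; apply: eq_bigr => v _; rewrite /x inE; case: ifP.
  apply: le_trans (sum_sqr_le _ _) _; rewrite card_setC.
  have -> // : \sum_(v in ~: L) mu v ^+ 2 = nn - X.
  rewrite -mu_sqn /sqn [in RHS](bigID (mem L)) /= addrAC subrr add0r.
  by apply: eq_bigl => v; rewrite inE.
have : (P - 1) * (\sum_v x v) ^+ 2 <= (P - 1) * ((nn - #|L|%:R) * (nn - X)).
  by rewrite ler_wpM2l// subr_ge0.
have : P * (rho * nn) <= P * (qform e x + 2 * (rho * X)).
  by rewrite ler_wpM2l//; move: qmu; rewrite qxy; lra.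
by move: qx; lra.
Qed.

(** To first order [removal] charges each deleted vertex [1 - mu v ^+ 2], and the total is at most
    [g], by which p rho / (p-1) may fall short of n. The last term pays for products of small
    quantities. *)
Lemma removal_weight (c : T -> 'I_p) (L : {set T}) (g : R) :
  (1 < p)%N ->
  (forall u v, u \notin L -> v \notin L -> e u v -> c u != c v) ->
  (forall v, mu v <= 2) -> 0 <= g -> 8 * #|L|%:R <= nn -> 0 < nn ->
  (P - 1) * (nn - g) <= P * rho ->
  \sum_(v in L) (1 - mu v ^+ 2) <= g + 4 * #|L|%:R ^+ 2 / nn.
Proof.
move=> p1 Lc mu2 g0 L8 n0 hr; have := removal Lc; set X := \sum_(v in L) _; set l := #|L|%:R : R.
have l0 : 0 <= l by exact: ler0n.
have Xl : X <= 4 * l.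
  rewrite /l mulrC mulr_natl -sumr_const; apply: ler_sum => v _.
  by have := mu2 v; have := mu_ge0 v; nra.
have X0 : 0 <= X by apply: sumr_ge0 => v _; exact: sqr_ge0.
have P1 : 0 < P - 1 by rewrite subr_gt0 ltr1n.
rewrite sumrB sumr_const -/X -/l.
move=> h.
have h1 : (P - 1) * (nn - g) * (nn - 2 * X) <= P * rho * (nn - 2 * X).
  by rewrite ler_wpM2r//; lra.
have {h}h1 : (nn - g) * (nn - 2 * X) <= (nn - l) * (nn - X).
  by rewrite -(ler_pM2l P1) mulrA; apply: le_trans h1 h.
rewrite -lerBlDl ler_pdivlMr//.
have : l * X <= 4 * l ^+ 2 by rewrite expr2 mulrCA ler_wpM2l.
have : 0 <= g * X by rewrite mulr_ge0.
by move: h1; lra.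
Qed.

End Removal.

(* Concavity of 2m - m^2 makes the cheapest way of spending a total of 7/5 m0 the one
   concentrated on a single index. *)
Lemma concave_budget (R : realFieldType) (I : finType) (F : {set I}) (m : I -> R) (m0 : R) :
  0 < m0 -> m0 <= 1 / 2 -> {in F, forall w, 0 <= m w <= 13 / 10} ->
  \sum_(w in F) (2 * m w - m w ^+ 2) <= 2 * m0 - m0 ^+ 2 + 22 / 100 * m0 ->
  \sum_(w in F) m w < 7 / 5 * m0.
Proof.
move=> m00 m0h mF hs; rewrite ltNge; apply/negP => hm.
pose t := 7 / 5 * m0.
suff : t * (2 - t) <= \sum_(w in F) (2 * m w - m w ^+ 2) by rewrite /t; nra.
have [/exists_inP[w wF tw]|no] := boolP [exists w in F, t <= m w].
  rewrite (bigD1 w)//= -[leLHS]addr0; apply: lerD.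
    by have := mF w wF; rewrite /t in tw * => /andP[]; nra.
  by apply: sumr_ge0 => i /andP[iF _]; have := mF i iF => /andP[]; nra.
apply: (@le_trans _ _ (\sum_(w in F) m w * (2 - t))).
  by rewrite -mulr_suml ler_wpM2r//; rewrite /t; lra.
apply: ler_sum => w wF; have /andP[m0w _] := mF w wF.
have : m w < t by rewrite ltNge; apply: contra no => h; apply/exists_inP; exists w.
by nra.
Qed.

(** * The room for missing edges *)

Section Budget.
Variables (R : realFieldType) (T : finType) (e : rel T) (p : nat).
Hypotheses (es : symmetric e) (ei : irreflexive e) (p3 : (3 <= p)%N).
Variables (c : T -> 'I_p) (G : {set T}) (N u : R).
Local Notation nn := (#|T|%:R).
Local Notation P := (p%:R).
Local Notation d1 := (6 * P * u).
Local Notation d2 := (12 * P ^+ 2 * u).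
Hypothesis nnE : nn = P * N.
Hypothesis uE : N = 6000 * P ^+ 2 * u.
Hypothesis u_ge : #|~: G|%:R + 1 <= u.
Hypothesis size_ge : forall i, N - 4 * P * u <= #|gclass G c i|%:R.
Hypothesis own_le : forall v, #|[set w in gclass G c (c v) | e v w]|%:R <= d2.
Hypothesis cross_le : {in G, forall v, #|[set w in G | (c w != c v) && ~~ e v w]|%:R <= d1}.
Hypothesis few_common : forall (J : {set 'I_p}) (K : {set T}), clique e K ->
  (#|K| + #|J| = p.+1)%N -> (#|K| <= p)%N ->
  exists2 j, j \in J & #|[set v in gclass G c j | cnb e K v]|%:R < d2.
Variables (rho : R) (mu : T -> R).
Hypothesis mu_ge0 : forall v, 0 <= mu v.
Hypothesis mu_le2 : forall v, mu v <= 2.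
Hypothesis mu_sqn : sqn mu = nn.
Hypothesis mu_eig : forall v, nbsum e mu v = rho * mu v.
Hypothesis mu_deg : forall v, (rho * mu v - #|[set w | e v w]|%:R) ^+ 2 <= u ^+ 2.
Local Notation m0 := (1 / (P - 1)).
Hypothesis rho_ge : (P - 1) * (nn - (2 * m0 - m0 ^+ 2 + m0 / 20)) <= P * rho.
Hypothesis N_ge : 100 * (#|~: G|%:R + 4) ^+ 2 <= N.

Local Notation missing := (missing e c G).
Local Notation defic := (defic e c G).
Local Notation k := (nn - N).

Lemma inner_conflict v w : e v w -> c v = c w ->
  exists2 j, j != c v & N - 2 * d2 <= (missing j v)%:R + (missing j w)%:R.
Proof.
move=> vw cvw; have vw' : v != w by apply: contraTneq vw => ->; rewrite ei.
have cK : clique e [set v; w].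
  by apply/cliqueP => a b; rewrite !inE => /orP[]/eqP-> /orP[]/eqP->; rewrite ?eqxx// es.
have [||j] := conflict p3 u_ge size_ge few_common (J := ~: [set c v]) cK.
- by rewrite cards2 vw' cardsC1 card_ord add2n prednK// (leq_trans _ p3).
- by rewrite cards2 vw' (leq_trans _ p3).
by rewrite !inE => jv h; exists j => //; move: h; rewrite big_setU1 ?inE//= big_set1.
Qed.

Let P3 : 3 <= P :> R. Proof. by rewrite ler_nat. Qed.
Let u1 : 1 <= u. Proof. by have := ler0n R #|~: G|; have := u_ge; lra. Qed.
Let Pu : 3 * u <= P * u.
Proof. by rewrite ler_wpM2r ?P_ge3//; have := u1; lra. Qed.
Let PPu : 3 * (P * u) <= P ^+ 2 * u.
Proof.
rewrite expr2 -mulrA; apply: ler_wpM2r; last exact: P_ge3.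
by have := Pu; have := u1; lra.
Qed.
Let N0 : 1600 <= N. Proof. by have := N_ge; have := ler0n R #|~: G|; nra. Qed.
Let kE : k = (P - 1) * N. Proof. by rewrite nnE; ring. Qed.
Let k0 : 2 * N <= k. Proof. by rewrite kE ler_wpM2r//; have := P3; have := N0; lra. Qed.
Let m00 : 0 < m0 :> R. Proof. by rewrite divr_gt0//; have := P3; lra. Qed.
Let m0h : m0 <= 1 / 2 :> R. Proof. by rewrite ler_pdivrMr; have := P3; lra. Qed.
Let m0k : m0 * k = N. Proof. by rewrite kE; field; rewrite gt_eqF//; have := P3; lra. Qed.

Lemma rho_ge_k : k - 1 <= rho.
Proof.
have : (P - 1) * (nn - 1) <= P * rho.
  apply: le_trans rho_ge; rewrite ler_wpM2l//; first by have := P3; lra.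
  rewrite lerD2l lerN2; have := m00; have := m0h; set m := m0; nra.
move=> h; have : P * (k - 1) <= P * rho.
  apply: le_trans h; rewrite nnE; lra.
by rewrite ler_pM2l//; have := P3; lra.
Qed.

(** The degree is at most about k - defic, and rho is at least k - 1, so the entry is at most about
    1 - defic/k. The error m0/100 equals 5 d2/k, because N = 500 d2 and m0 k = N. *)
Lemma mu_le v : mu v <= 1 - (defic v)%:R / k + m0 / 100.
Proof.
have r := rho_ge_k; have n0 := N0; have k0' := k0.
have := deg_le p3 u_ge size_ge own_le v; set d := #|_|%:R; set D := (defic v)%:R => dl.
have : rho * mu v - d <= u.
  have uu := u1; apply: le_trans (ler_norm _) _.
  by rewrite -(@ler_pXn2r _ 2)// ?nnegrE//; [rewrite real_normK ?num_real// mu_deg|lra].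
have -> : m0 / 100 = 5 * d2 / k.
  have -> : 5 * d2 = N / 100 by rewrite uE; field.
  by rewrite -[X in _ = X / 100 / _]m0k; field; rewrite !gt_eqF//; have := P3; lra.
set z := 1 - _ + _; have zE : z * k = k - D + 5 * d2 by rewrite /z; field; rewrite gt_eqF; lra.
move=> h; rewrite leNgt; apply/negP => hz.
have D0 : 0 <= D by exact: ler0n.
have hd : rho * mu v <= k - D + 3 * d2 by have := Pu; have := PPu; have := u1; move: dl h; lra.
have d2N : 500 * d2 = N by rewrite uE; ring.
have z2 : z < 2 by have := mu_le2 v; lra.
have : (k - 1) * mu v <= rho * mu v by rewrite ler_wpM2r.
have : (k - 1) * z <= (k - 1) * mu v by rewrite ler_wpM2l//; lra.
by lra.
Qed.

Lemma defic_good v : v \in G -> (defic v)%:R <= d1.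
Proof. by move=> vG; rewrite defic_card cross_le. Qed.

(** The set handed to [removal_weight] is [F] together with [L0]. Off [L0] there is no inner edge,
    and [L0] is bounded because good vertices miss at most [d1]. Vertices of [L0] outside [F] have a
    nonnegative charge and are dropped, which leaves a bound for [F] alone. *)
Lemma budget (F : {set T}) : (#|F| <= 4)%N ->
  \sum_(w in F) (defic w)%:R < 7 / 5 * N.
Proof.
move=> F4; have n0 := N0; have k0' := k0; have k00 : 0 < k by lra.
(* The ends of an inner edge together miss nearly N vertices of one class, so one of them passes the
   threshold 2/5 N. *)
pose L0 := [set w | 2 / 5 * N <= (defic w)%:R].
have d2N : 500 * d2 = N by rewrite uE; ring.
have L0G : L0 \subset ~: G.
  apply/subsetP => w; rewrite !inE => h; apply/negP => /defic_good.
  by have := Pu; have := PPu; have := u1; move: h; lra.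
pose L := L0 :|: F.
have Lc v w : v \notin L -> w \notin L -> e v w -> c v != c w.
  rewrite !inE !negb_or -!ltNge => /andP[v0 _] /andP[w0 _] vw; apply/eqP => cvw.
  have [j jv] := inner_conflict vw cvw.
  have := missing_le e G jv; rewrite cvw in jv; have := missing_le e G jv.
  by rewrite -!(ler_nat R); move: v0 w0; lra.
have Lcard : #|L|%:R <= #|~: G|%:R + 4 :> R.
  rewrite -natrD ler_nat (leq_trans (_ : _ <= #|L0| + #|F|)%N)//.
    by rewrite cardsU leq_subr.
  by rewrite leq_add// subset_leq_card.
have l0 := ler0n R #|L|.
have g0 : 0 <= 2 * m0 - m0 ^+ 2 + m0 / 20 :> R.
  by have := m00; have := m0h; set m := m0; nra.
have Ll : 100 * #|L|%:R ^+ 2 <= N.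
  apply: le_trans N_ge; rewrite ler_wpM2l// ler_pXn2r ?nnegrE//; lra.
have nnN : k + N = nn by ring.
have nn0 : 0 < nn :> R by lra.
have p1 : (1 < p)%N by rewrite (leq_trans _ p3).
have l8 : 8 * #|L|%:R <= nn :> R by move: Ll; set l := #|L|%:R in l0 *; nra.
have p0 : (0 < p)%N by rewrite (leq_trans _ p3).
have h := removal_weight es p0 mu_ge0 mu_sqn mu_eig p1 Lc mu_le2 g0 l8 nn0 rho_ge.
have lnn : 4 * #|L|%:R ^+ 2 / nn <= m0 / 20 :> R.
  rewrite ler_pdivrMr// mulrAC -nnN mulrDr m0k.
  have : 0 <= m0 * N by rewrite mulr_ge0//; [exact: ltW m00|lra].
  by move: Ll; lra.
pose m w : R := (defic w)%:R / k; pose eta : R := m0 / 100.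
have m_ge0 w : 0 <= m w by rewrite divr_ge0// ltW.
have muz w : mu w <= 1 - m w + eta by exact: mu_le.
have eta0 : 0 <= eta by rewrite divr_ge0// ltW// m00.
have eta1 : eta <= 1 / 200 by have := m0h; rewrite /eta; lra.
have m_le w : m w <= 1 + eta by have := muz w; have := mu_ge0 w; lra.
have mw w : (m w - eta) * (2 - m w + eta) <= 1 - mu w ^+ 2.
  have -> : (m w - eta) * (2 - m w + eta) = 1 - (1 - m w + eta) ^+ 2 by ring.
  rewrite lerD2l lerN2 ler_pXn2r ?nnegrE//.
  by have := muz w; have := mu_ge0 w; lra.
have hF : \sum_(w in F) (2 * m w - m w ^+ 2 - 3 * eta) <= \sum_(w in L) (1 - mu w ^+ 2).
  rewrite [leRHS](bigID (mem F)) /= -[leLHS]addr0; apply: lerD.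
    rewrite [leRHS](eq_bigl (mem F)); last first.
      by move=> w; rewrite !inE; case: (w \in F); rewrite ?orbT ?andbF.
    apply: ler_sum => w _; apply: le_trans (mw w).
    by have := m_ge0 w; have := m_le w; nra.
  apply: sumr_ge0 => w /andP[]; rewrite !inE => wL /negbTE wF.
  apply: le_trans (mw w); rewrite wF orbF in wL; rewrite mulr_ge0//; last first.
    by have := m_le w; lra.
  rewrite subr_ge0; apply: (@le_trans _ _ (2 / 5 * m0)).
    by have := m00; rewrite /eta; lra.
  by rewrite /m ler_pdivlMr// -[leLHS]mulrA m0k.
have F4' : #|F|%:R <= 4 :> R by rewrite ler_nat.
(* The 22/100 is 1/20 from the bound on rho, 1/20 from [lnn], and 3/100 for each of four
   vertices. *)
have {}hF : \sum_(w in F) (2 * m w - m w ^+ 2) <= 2 * m0 - m0 ^+ 2 + 22 / 100 * m0.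
  move: hF; rewrite sumrB sumr_const -[_ *+ #|F|]mulr_natl.
  have : #|F|%:R * (3 * eta) <= 4 * (3 * eta) by rewrite ler_wpM2r//; lra.
  by rewrite /eta; move: h lnn; lra.
have mF : {in F, forall w, 0 <= m w <= 13 / 10}.
  by move=> w _; rewrite m_ge0 /=; have := m_le w; lra.
have := concave_budget m00 m0h mF hF.
by rewrite -mulr_suml ltr_pdivrMr// -[ltRHS]mulrA m0k.
Qed.

End Budget.

(** * The structure theorem *)

Definition c5adj : rel 'I_5 := fun i j => (i.+1 %% 5 == j)%N || (j.+1 %% 5 == i)%N.

(** The join of the 5-cycle and a complete graph, whose vertices are the hubs. For m = p-2 it needs
    p+1 colours, and [wheel_minus_colorable] shows that it is vertex-critical. *)
Definition wheel m : rel ('I_5 + 'I_m) := fun a b =>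
  match a, b with
  | inl i, inl j => c5adj i j
  | inr i, inr j => i != j
  | _, _ => true
  end.

Section Star.
Variables (R : realFieldType) (T : finType) (e : rel T) (p : nat).
Hypotheses (es : symmetric e) (ei : irreflexive e) (p3 : (3 <= p)%N).
Variables (c : T -> 'I_p) (missing : 'I_p -> T -> nat) (N B : R).
Local Notation defic v := (\sum_(j | j != c v) missing j v)%N.
Hypothesis B_ge : 24 / 25 * N <= B.
Hypothesis N0 : 0 < N.
Hypothesis conflict : forall (J : {set 'I_p}) (K : {set T}), clique e K ->
  (#|K| + #|J| = p.+1)%N -> (#|K| <= p)%N ->
  exists2 j, j \in J & B <= \sum_(v in K) (missing j v)%:R.
Hypothesis budget : forall F : {set T}, (#|F| <= 4)%N ->
  \sum_(w in F) (defic w)%:R < 7 / 5 * N.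

Definition inner u v := e u v && (c u == c v).

Lemma innerC u v : inner u v = inner v u.
Proof. by rewrite /inner es eq_sym. Qed.

Lemma inner_neq u v : inner u v -> u != v.
Proof. by case/andP => uv _; apply: contraTneq uv => ->; rewrite ei. Qed.

Lemma budget_seq (s : seq T) : uniq s -> (size s <= 4)%N ->
  \sum_(w <- s) (defic w)%:R < 7 / 5 * N.
Proof.
move=> us s4; have := budget (F := [set w in s]).
rewrite cardsE (card_uniqP us) => /(_ s4); rewrite (big_uniq _ us) /=.
by rewrite (eq_bigl (fun w => w \in s)) // => w; rewrite inE.
Qed.

Lemma missing_le1 j v : j != c v -> (missing j v)%:R <= (defic v)%:R :> R.
Proof. by move=> jv; rewrite ler_nat (bigD1 j)//= leq_addr. Qed.

Lemma missing_le2 i j v : i != c v -> j != c v -> i != j ->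
  (missing i v)%:R + (missing j v)%:R <= (defic v)%:R :> R.
Proof.
move=> iv jv ij; rewrite -natrD ler_nat (bigD1 i)//= (bigD1 j)//=; last by rewrite jv eq_sym.
by rewrite addnA leq_addr.
Qed.

Lemma inner_miss u v : inner u v ->
  exists2 j, j != c u & B <= (missing j u)%:R + (missing j v)%:R.
Proof.
move=> iuv; have /andP[uv /eqP cuv] := iuv; have nuv := inner_neq iuv.
have cK : clique e [set u; v].
  by apply/cliqueP => a b; rewrite !inE => /orP[]/eqP-> /orP[]/eqP->; rewrite ?eqxx// es.
have [||j] := conflict (J := ~: [set c u]) cK.
- by rewrite cards2 nuv cardsC1 card_ord add2n prednK// (leq_trans _ p3).
- by rewrite cards2 nuv (leq_trans _ p3).
by rewrite !inE => ju h; exists j => //; move: h; rewrite big_setU1 ?inE//= big_set1.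
Qed.

Lemma inner_defic u v : inner u v -> B <= (defic u)%:R + (defic v)%:R.
Proof.
move=> iuv; have [j ju h] := inner_miss iuv; have /andP[_ /eqP cuv] := iuv.
have := missing_le1 ju; rewrite cuv in ju; have := missing_le1 ju.
by move: h; lra.
Qed.

(** Two disjoint inner edges would use 2B, at least 48/25 N. *)
Lemma inner_meet u v x y : inner u v -> inner x y -> (x \in [:: u; v]) || (y \in [:: u; v]).
Proof.
move=> iuv ixy; apply/negPn/negP; rewrite negb_or => /andP[xuv yuv].
have us : uniq [:: x; y; u; v].
  move: xuv yuv; rewrite /= !inE !negb_or => /andP[-> ->] /andP[-> ->].
  by rewrite (inner_neq iuv) (inner_neq ixy).
have := budget_seq us isT; rewrite !big_cons big_nil.
by have := inner_defic iuv; have := inner_defic ixy; have := B_ge; have := N0; lra.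
Qed.

(** Adding the three edge conditions counts every vertex twice, so a triangle uses 3B/2, at least
    36/25 N. This is the tightest use of the constants 24/25 and 7/5. *)
Lemma inner_no_triangle u v x : inner u v -> inner v x -> inner u x -> False.
Proof.
move=> uv vx ux.
have us : uniq [:: u; v; x].
  by rewrite /= !inE negb_or (inner_neq uv) (inner_neq vx) (inner_neq ux).
have := budget_seq us isT; rewrite !big_cons big_nil.
have := inner_defic uv; have := inner_defic vx; have := inner_defic ux.
by have := B_ge; have := N0; lra.
Qed.

Lemma inner_star u v : inner u v ->
  exists w s, inner w s /\ forall x y, inner x y -> (x == w) || (y == w).
Proof.
move=> uv.
have [/forallP h|/forallPn[x /forallPn[y]]] :=
  boolP [forall x, forall y, inner x y ==> ((x == u) || (y == u))].
  by exists u, v; split => // x y; apply/implyP; move: (h x) => /forallP.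
rewrite negb_imply negb_or => /andP[xy /andP[xu yu]].
have [z vz zu] : exists2 z, inner v z & z != u.
  have := inner_meet uv xy; rewrite !inE (negbTE xu) (negbTE yu) /=.
  by move=> /orP[]/eqP E; subst; [exists y|exists x => //; rewrite innerC].
exists v, u; split; first by rewrite innerC.
move=> a b ab; apply/negPn/negP; rewrite negb_or => /andP[av bv].
have := inner_meet uv ab; have := inner_meet vz ab.
rewrite !inE (negbTE av) (negbTE bv) /= !orbF => /orP[]/eqP E1 /orP[]/eqP E2; subst.
- by rewrite eqxx in zu.
- by apply: (inner_no_triangle uv vz); rewrite innerC.
- exact: (inner_no_triangle uv vz).
- by rewrite eqxx in zu.
Qed.

(** All inner edges share the centre [w]. Its class splits into [w] (0), its inner neighbours (1)
    and the rest (3); a class [j0] splits into neighbours of [w] (4) and the rest (2); the other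
    classes are hubs. The non-edges of the 5-cycle lie within a class or hold by the choice of the
    parts, except the pair 1, 4, which is [noSR]. *)
Lemma star_hom u0 v0 : inner u0 v0 ->
  exists h : T -> 'I_5 + 'I_p.-2, forall x y, e x y -> wheel (h x) (h y).
Proof.
move=> /inner_star[w [s0 [ws0 star]]].
have [j0 j0w hj0] := inner_miss ws0.
have cs s : inner w s -> c s = c w by case/andP => _ /eqP.
(* A conflict of [w] and [s] in any other class would, together with [hj0], use 2B. *)
have j0s s : inner w s -> B <= (missing j0 w)%:R + (missing j0 s)%:R.
  move=> ws; have [j jw hj] := inner_miss ws.
  have [E|jj0] := eqVneq j j0; first by rewrite -E.
  have [E|ss0] := eqVneq s s0.
    subst s; have us : uniq [:: w; s0] by rewrite /= inE (inner_neq ws0).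
    have := budget_seq us isT; rewrite !big_cons big_nil.
    have := missing_le2 jw j0w jj0.
    rewrite -(cs _ ws0) in jw j0w; have := missing_le2 jw j0w jj0.
    by have := B_ge; have := N0; move: hj hj0; lra.
  have us : uniq [:: w; s0; s].
    by rewrite /= !inE negb_or (inner_neq ws) (inner_neq ws0) eq_sym ss0.
  have := budget_seq us isT; rewrite !big_cons big_nil.
  have := missing_le2 jw j0w jj0.
  have := missing_le1 (_ : j0 != c s0); rewrite (cs _ ws0) => /(_ j0w).
  have := missing_le1 (_ : j != c s); rewrite (cs _ ws) => /(_ jw).
  by have := B_ge; have := N0; move: hj hj0; lra.
(* A triangle [w], [s], [r] would conflict in a third class, which together with [j0] again uses
   2B. *)
have noSR s r : inner w s -> c r = j0 -> e w r -> ~~ e s r.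
  move=> ws cr wr; apply/negP => sr.
  have wr' : w != r by apply: contraTneq wr => ->; rewrite ei.
  have sr' : s != r by apply: contraTneq sr => ->; rewrite ei.
  have ws' := inner_neq ws; have ews : e w s by case/andP: ws.
  have cK : clique e [set w; s; r].
    apply/cliqueP => a b; rewrite !inE -!orbA => /or3P[]/eqP-> /or3P[]/eqP->;
    by rewrite ?eqxx// es.
  have sK : #|[set w; s; r]| = 3.
    rewrite setUC cardsU1 cards2 ws' !inE negb_or eq_sym wr' eq_sym sr'//.
  have [||j] := conflict (J := ~: [set c w; j0]) cK.
  - by rewrite sK cardsCs setCK card_ord cards2 eq_sym j0w -[3]/(1 + 2)%N -addnA subnKC ?add1n// ltnW.
  - by rewrite sK.
  rewrite !inE negb_or => /andP[jw jj0] hj.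
  have {}hj : B <= (missing j w)%:R + (missing j s)%:R + (missing j r)%:R.
    apply: le_trans hj _; rewrite setUC big_setU1 ?big_setU1 ?big_set1 ?inE ?negb_or//=.
      by rewrite addrC.
    by rewrite eq_sym wr' eq_sym sr'.
  have us : uniq [:: w; s; r] by rewrite /= !inE negb_or ws' wr' sr'.
  have := budget_seq us isT; rewrite !big_cons big_nil.
  have := missing_le2 jw j0w jj0.
  have := missing_le2 (_ : j != c s) (_ : j0 != c s) jj0; rewrite (cs _ ws) => /(_ jw j0w).
  have := missing_le1 (_ : j != c r); rewrite cr => /(_ jj0).
  by have := B_ge; have := N0; move: (j0s _ ws) hj; lra.
have [f fi] : exists f : 'I_p -> 'I_p.-2, {in ~: [set c w; j0] &, injective f}.
  pose A := ~: [set c w; j0].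
  have sA : #|A| = p.-2 by rewrite cardsCs setCK card_ord cards2 eq_sym j0w subn2.
  have [a aA] : exists a, a \in A.
    by apply/set0Pn; rewrite -card_gt0 sA -subn2 subn_gt0.
  exists (fun j => cast_ord sA (enum_rank_in aA j)) => i j iA jA.
  by move=> /cast_ord_inj /(congr1 enum_val); rewrite !enum_rankK_in.
pose o k (lt_k5 : (k < 5)%N) : 'I_5 + 'I_p.-2 := inl (Ordinal lt_k5).
pose h v : 'I_5 + 'I_p.-2 :=
  if v == w then o 0%N isT else
  if c v == c w then (if e w v then o 1%N isT else o 3%N isT) else
  if c v == j0 then (if e w v then o 4%N isT else o 2%N isT) else inr (f (c v)).
have inA v : c v != c w -> c v != j0 -> c v \in ~: [set c w; j0].
  by rewrite !inE negb_or => -> ->.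
exists h => x y xy; rewrite /h.
case: (eqVneq x w) => [xw|xw]; case: (eqVneq y w) => [yw|yw].
- by move: xy; rewrite xw yw ei.
- by rewrite xw in xy; rewrite xy; case: ifP => // _; case: ifP.
- by rewrite yw es in xy; rewrite xy; case: ifP => // _; case: ifP.
have cxy : c x != c y.
  apply/negP => cxy; have := star x y; rewrite /inner xy cxy => /(_ isT).
  by rewrite (negbTE xw) (negbTE yw).
have iw v : v != w -> c v = c w -> e w v -> inner w v by move=> _ cv wv; rewrite /inner wv cv eqxx.
case: (eqVneq (c x) (c w)) => [cxw|cxw]; case: (eqVneq (c y) (c w)) => [cyw|cyw].
- by rewrite cxw cyw eqxx in cxy.
- case: (eqVneq (c y) j0) => [cyj|cyj]; last by case: ifP.
  case: (boolP (e w x)) => wx; case: (boolP (e w y)) => wy //.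
  by have := noSR _ _ (iw _ xw cxw wx) cyj wy; rewrite xy.
- case: (eqVneq (c x) j0) => [cxj|cxj]; last by case: ifP.
  case: (boolP (e w x)) => wx; case: (boolP (e w y)) => wy //.
  by have := noSR _ _ (iw _ yw cyw wy) cxj wx; rewrite es xy.
- case: (eqVneq (c x) j0) => [cxj|cxj]; case: (eqVneq (c y) j0) => [cyj|cyj].
  + by rewrite cxj cyj eqxx in cxy.
  + by case: ifP.
  + by case: ifP.
  + by apply: contra cxy => /eqP/fi ->//; rewrite inA.
Qed.

End Star.

(** * Choice of constants and the homomorphism into the wheel *)

Lemma nat_above (R : realType) (x : R) : exists N : nat, forall n : nat, (N <= n)%N -> x <= n%:R.
Proof.
exists (Num.truncn `|x|).+1 => n hn; apply: le_trans (ler_norm x) _; apply: ltW.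
by apply: lt_le_trans (_ : (Num.truncn `|x|).+1%:R <= _); [exact: truncnS_gt|rewrite ler_nat].
Qed.

(* 1 - (1 - m)^2 at m = 1/(p-1), with a small margin: the loss in order caused by one vertex
   which misses a whole class. *)
Definition loss (R : realFieldType) (p : nat) : R :=
  let m := 1 / (p%:R - 1) in 2 * m - m ^+ 2 + m / 20.

Lemma loss_le1 (R : realFieldType) (p : nat) : (3 <= p)%N -> loss R p <= 1.
Proof.
move=> p3; have P3 : (3 : R) <= p%:R by rewrite ler_nat.
rewrite /loss /=; have : 1 / (p%:R - 1) <= 1 / 2 :> R by rewrite ler_pdivrMr; lra.
have : 0 < 1 / (p%:R - 1) :> R by rewrite divr_gt0//; lra.
by move: (1 / _) => m; nra.
Qed.

(** Fixes the order of quantifiers: [eps] depends only on p and q, and [C] must serve every number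
    [l] of exceptional vertices that [stable_colouring] allows for this [eps]. The value 1/(6000
    P^3) makes u = eps n and N = n/P satisfy N = 6000 P^2 u. *)
Lemma parameters (R : realFieldType) (P Q : R) : 3 <= P -> 0 <= Q ->
  exists eps C : R, [/\ 0 < eps, eps <= 1 / 2 & forall nn l : R, C <= nn -> 0 <= l ->
    l <= (8 * Q + 2 * P) / eps ^+ 2 + 2 * (P ^+ 2 + 4 * P * Q) ->
    exists N u : R, [/\ nn = P * N, N = 6000 * P ^+ 2 * u & u = eps * nn] /\
      [/\ Q + l + 1 <= u, nn * (8 * Q + 2 * P) <= u ^+ 2, 100 * (l + 4) ^+ 2 <= N,
          P * P + 6 < nn & 0 < N]].
Proof.
move=> P3 Q0; have P0 : 0 < P by lra.
have P1 : 1 <= P ^+ 3 by rewrite exprn_ege1//; lra.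
have P30 : 0 < 6000 * P ^+ 3 by lra.
have [eps epsE] : exists eps : R, eps = (6000 * P ^+ 3)^-1 by exists (6000 * P ^+ 3)^-1.
have eps0 : 0 < eps by rewrite epsE invr_gt0.
have epsh : eps <= 1 / 2 by rewrite epsE mul1r lef_pV2 ?posrE//; lra.
have [D DE] : exists D : R, D = (8 * Q + 2 * P) / eps ^+ 2 by exists ((8 * Q + 2 * P) / eps ^+ 2).
have D0 : 0 <= D by rewrite DE divr_ge0 ?exprn_ge0 ?ltW//; lra.
have [L LE] : exists L : R, L = D + 2 * (P ^+ 2 + 4 * P * Q) by exists (D + 2 * (P ^+ 2 + 4 * P * Q)).
have L0 : 0 <= L by have := mulr_ge0 (ltW P0) Q0; have := sqr_ge0 P; clear -LE D0; lra.
have [C1 C1E] : exists C : R, C = 6000 * P ^+ 3 * (Q + L + 1) by exists (6000 * P ^+ 3 * (Q + L + 1)).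
have [C2 C2E] : exists C : R, C = 100 * (L + 4) ^+ 2 * P by exists (100 * (L + 4) ^+ 2 * P).
have C10 : 0 <= C1 by rewrite C1E mulr_ge0 ?(ltW P30)//; clear -Q0 L0; lra.
have C20 : 0 <= C2 by rewrite C2E mulr_ge0 ?(ltW P0)// mulr_ge0 ?sqr_ge0.
have PP0 := mulr_ge0 (ltW P0) (ltW P0).
exists eps, (P * P + 7 + C1 + D + C2); split=> // nn l nbig l0; rewrite -DE -LE => lL.
have [hP hC1 hD hC2] : [/\ P * P + 7 <= nn, C1 <= nn, D <= nn & C2 <= nn].
  by move: nbig; clear -PP0 C10 D0 C20; split; lra.
have nn0 : 0 < nn by clear -PP0 hP; lra.
exists (nn / P), (eps * nn); split; split=> //.
- by field; rewrite gt_eqF.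
- by rewrite epsE; field; rewrite gt_eqF.
- apply: (@le_trans _ _ (Q + L + 1)); first by rewrite lerD2r lerD2l.
  by rewrite epsE mulrC ler_pdivlMr// mulrC -C1E.
- have -> : (eps * nn) ^+ 2 = nn * (nn * eps ^+ 2) by ring.
  by rewrite (ler_wpM2l (ltW nn0))// -ler_pdivrMr ?exprn_gt0// -DE.
- rewrite ler_pdivlMr//; apply: le_trans hC2.
  rewrite C2E ler_wpM2r// ?(ltW P0)// ler_wpM2l// -subr_ge0 subr_sqr.
  by rewrite mulr_ge0//; clear -lL l0 L0; lra.
- by clear -hP; lra.
- by rewrite divr_gt0.
Qed.

Lemma degree_bound (R : realFieldType) (P nn N u eps rho m d : R) : 3 <= P ->
  nn = P * N -> u = eps * nn -> 1 <= u -> 0 < N -> 0 < eps -> eps <= 1 / 2 -> 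
  (P - 1) * nn - P <= P * rho -> 1 - eps <= m -> (rho * m - d) ^+ 2 <= u ^+ 2 ->
  nn - N - 3 * u <= d.
Proof.
move=> P3 nnE uE u1 N0 eps0 epsh hrho hm hd.
have r1 : nn - N - 1 <= rho.
  rewrite -(@ler_pM2l _ P); last lra.
  by apply: le_trans hrho; rewrite nnE; lra.
have d1 : rho * m - d <= u.
  apply: le_trans (ler_norm _) _; rewrite -(@ler_pXn2r _ 2)// ?nnegrE//; last lra.
  by rewrite real_normK ?num_real.
have N1 : 3 * N <= nn by rewrite nnE ler_wpM2r// ltW.
have u2 : 2 * u <= nn by rewrite uE; have : 2 * eps <= 1; [lra|]; have : 0 <= nn; [lra|]; nra.
have h1 : (nn - N - 1) * (1 - eps) <= rho * m by apply: ler_pM => //; lra.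
have h2 : 0 <= eps * (N + 1) by rewrite mulr_ge0//; lra.
by move: d1 h1 h2; rewrite uE in u1 *; lra.
Qed.

Lemma wheel_hom (R : realType) (p q : nat) : (3 <= p)%N ->
  exists N0 : nat, forall n : nat, (N0 <= n)%N -> forall e : rel 'I_n, simple_graph e ->
    non_partite e p -> ~ contains_subgraph (@B_adj p q) e ->
    (p%:R - 1) * (n%:R - loss R p) <= p%:R * spec_rad R e ->
    exists h : 'I_n -> 'I_5 + 'I_p.-2, forall x y, e x y -> wheel (h x) (h y).
Proof.
move=> p3; have P3 : 3 <= p%:R :> R by rewrite ler_nat.
have [eps [C [eps0 epsh par]]] := parameters P3 (ler0n R q).
have [N0 hN0] := nat_above C.
exists N0.+1 => n nN e [ei' es] np nB hr.
have ei : irreflexive e by move=> x; apply/negbTE.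
have n0 : (0 < n)%N by apply: leq_trans nN.
have nbig := hN0 n (ltnW nN).
have [x [x_ge0 x1 xe]] := perron R es ei n0.
move: hr xe; move: (spec_rad R e) => rho hr xe.
have [mu [mu_ge0 mu_sqn mu_eig]] : exists mu : 'I_n -> R,
    [/\ forall v, 0 <= mu v, sqn mu = #|'I_n|%:R & forall v, nbsum e mu v = rho * mu v].
  exists (fun v => Num.sqrt n%:R * x v); split.
  - by move=> v; rewrite mulr_ge0 ?sqrtr_ge0.
  - rewrite /sqn; under eq_bigr do rewrite exprMn sqr_sqrtr ?ler0n//.
    by rewrite -mulr_sumr -/(sqn x) x1 mulr1 card_ord.
  - by move=> v; rewrite nbsumZ xe mulrCA.
have fc := book_free_cnb (conj ei' es) nB.
have nnE : #|'I_n|%:R = n%:R :> R by rewrite card_ord.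
have rho1 : (p%:R - 1) * #|'I_n|%:R - p%:R <= p%:R * rho.
  rewrite nnE; apply: le_trans hr; have := loss_le1 R p3; move: (loss R p) => l l1.
  have : (p%:R - 1) * l <= (p%:R - 1) * 1 by rewrite ler_wpM2l//; lra.
  lra.
(* [par] is first used with l = 0, because the size condition on n is required before [G] is
   available. *)
have [_ [_ [_ [_ _ _ n_ge _]]]] : exists N u : R, [/\ n%:R = p%:R * N, N = 6000 * p%:R ^+ 2 * u & u = eps * n%:R] /\
      [/\ q%:R + 0 + 1 <= u, n%:R * (8 * q%:R + 2 * p%:R) <= u ^+ 2, 100 * (0 + 4) ^+ 2 <= N,
          p%:R * p%:R + 6 < n%:R :> R & 0 < N].
  apply: par => //; rewrite addr_ge0 ?divr_ge0 ?sqr_ge0 ?mulr_ge0 ?addr_ge0 ?mulr_ge0//.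
rewrite -nnE in n_ge.
have mu2 := mu_le2 p3 mu_ge0 mu_sqn mu_eig rho1 n_ge.
have dev := deg_dev es ei p3 fc mu_ge0 mu_sqn mu_eig rho1 n_ge.
have [c0 [G [Gc Gmu Gin]]] := stable_colouring es ei p3 fc mu_ge0 mu_sqn mu_eig rho1 n_ge eps0 epsh.
have [N [u [[nN' uE uE'] [u1 dev' NG _ N00]]]] := par _ _ nbig (ler0n R _) Gc.
rewrite -nnE in nN' dev' uE'.
have u2 : #|~: G|%:R + 1 <= u by apply: le_trans u1; rewrite lerD2r lerDr.
have dev_u v : (rho * mu v - #|[set w | e v w]|%:R) ^+ 2 <= u ^+ 2 by exact: le_trans (dev v) _.
have deg_ge : {in G, forall v, #|'I_n|%:R - N - 3 * u <= #|[set w | e v w]|%:R}.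
  move=> v vG; apply: (degree_bound P3 nN' uE' _ N00 eps0 epsh rho1 (Gmu v vG) (dev_u v)).
  by apply: le_trans u2; rewrite lerDr.
have [c [cs ci co cc cf]] := full_colouring es ei p3 fc nN' uE u1 deg_ge Gin.
have hr' := hr; rewrite /loss /= -nnE in hr'.
have bud := budget es ei p3 nN' uE u2 cs co cc cf mu_ge0 mu2 mu_sqn mu_eig dev_u hr' NG.
have [/existsP[v /existsP[w /andP[vw cvw]]]|noin] :=
  boolP [exists v, exists w, e v w && (c v == c w)].
  have B24 : 24 / 25 * N <= N - 2 * (12 * p%:R ^+ 2 * u).
    have u0 : 0 <= u by apply: le_trans u2; rewrite addr_ge0 ?ler0n.
    have : 0 <= p%:R ^+ 2 * u by rewrite mulr_ge0 ?sqr_ge0.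
    by clear -uE; rewrite uE; lra.
  apply: (star_hom es ei p3 B24 N00 (conflict p3 u2 cs cf) bud (u0 := v) (v0 := w)).
  by rewrite /inner vw.
case: np; exists c => a b ab; apply: contra noin => cab.
by apply/existsP; exists a; apply/existsP; exists b; rewrite ab.
Qed.

(** * Blow-ups of the wheel *)

Lemma c5adj_sym : symmetric c5adj.
Proof. by move=> i j; rewrite /c5adj orbC. Qed.

Lemma c5adj_irr : irreflexive c5adj.
Proof. by case=> [[|[|[|[|[|]]]]]]. Qed.

Lemma wheel_sym m : symmetric (@wheel m).
Proof. by case=> i [] j //=; [exact: c5adj_sym|rewrite eq_sym]. Qed.

Lemma wheel_irr m : irreflexive (@wheel m).
Proof. by case=> i /=; [exact: c5adj_irr|rewrite eqxx]. Qed.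

(* A 5-cycle minus a vertex is a path, hence 2-coloured by the parity of the distance
   from the missing vertex. *)
Lemma c5_path_parity (k i j : 'I_5) : i != k -> j != k -> c5adj i j ->
  odd ((i + (5 - k)) %% 5)%N != odd ((j + (5 - k)) %% 5)%N.
Proof.
by case: k i j => [[|[|[|[|[|//]]]]] ?] [[|[|[|[|[|//]]]]] ?] [[|[|[|[|[|//]]]]] ?].
Qed.

(** Without a cycle vertex, the remaining path takes two new colours. Without a hub, the colour of
    that hub is given to cycle vertex 4, and the vertices 0 to 3 alternate. *)
Lemma wheel_minus_colorable m (a : 'I_5 + 'I_m) :
  exists g : 'I_5 + 'I_m -> 'I_m.+2, forall b d, b != a -> d != a -> wheel b d -> g b != g d.
Proof.
case: a => [k|k].
- exists (fun b : 'I_5 + 'I_m => match b return 'I_m.+2 with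
    | inl i => inord (m + odd ((i + (5 - k)) %% 5))%N
    | inr j => inord j end).
  have lt1 (b : bool) : (m + b < m.+2)%N by case: b; rewrite ?addn0 ?addn1.
  have lt2 (j : 'I_m) : (j < m.+2)%N by rewrite (leq_trans (ltn_ord j))// !leqW.
  case=> i [j|j] bk dk /= h; rewrite -val_eqE /= !inordK//.
  + by rewrite eqn_add2l; have := c5_path_parity bk dk h; case: odd; case: odd.
  + by rewrite gtn_eqF// (leq_trans (ltn_ord j))// leq_addr.
  + by rewrite ltn_eqF// (leq_trans (ltn_ord i))// leq_addr.
- exists (fun b : 'I_5 + 'I_m => match b return 'I_m.+2 with
    | inl i => if i == 4 :> nat then inord k else inord (m + odd i)%N
    | inr j => inord j end).
  have lt1 (b : bool) : (m + b < m.+2)%N by case: b; rewrite ?addn0 ?addn1.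
  have lt2 (j : 'I_m) : (j < m.+2)%N by rewrite (leq_trans (ltn_ord j))// !leqW.
  have ne (j : 'I_m) (b : bool) : j != (m + b)%N :> nat.
    by rewrite ltn_eqF// (leq_trans (ltn_ord j))// leq_addr.
  case=> i [j|j] bk dk /= h; rewrite -val_eqE /=.
  + case: ifP => /eqP i4; case: ifP => /eqP j4; rewrite !inordK ?ne//.
    * by move: h; rewrite /c5adj i4 j4.
    * by rewrite eq_sym ne.
    * rewrite eqn_add2l; move: h i4 j4.
      by case: i j {bk dk} => [[|[|[|[|[|//]]]]] ?] [[|[|[|[|[|//]]]]] ?].
  + case: ifP => /eqP i4; rewrite !inordK//; last by rewrite eq_sym ne.
    by apply: contra dk => /eqP/val_inj->.
  + by case: ifP => /eqP i4; rewrite inordK// inordK.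
  + by rewrite !inordK.
Qed.

(** A homomorphism that avoids [a] would compose with a colouring of the wheel minus [a] to a
    colouring of [e]. *)
Lemma wheel_hom_surj n m (e : rel 'I_n) (h : 'I_n -> 'I_5 + 'I_m) :
  non_partite e m.+2 -> (forall x y, e x y -> wheel (h x) (h y)) ->
  forall a, exists v, h v = a.
Proof.
move=> np hh a; have [/existsP[v /eqP]|no] := boolP [exists v, h v == a]; first by exists v.
have [g hg] := wheel_minus_colorable a.
case: np; exists (g \o h) => x y /hh; apply: hg.
- by apply: contra no => h1; apply/existsP; exists x.
- by apply: contra no => h1; apply/existsP; exists y.
Qed.

Definition blow n m (c : 'I_n -> 'I_5 + 'I_m) : rel 'I_n := fun u v => wheel (c u) (c v).

Lemma blow_sym n m (c : 'I_n -> 'I_5 + 'I_m) : symmetric (blow c).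
Proof. by move=> u v; exact: wheel_sym. Qed.

Lemma blow_irr n m (c : 'I_n -> 'I_5 + 'I_m) : irreflexive (blow c).
Proof. by move=> u; exact: wheel_irr. Qed.

Section BlowUp.
Variables (R : realType) (n m : nat) (c : 'I_n -> 'I_5 + 'I_m).
Hypothesis m0 : (0 < m)%N.
Hypothesis c_surj : forall a, exists v, c v = a.
Local Notation rho := (spec_rad R (blow c)).

Definition csize (a : 'I_5 + 'I_m) := #|[set v | c v == a]|.

Lemma blow_n0 : (0 < n)%N.
Proof. by have [[v vn] _] := c_surj (inl ord0); exact: leq_ltn_trans vn. Qed.

Lemma csize_gt0 a : (0 < csize a)%N.
Proof. by have [v cv] := c_surj a; apply/card_gt0P; exists v; rewrite inE cv. Qed.

(** Connectedness in the form used for positivity: a hub joins any two vertices of the cycle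
    classes, and a cycle class joins the vertices of one hub class. *)
Lemma blow_dist2 u v : blow c u v \/ exists z, blow c u z && blow c z v.
Proof.
rewrite /blow; case cu: (c u) => [i|i]; case cv: (c v) => [j|j]; try by left.
- right; have [z cz] := c_surj (inr (Ordinal m0)); by exists z; rewrite cz.
- right; have [z cz] := c_surj (inl ord0); by exists z; rewrite cz.
Qed.

Lemma blow_eigen_pos (x : 'I_n -> R) : (forall v, 0 <= x v) -> sqn x != 0 ->
  (forall v, nbsum (blow c) x v = rho * x v) -> 0 < rho /\ forall v, 0 < x v.
Proof.
move=> x0 xn xe.
have [u xu] : exists u, 0 < x u.
  have [/existsP[u xu]|no] := boolP [exists u, 0 < x u]; first by exists u.
  case/eqP: xn; rewrite /sqn big1// => v _; have : ~~ (0 < x v).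
    by apply: contra no => h; apply/existsP; exists v.
  by rewrite lt_def x0 andbT negbK => /eqP->; rewrite expr0n.
have step v w : blow c v w -> 0 < x v -> 0 < rho * x w.
  move=> vw xv; rewrite -xe /nbsum (bigD1 v) /=; last by rewrite blow_sym.
  by rewrite ltr_pwDl// sumr_ge0.
have rho0 : 0 < rho.
  have [w uw] : exists w, blow c u w.
    by case: (blow_dist2 u u) => [h|[z /andP[h _]]]; eexists; exact: h.
  have := step _ _ uw xu; rewrite lt_def mulf_eq0 negb_or => /andP[/andP[rn wn]].
  by rewrite pmulr_lge0 ?lt_def ?rn ?wn ?x0//.
have {}step v w : blow c v w -> 0 < x v -> 0 < x w.
  by move=> vw xv; have := step _ _ vw xv; rewrite pmulr_rgt0.
split=> // v; case: (blow_dist2 u v) => [h|[z /andP[h1 h2]]]; first exact: step h xu.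
exact: step h2 (step _ _ h1 xu).
Qed.

(** As rho is positive, an eigenvector entry is determined by the neighbourhood, hence by the class;
    so the Perron vector descends to one value [xi] per class. *)
Lemma blow_perron : exists xi : 'I_5 + 'I_m -> R,
  [/\ 0 < rho, forall a, 0 < xi a &
      forall a, rho * xi a = \sum_(b | wheel a b) (csize b)%:R * xi b].
Proof.
have n0 := blow_n0.
have [x [x0 x1 xe]] := perron R (@blow_sym _ _ c) (@blow_irr _ _ c) n0.
have [|rho0 xpos] := blow_eigen_pos x0 _ xe; first by rewrite x1 oner_neq0.
pose xi a := (\sum_(w | wheel a (c w)) x w) / rho.
have xxi v : x v = xi (c v).
  have E : \sum_(w | wheel (c v) (c w)) x w = rho * x v by exact: xe.
  by rewrite /xi E mulrC mulKf// gt_eqF.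
have sE b : \sum_(v | c v == b) x v = (csize b)%:R * xi b.
  rewrite (eq_bigr (fun=> xi b)); last by move=> v /eqP <-.
  by rewrite sumr_const mulr_natl /csize cardsE.
exists xi; split=> // [a|a].
  by have [v <-] := c_surj a; rewrite -xxi; exact: xpos.
rewrite /xi mulrCA divff ?gt_eqF// mulr1 (partition_big c (wheel a))//=.
apply: eq_bigr => b ab; rewrite -sE; apply: eq_bigl => v.
by case: (c v =P b) => [->|_]; rewrite ?ab ?andbF.
Qed.

Lemma class_sum (F : 'I_5 + 'I_m -> R) : \sum_v F (c v) = \sum_b (csize b)%:R * F b.
Proof.
rewrite (partition_big c predT)//=; apply: eq_bigr => b _.
rewrite (eq_bigr (fun=> F b)); last by move=> v /eqP <-.
by rewrite sumr_const mulr_natl /csize cardsE.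
Qed.

Lemma class_nbsum (z : 'I_5 + 'I_m -> R) v :
  nbsum (blow c) (z \o c) v = \sum_(b | wheel (c v) b) (csize b)%:R * z b.
Proof.
rewrite /nbsum big_mkcond /= [RHS]big_mkcond /=.
rewrite (class_sum (fun b => if wheel (c v) b then z b else 0)).
by apply: eq_bigr => b _; case: ifP => // _; rewrite mulr0.
Qed.

Lemma class_rayleigh (z : 'I_5 + 'I_m -> R) :
  \sum_b (csize b)%:R * (z b * (\sum_(d | wheel b d) (csize d)%:R * z d)) <=
  rho * \sum_b (csize b)%:R * z b ^+ 2.
Proof.
have := rayleigh (@blow_sym _ _ c) (@blow_irr _ _ c) blow_n0 (z \o c).
rewrite /sqn (class_sum (fun b => z b ^+ 2)); apply: le_trans.
rewrite -(class_sum (fun b => z b * (\sum_(d | wheel b d) (csize d)%:R * z d))).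
by rewrite le_eqVlt; apply/orP; left; apply/eqP; apply: eq_bigr => v _; rewrite class_nbsum.
Qed.

End BlowUp.

Lemma qform_vertex (R : realFieldType) (T : finType) (e : rel T) (x : T -> R) v :
  symmetric e -> irreflexive e ->
  qform e x = 2 * (x v * nbsum e x v) + \sum_(u | u != v) x u * \sum_(w | e u w && (w != v)) x w.
Proof.
move=> es ei; rewrite /qform (bigD1 v)//= mulrDl mul1r -addrA; congr (_ + _).
have E u : nbsum e x u = (e u v)%:R * x v + \sum_(w | e u w && (w != v)) x w.
  rewrite /nbsum (bigID (fun w => w == v)) /=; congr (_ + _).
  rewrite big_mkcondl /= big_pred1_eq; case: (e u v); rewrite ?mul1r ?mul0r//.
under eq_bigr do rewrite E mulrDr.
rewrite big_split /=; congr (_ + _).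
rewrite (E v) ei mul0r add0r mulr_sumr [LHS]big_mkcond [RHS]big_mkcond; apply: eq_bigr => u _.
by rewrite andbC (es v u); case: (u =P v) => //= _; case: (e u v); rewrite ?mul1r ?mul0r ?mulr0// mulrC.
Qed.

Definition recolor n (V : eqType) (c : 'I_n -> V) v t : 'I_n -> V :=
  fun w => if w == v then t else c w.

Section Moves.
Variables (R : realType) (n m : nat) (c : 'I_n -> 'I_5 + 'I_m).
Hypothesis m0 : (0 < m)%N.
Hypothesis c_surj : forall a, exists v, c v = a.
Local Notation rho := (spec_rad R (blow c)).
Hypothesis c_max : forall c' : 'I_n -> 'I_5 + 'I_m, (forall a, exists v, c' v = a) ->
  spec_rad R (blow c') <= rho.
Variable xi : 'I_5 + 'I_m -> R.
Hypothesis rho0 : 0 < rho.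
Hypothesis xi0 : forall a, 0 < xi a.
Hypothesis xiE : forall a, rho * xi a = \sum_(b | wheel a b) (csize c b)%:R * xi b.

Lemma recolor_surj v t : (1 < csize c (c v))%N -> forall a, exists w, recolor c v t w = a.
Proof.
move=> s2 a; have [->|at_] := eqVneq a t; first by exists v; rewrite /recolor eqxx.
have [w wv cw] : exists2 w, w != v & c w = a.
  have [E|av] := eqVneq a (c v); last first.
    by have [w cw] := c_surj a; exists w => //; apply: contra av => /eqP<-; rewrite cw.
  move: s2; rewrite /csize (cardsD1 v) inE eqxx ltnS => /card_gt0P[w].
  by rewrite !inE E => /andP[wv /eqP cw]; exists w.
by exists w; rewrite /recolor (negbTE wv).
Qed.

(** Move one vertex v from class a to class t and test with the old Perron vector: the form changes
    by twice [x v] times the change of the neighbour sum of v, which maximality makes nonpositive.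
    The term [wheel a t] appears because v itself leaves class a. If the change were zero, the old
    vector would be an eigenvector of the new graph, but a vertex of class z has gained the
    neighbour v and lost none. *)
Lemma move_vertex a t : (1 < csize c a)%N -> a != t ->
  rho * xi t <= (rho + (wheel a t)%:R) * xi a /\
  (forall z, wheel t z -> ~~ wheel a z -> z != a ->
     rho * xi t < (rho + (wheel a t)%:R) * xi a).
Proof.
have [v <-] := c_surj a; move=> s2 at_; pose x w := xi (c w).
pose c' := recolor c v t; have c's := recolor_surj t s2.
have n0 := blow_n0 c_surj.
have c'v : c' v = t by rewrite /c' /recolor eqxx.
have c'w w : w != v -> c' w = c w by rewrite /c' /recolor => /negbTE->.
have xe w : nbsum (blow c) x w = rho * x w by rewrite class_nbsum -xiE.
have x0 w : 0 < x w by exact: xi0.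
have sx : 0 < sqn x.
  rewrite lt_def sqn_ge0 andbT; apply/eqP => /sqn_eq0/(_ v) h.
  by have := x0 v; rewrite h ltxx.
have nbE : nbsum (blow c') x v = rho * xi t - (wheel (c v) t)%:R * x v.
  have -> : rho * xi t = \sum_(w | wheel t (c w)) x w.
    rewrite xiE big_mkcond /= [RHS]big_mkcond /= (class_sum c (fun b => if wheel t b then xi b else 0)).
    by apply: eq_bigr => b _; case: ifP; rewrite ?mulr0.
  rewrite (bigID (pred1 v)) /= big_mkcondl /= big_pred1_eq wheel_sym.
  rewrite [X in _ = X + _ - _](_ : _ = (wheel (c v) t)%:R * x v); last first.
    by case: ifP; rewrite ?mul1r ?mul0r.
  rewrite addrAC subrr add0r /nbsum; apply: eq_bigl => w; rewrite /blow c'v.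
  by have [->|wv] := eqVneq w v; rewrite ?c'v ?wheel_irr ?andbF// c'w// andbT.
have qE : qform (blow c') x - qform (blow c) x = 2 * x v * (nbsum (blow c') x v - rho * x v).
  rewrite !(@qform_vertex _ _ _ x v)//; [|exact: blow_sym|exact: blow_irr|exact: blow_sym|exact: blow_irr].
  rewrite xe [X in _ + X - _](_ : _ = \sum_(u | u != v) x u * \sum_(w | blow c u w && (w != v)) x w).
    by ring.
  apply: eq_bigr => u uv; congr (_ * _); apply: eq_bigl => w.
  by have [->|wv] := eqVneq w v; rewrite ?andbF// /blow !c'w.
have qc : qform (blow c) x = rho * sqn x by exact: qform_eigen.
have ray := rayleigh (@blow_sym _ _ c') (@blow_irr _ _ c') n0 x.
have mx : spec_rad R (blow c') * sqn x <= rho * sqn x by rewrite ler_pM2r ?c_max.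
have le : nbsum (blow c') x v <= rho * x v.
  rewrite -subr_le0 -(pmulr_rle0 _ (_ : 0 < 2 * x v)) ?mulr_gt0// -qE subr_le0 qc.
  exact: le_trans ray mx.
have -> : (rho + (wheel (c v) t)%:R) * xi (c v) = rho * x v + (wheel (c v) t)%:R * x v.
  by rewrite mulrDl.
split; first by rewrite -lerBlDr -nbE.
move=> z tz az za; rewrite -ltrBlDr -nbE lt_def le andbT; apply/eqP => eq.
have q' : qform (blow c') x = rho * sqn x.
  by apply/eqP; rewrite -qc -subr_eq0 qE eq subrr mulr0.
have r' : spec_rad R (blow c') = rho.
  apply/eqP; rewrite eq_le c_max//= -(ler_pM2r sx) -q'; exact: ray.
have [u cu] := c_surj z.
have := rayleigh_eq (@blow_sym _ _ c') (@blow_irr _ _ c') n0 (x := x).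
rewrite q' r' => /(_ erefl u); rewrite -xe.
have uv : u != v by apply: contra za => /eqP<-; rewrite cu.
rewrite /nbsum (bigD1 v) /=; last by rewrite /blow c'v c'w// cu wheel_sym.
have -> : \sum_(w | blow c' u w && (w != v)) x w = \sum_(w | blow c u w) x w.
  apply: eq_bigl => w; rewrite /blow c'w// cu.
  have [->|wv] := eqVneq w v; last by rewrite c'w// andbT.
  by rewrite andbF wheel_sym (negbTE az).
move/eqP; rewrite -subr_eq0 addrK => /eqP h.
by have := x0 v; rewrite h ltxx.
Qed.

(** For nonadjacent i and j some z is adjacent to j but not to i, and likewise with i and j
    exchanged; two large classes would give strict inequalities in both directions. *)
Lemma c5_classes (i j : 'I_5) : i != j -> ~~ c5adj i j ->
  (csize c (inl i) <= 1)%N || (csize c (inl j) <= 1)%N.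
Proof.
move=> ij nij; apply/negPn/negP; rewrite negb_or -!ltnNge => /andP[si sj].
have w (a b : 'I_5) : a != b -> ~~ c5adj a b ->
    exists z : 'I_5, [/\ c5adj b z, ~~ c5adj a z & z != a].
  have h : forall a b : 'I_5, a != b -> ~~ c5adj a b ->
    [|| c5adj b (inord (b.+1 %% 5)) && ~~ c5adj a (inord (b.+1 %% 5)) && (inord (b.+1 %% 5) != a) |
        c5adj b (inord (b.+4 %% 5)) && ~~ c5adj a (inord (b.+4 %% 5)) && (inord (b.+4 %% 5) != a)].
    move=> [[|[|[|[|[|//]]]]] ?] [[|[|[|[|[|//]]]]] ?] //=; rewrite /c5adj -?val_eqE /= ?inordK//.
  by move=> ab nab; case/orP: (h _ _ ab nab) => /andP[/andP[]]; eexists; split; eassumption.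
have {w}lt (a b : 'I_5) : (1 < csize c (inl a))%N -> a != b -> ~~ c5adj a b ->
    xi (inl b) < xi (inl a).
  move=> sa ab nab; have [z [bz az za]] := w _ _ ab nab.
  have [|_ /(_ (inl z) bz az za)] := move_vertex (t := inl b) sa; first by [].
  by rewrite /= (negbTE nab) addr0 ltr_pM2l.
have := lt _ _ si ij nij; rewrite c5adj_sym eq_sym in ij nij.
by move=> h; have := lt_trans h (lt _ _ sj ij nij); rewrite ltxx.
Qed.

End Moves.

(** * Comparing class sizes *)

(* The eigenvector equations of a blow-up whose classes 0, 1, 4 of the 5-cycle are single vertices:
   w, s, r are the entries at these vertices, b and a the entries on the classes 2 and 3, of sizes
   be and al, and tau is the sum of the entries over the classes outside the 5-cycle. *)
Record class_eqs (R : realFieldType) (rho w s b a r tau al be : R) : Prop := ClassEqs {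
  w_gt0 : 0 < w; s_gt0 : 0 < s; b_gt0 : 0 < b; a_gt0 : 0 < a; r_gt0 : 0 < r; tau_gt0 : 0 < tau;
  rho_ge5 : 5 <= rho; al_ge1 : 1 <= al; be_ge1 : 1 <= be;
  eqn_w : rho * w = tau + s + r; eqn_s : rho * s = tau + w + be * b;
  eqn_b : rho * b = tau + s + al * a; eqn_a : rho * a = tau + r + be * b;
  eqn_r : rho * r = tau + w + al * a }.

(** The long sum is the total of all entries. A vertex of class 3 misses its own class, w and s. *)
Lemma class_eqs_a (R : realFieldType) (rho w s b a r tau al be : R) :
  class_eqs rho w s b a r tau al be ->
  (rho + al) * a = (tau + w + s + r + al * a + be * b) - w - s.
Proof.
move=> eqs; have [w0 s0 b0 a0 r0 tau0 rho5 al1 be1 Ew Es Eb Ea Er] := eqs.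
by move: Ea; lra.
Qed.

Lemma class_eqs_ws (R : realFieldType) (rho w s b a r tau al be : R) :
  class_eqs rho w s b a r tau al be ->
  rho * (w + s) = (tau + w + s + r + al * a + be * b) + tau - al * a.
Proof.
move=> eqs; have [w0 s0 b0 a0 r0 tau0 rho5 al1 be1 Ew Es Eb Ea Er] := eqs.
by move: Ew Es; lra.
Qed.

(** The differences a - s and r - w are coupled by two equations; eliminating the second leaves a
    positive multiple of a - s equal to (al - 1) a. *)
Lemma class_eqs_s_le_a (R : realFieldType) (rho w s b a r tau al be : R) :
  class_eqs rho w s b a r tau al be ->
  s <= a.
Proof.
move=> eqs; have [w0 s0 b0 a0 r0 tau0 rho5 al1 be1 Ew Es Eb Ea Er] := eqs.
have h1 : rho * (a - s) = r - w by move: Ea Es; lra.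
have h2 : (rho + 1) * (r - w) = al * a - s by move: Er Ew; lra.
have h3 : a <= al * a by rewrite ler_peMl// ltW.
have h4 : ((rho + 1) * rho - 1) * (a - s) >= 0.
  have -> : ((rho + 1) * rho - 1) * (a - s) = al * a - a.
    have : (rho + 1) * (rho * (a - s)) = al * a - s by rewrite h1 h2.
    by lra.
  by rewrite subr_ge0.
have h5 : 0 < (rho + 1) * rho - 1 by have := rho5; clear; nra.
by move: h4; rewrite pmulr_rge0// subr_ge0.
Qed.

Lemma class_eqs_w_le_s (R : realFieldType) (rho w s b a r tau al be : R) :
  class_eqs rho w s b a r tau al be ->
  w <= s.
Proof.
move=> eqs; have [w0 s0 b0 a0 r0 tau0 rho5 al1 be1 Ew Es Eb Ea Er] := eqs.
have h1 : rho * (b - r) = s - w by move: Eb Er; lra.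
have h2 : (rho + 1) * (s - w) = be * b - r by move: Es Ew; lra.
have h3 : b <= be * b by rewrite ler_peMl// ltW.
have h4 : ((rho + 1) * rho - 1) * (b - r) >= 0.
  have -> : ((rho + 1) * rho - 1) * (b - r) = be * b - b.
    have : (rho + 1) * (rho * (b - r)) = be * b - r by rewrite h1 h2.
    by lra.
  by rewrite subr_ge0.
have h5 : 0 < (rho + 1) * rho - 1 by have := rho5; clear; nra.
have h6 : 0 <= b - r by move: h4; rewrite pmulr_rge0.
have : 0 <= rho * (b - r) by rewrite mulr_ge0//; have := rho5; lra.
by rewrite h1 subr_ge0.
Qed.

(** The last inequality is optimality against a move from class 3 to a hub of size nu. Class 3
    misses w and s in addition, and by [class_eqs_ws] they weigh so much that optimality would give
    tau + w + rho (al - nu) xi <= al a, whereas al a <= al xi <= tau + (al - nu) xi. *)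
Lemma no_move_to_class (R : realFieldType) (rho w s b a r tau al be : R) (nu xi : R) :
  class_eqs rho w s b a r tau al be ->
  1 <= nu -> nu <= al -> 0 < xi -> nu * xi <= tau ->
  (rho + nu) * xi = (tau + w + s + r + al * a + be * b) -> ~ rho * xi <= (rho + 1) * a.
Proof.
move=> eqs; have [w0 s0 b0 a0 r0 tau0 rho5 al1 be1 Ew Es Eb Ea Er] := eqs.
move=> nu1 nual xi0 nuxi Exi hm.
have ea := class_eqs_a eqs; have ews := class_eqs_ws eqs.
have h1 : (rho + al) * (rho * xi) <= (rho + al) * ((rho + 1) * a).
  by rewrite ler_wpM2l//; clear -rho5 al1; lra.
have h2 : (rho + al) * ((rho + 1) * a) = (rho + 1) * (rho + nu) * xi - (rho + 1) * (w + s).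
  have -> : (rho + al) * ((rho + 1) * a) = (rho + 1) * ((rho + al) * a) by clear; ring.
  rewrite ea -Exi; clear; ring.
have h3 : (rho + 1) * (w + s) + rho * (al - nu) * xi <= (rho + nu) * xi.
  by clear -h1 h2; lra.
have h4 : tau + w + rho * (al - nu) * xi <= al * a.
  have : (rho + 1) * (w + s) = (tau + w + s + r + al * a + be * b) + tau - al * a + (w + s) by rewrite -ews; clear; ring.
  by clear -h3 Exi s0; lra.
have axi : a < xi.
  have : (rho + al) * a < (rho + al) * xi.
    apply: (@lt_le_trans _ _ ((rho + nu) * xi)); first by rewrite ea Exi; clear -w0 s0; lra.
    by rewrite ler_wpM2r ?(ltW xi0)// lerD2l.
  by rewrite ltr_pM2l//; clear -rho5 al1; lra.
have h5 : al * a <= nu * xi + (al - nu) * xi.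
  have : al * a <= al * xi by rewrite ler_wpM2l ?(ltW axi)//; clear -al1; lra.
  by clear; lra.
have h6 : (al - nu) * xi <= rho * (al - nu) * xi.
  rewrite -mulrA ler_peMl//; last by clear -rho5; lra.
  by rewrite mulr_ge0 ?(ltW xi0)// subr_ge0.
by clear -h4 h5 h6 nuxi w0; lra.
Qed.

(** With d = r - s one has rho d = al a - be b and rho (b - a) = (rho - 1) d. Optimality says (rho -
    1) d <= a, whereas a gap of two gives rho d >= 2 b - al (b - a), and the bound on al keeps the
    correction below 3/4 (rho - 1) d. *)
Lemma no_unbalanced_pair (R : realFieldType) (rho w s b a r tau al be : R) :
  class_eqs rho w s b a r tau al be ->
  be + 2 <= al -> al <= 3 / 4 * rho -> ~ rho * b <= (rho + 1) * a.
Proof.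
move=> eqs; have [w0 s0 b0 a0 r0 tau0 rho5 al1 be1 Ew Es Eb Ea Er] := eqs.
move=> hal hr hm; have rho0 : 0 < rho by clear -rho5; lra.
have [d dE] : exists d, d = r - s by exists (r - s).
have hd : rho * d = al * a - be * b by rewrite dE; move: Er Es; clear; lra.
have hb : rho * (b - a) = (rho - 1) * d.
  have : rho * (b - a) = s - r + al * a - be * b by move: Eb Ea; clear; lra.
  by rewrite [(rho - 1) * d]mulrBl hd dE mul1r => ->; clear; lra.
have h1 : (rho - 1) * d <= a by rewrite -hb; clear -hm; lra.
have d0 : 0 < d.
  rewrite ltNge; apply/negP => dn.
  have : b <= a.
    have : rho * (b - a) <= 0 by rewrite hb mulr_ge0_le0//; clear -rho5; lra.
    by rewrite pmulr_rle0// subr_le0.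
  have bb : 0 <= (al - be) * b by rewrite mulr_ge0 ?(ltW b0)//; clear -hal; lra.
  move=> ba; have : al * b <= al * a by rewrite ler_wpM2l//; clear -al1; lra.
  have : rho * d <= 0 by rewrite mulr_ge0_le0// ltW.
  have : 0 < (al - be) * b by rewrite mulr_gt0//; clear -hal; lra.
  by rewrite hd; clear; lra.
have ba : a < b.
  have : 0 < rho * (b - a) by rewrite hb mulr_gt0//; clear -rho5; lra.
  by rewrite pmulr_rgt0// subr_gt0.
have h2 : 2 * b - al * (b - a) <= rho * d.
  have : be * b <= (al - 2) * b by rewrite ler_wpM2r ?(ltW b0)//; clear -hal; lra.
  by rewrite hd; clear; lra.
have h3 : al * (b - a) <= 3 / 4 * ((rho - 1) * d).
  rewrite -hb mulrA ler_wpM2r//; clear -ba; lra.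
have h4 : 2 * ((rho - 1) * d) < rho * d + 3 / 4 * ((rho - 1) * d).
  by clear -h1 h2 h3 ba; lra.
have : 0 <= (rho - 5) * d by rewrite mulr_ge0 ?(ltW d0)// subr_ge0.
by clear -h4 d0; lra.
Qed.

(** A first estimate with crude lower-order terms: 9 = 3 + 4 + 2, from 3 rho, 2 nu <= 4 rho and al
    <= 2 rho. It serves to make al large in [cycle_large]. *)
Lemma class_le_al (R : realFieldType) (rho w s b a r tau al be : R) (nu xi : R) :
  class_eqs rho w s b a r tau al be ->
  0 < xi -> 1 <= nu -> nu <= 2 * rho -> al <= 2 * rho ->
  (rho + nu) * xi = (tau + w + s + r + al * a + be * b) -> rho * a <= (rho + 1) * xi -> nu <= al + 9.
Proof.
move=> eqs; have [w0 s0 b0 a0 r0 tau0 rho5 al1 be1 Ew Es Eb Ea Er] := eqs.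
move=> xi0 nu1 nur alr Exi hm.
have rho0 : 0 < rho by clear -rho5; lra.
have ea := class_eqs_a eqs; have ews := class_eqs_ws eqs.
have aa : 0 < al * a by rewrite mulr_gt0//; clear -al1; lra.
have bb : 0 < be * b by rewrite mulr_gt0//; clear -be1; lra.
have s2 : rho * (w + s) <= 2 * (tau + w + s + r + al * a + be * b) by rewrite ews; clear -aa bb w0 s0 r0; lra.
have sg : 0 < (tau + w + s + r + al * a + be * b) by rewrite -Exi mulr_gt0//; clear -rho0 nu1; lra.
have h1 : (rho + nu) * ((rho + al) * (rho * a)) <= (rho + nu) * ((rho + al) * ((rho + 1) * xi)).
  by rewrite ler_wpM2l ?ler_wpM2l//; clear -rho0 nu1 al1; lra.
have h2 : (rho + nu) * ((rho + al) * (rho * a)) = (rho + nu) * (rho * (tau + w + s + r + al * a + be * b) - rho * (w + s)).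
  have -> : (rho + nu) * ((rho + al) * (rho * a)) = (rho + nu) * (rho * ((rho + al) * a)) by clear; ring.
  by rewrite ea; clear; ring.
have h3 : (rho + nu) * ((rho + al) * ((rho + 1) * xi)) = (rho + al) * (rho + 1) * (tau + w + s + r + al * a + be * b).
  by rewrite -Exi; clear; ring.
have h4 : (rho + nu) * (rho * (tau + w + s + r + al * a + be * b) - 2 * (tau + w + s + r + al * a + be * b)) <= (rho + nu) * (rho * (tau + w + s + r + al * a + be * b) - rho * (w + s)).
  by rewrite ler_wpM2l ?lerD2l ?lerN2//; clear -rho0 nu1; lra.
have h5 : (rho + nu) * (rho - 2) <= (rho + al) * (rho + 1).
  rewrite -(ler_pM2r sg) -h3; apply: le_trans h1; rewrite h2; apply: le_trans h4.
  by rewrite le_eqVlt; apply/orP; left; apply/eqP; clear; ring.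
have h6 : rho * nu <= rho * (al + 9).
  by move: h5 nur alr; clear; lra.
by move: h6; rewrite ler_pM2l.
Qed.

(** For the largest admissible om both sides agree to first order in 1/P, and the constant 6 makes
    the second-order term favourable; the remaining polynomial has positive coefficients. *)
Lemma shift_gain (R : realFieldType) (P om sg : R) : 0 < P -> 0 < sg -> P ^+ 2 * om <= (2 * P - 6) * sg ->
  sg ^+ 2 * (P * (P + 1)) < (sg - om) ^+ 2 * ((P + 2) * (P + 3)).
Proof.
move=> P0 sg0 h.
have P20 : 0 < P ^+ 2 by rewrite exprn_gt0.
have k0 : 0 < P ^+ 2 - 2 * P + 6.
  have -> : P ^+ 2 - 2 * P + 6 = (P - 1) ^+ 2 + 5 by clear; ring.
  by have := sqr_ge0 (P - 1); clear; lra.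
have h1 : (P ^+ 2 - 2 * P + 6) * sg <= P ^+ 2 * (sg - om) by move: h; clear; lra.
have h2 : ((P ^+ 2 - 2 * P + 6) * sg) ^+ 2 <= (P ^+ 2 * (sg - om)) ^+ 2.
  have z0 : 0 <= (P ^+ 2 - 2 * P + 6) * sg by rewrite mulr_ge0 ?ltW.
  by rewrite ler_pXn2r// nnegrE// (le_trans z0).
have P23 : 0 < (P + 2) * (P + 3) by rewrite mulr_gt0//; clear -P0; lra.
have P40 : 0 < P ^+ 4 by rewrite exprn_gt0.
rewrite -(ltr_pM2l P40).
have -> : P ^+ 4 * ((sg - om) ^+ 2 * ((P + 2) * (P + 3))) =
   (P ^+ 2 * (sg - om)) ^+ 2 * ((P + 2) * (P + 3)) by clear; ring.
apply: lt_le_trans (_ : ((P ^+ 2 - 2 * P + 6) * sg) ^+ 2 * ((P + 2) * (P + 3)) <= _); last first.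
  by rewrite ler_wpM2r// ltW.
rewrite -subr_gt0.
have -> : ((P ^+ 2 - 2 * P + 6) * sg) ^+ 2 * ((P + 2) * (P + 3)) - P ^+ 4 * (sg ^+ 2 * (P * (P + 1)))
  = sg ^+ 2 * (2 * P ^+ 4 + 32 * P ^+ 3 + 12 * P ^+ 2 + 36 * P + 216) by clear; ring.
rewrite mulr_gt0 ?exprn_gt0//.
have P30 : 0 < P ^+ 3 by rewrite exprn_gt0.
by clear -P0 P20 P30 P40; lra.
Qed.

(* The quantities subtracted below are the values which solve the old class equations with
   the old radius after one vertex of a class of size nu has been moved to the class of a. *)
Lemma shift_class (R : realFieldType) (rho w s b a r tau al be : R) (nu xi xi' a' E D : R) :
  class_eqs rho w s b a r tau al be ->
  0 < xi -> al + 3 <= nu -> 30 <= be -> al <= be + 1 -> be <= al + 1 ->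
  (rho + nu) * xi = (tau + w + s + r + al * a + be * b) ->
  xi' = (tau + w + s + r + al * a + be * b) / (rho + nu - 1) -> a' = ((tau + w + s + r + al * a + be * b) - w - s) / (rho + al + 1) ->
  E = (al + 1) * a' - al * a -> D = E - (nu * xi - (nu - 1) * xi') ->
  E * (w + s) < D * ((tau + w + s + r + al * a + be * b) + D).
Proof.
move=> eqs; have [w0 s0 b0 a0 r0 tau0 rho5 al1 be1 Ew Es Eb Ea Er] := eqs.
move=> xi0 hnu be30 h1 h2 Exi xi'E a'E DefE DefD.
have rho0 : 0 < rho by clear -rho5; lra.
have ea := class_eqs_a eqs; have ews := class_eqs_ws eqs; have sa := class_eqs_s_le_a eqs; have ws := class_eqs_w_le_s eqs.
have aa : 0 < al * a by rewrite mulr_gt0//; clear -al1; lra.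
have bb : 0 < be * b by rewrite mulr_gt0//; clear -be1; lra.
have ba : a / 2 <= b.
  rewrite leNgt; apply/negP => ba.
  have hd : rho * (r - s) = al * a - be * b by move: Er Es; clear; lra.
  have hb : rho * (b - a) = s - r + al * a - be * b by move: Eb Ea; clear; lra.
  have : be * b <= (al + 1) * (a / 2).
    by rewrite ler_pM ?(ltW b0) ?(ltW ba)//; clear -be1; lra.
  have : 1 * a <= al * a by rewrite ler_wpM2r// ltW.
  move=> ha hbb; have rs : 0 <= rho * (r - s) by rewrite hd; clear -ha hbb; lra.
  have rs0 : 0 <= r - s by rewrite -(pmulr_rge0 _ rho0).
  have : 0 <= rho * (b - a).
    have -> : rho * (b - a) = (rho - 1) * (r - s) by rewrite [RHS]mulrBl hd hb mul1r; clear; ring.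
    by rewrite mulr_ge0//; clear -rho5; lra.
  by rewrite pmulr_rge0// subr_ge0; clear -ba a0; lra.
have [P PE] : exists P, P = rho + al by exists (rho + al).
have [sg sgE] : exists sg, sg = (tau + w + s + r + al * a + be * b) by exists (tau + w + s + r + al * a + be * b).
have [om omE] : exists om, om = w + s by exists (w + s).
have P30 : 30 <= P by rewrite PE; clear -h2 be30 rho5; lra.
have P0 : 0 < P by clear -P30; lra.
have sg0 : 0 < sg by rewrite sgE; clear -aa bb w0 s0 r0 tau0; lra.
have om0 : 0 < om by rewrite omE; clear -w0 s0; lra.
have Pa : P * a = sg - om by rewrite PE ea sgE omE; clear; ring.
have b15 : 15 * a <= be * b.
  have : 30 * (a / 2) <= be * b by rewrite ler_pM//; clear -a0; lra.
  by clear; lra.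
have Pom : P * om <= 2 * sg - be * b.
  have -> : P * om = rho * (w + s) + al * (w + s) by rewrite PE omE; clear; ring.
  have : al * (w + s) <= al * (a + a).
    by rewrite ler_wpM2l//; [clear -al1|clear -sa ws]; lra.
  by rewrite ews sgE; clear -w0 s0 r0; lra.
(* The surplus 6 comes from class 2: be b is at least 15 a, and P a is nearly the total [sg]. *)
have hP : P ^+ 2 * om <= (2 * P - 6) * sg.
  have : P * (P * om) <= P * (2 * sg - be * b) by rewrite ler_wpM2l// ltW.
  have : P * (15 * a) <= P * (be * b) by rewrite ler_wpM2l// ltW.
  have : 2 * om <= 4 * a by rewrite omE; clear -sa ws; lra.
  have Paa : 30 * a <= P * a by rewrite ler_wpM2r// ltW.
  have -> : P * (15 * a) = 15 * (P * a) by clear; ring.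
  rewrite expr2; move: Paa; rewrite Pa; clear -om0 sg0; lra.
have gain := shift_gain P0 sg0 hP.
have [k kE] : exists k, k = rho + nu by exists (rho + nu).
have kP : P + 3 <= k by rewrite kE PE; clear -hnu; lra.
have k0 : 0 < k by clear -kP P0; lra.
have k10 : 0 < k - 1 by clear -kP P0; lra.
have P10 : 0 < P + 1 by clear -P0; lra.
have xiE : xi = sg / k by rewrite sgE -Exi -kE mulrC mulKf// gt_eqF.
have aE : a = (sg - om) / P by rewrite -Pa mulrC mulKf// gt_eqF.
have EE : E = (sg - om) * rho / (P * (P + 1)).
  rewrite DefE a'E (_ : (tau + w + s + r + al * a + be * b) - w - s = sg - om); last by rewrite sgE omE; clear; ring.
  rewrite aE (_ : rho = P - al); last by rewrite PE; clear; ring.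
  rewrite (_ : P - al + al + 1 = P + 1); last by clear; ring.
  by clear -P0 P10; field; rewrite !gt_eqF.
have GE : nu * xi - (nu - 1) * xi' = sg * rho / (k * (k - 1)).
  rewrite xi'E -sgE xiE (_ : rho = k - nu); last by rewrite kE; clear; ring.
  rewrite (_ : k - nu + nu - 1 = k - 1); last by clear; ring.
  by clear -k0 k10; field; rewrite !gt_eqF.
have kk : (P + 2) * (P + 3) <= k * (k - 1).
  by rewrite mulrC; apply: ler_pM; clear -kP P0; lra.
have so0 : 0 < sg - om by rewrite -Pa mulr_gt0.
have E0 : 0 < E by rewrite EE divr_gt0 ?mulr_gt0.
have kk0 : 0 < k * (k - 1) by rewrite mulr_gt0.
have PP0 : 0 < P * (P + 1) by rewrite mulr_gt0.
have key : sg * (sg * rho / (k * (k - 1))) < (sg - om) * E.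
  rewrite EE [X in X < _](_ : _ = sg ^+ 2 * rho / (k * (k - 1))); last by clear; ring.
  rewrite [X in _ < X](_ : _ = (sg - om) ^+ 2 * rho / (P * (P + 1))); last by clear; ring.
  rewrite ltr_pdivrMr// [ltRHS]mulrAC ltr_pdivlMr//.
  rewrite [X in X < _](_ : _ = rho * (sg ^+ 2 * (P * (P + 1)))); last by clear; ring.
  rewrite [X in _ < X](_ : _ = rho * ((sg - om) ^+ 2 * (k * (k - 1)))); last by clear; ring.
  rewrite ltr_pM2l//; apply: lt_le_trans gain _.
  by rewrite ler_wpM2l// sqr_ge0.
have DE : D = E - sg * rho / (k * (k - 1)) by rewrite DefD GE.
have D0 : 0 < D.
  have : 0 < sg * D by rewrite DE mulrBr; have := mulr_gt0 om0 E0; move: key; clear; lra.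
  by rewrite pmulr_rgt0.
rewrite -sgE -omE; have : E * om < D * sg by rewrite DE; move: key; clear; lra.
by have := mulr_gt0 D0 D0; clear; lra.
Qed.

Definition q0 : 'I_5 := @Ordinal 5 0 isT.
Definition q1 : 'I_5 := @Ordinal 5 1 isT.
Definition q2 : 'I_5 := @Ordinal 5 2 isT.
Definition q3 : 'I_5 := @Ordinal 5 3 isT.
Definition q4 : 'I_5 := @Ordinal 5 4 isT.

Section WheelSums.
Variables (V : nmodType) (m : nat).

Lemma sum5 (F : 'I_5 -> V) : \sum_i F i = F q0 + F q1 + F q2 + F q3 + F q4.
Proof.
rewrite !big_ord_recl big_ord0 addr0 !addrA.
by congr (F _ + F _ + F _ + F _ + F _); apply: val_inj.
Qed.

Lemma wheel_sum (F : 'I_5 + 'I_m -> V) : \sum_b F b = \sum_i F (inl i) + \sum_j F (inr j).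
Proof. by rewrite big_sumType. Qed.

Lemma wheel_sum_inl i (F : 'I_5 + 'I_m -> V) : \sum_(b | wheel (inl i) b) F b =
  \sum_(k | c5adj i k) F (inl k) + \sum_j F (inr j).
Proof. by rewrite big_sumType. Qed.

Lemma wheel_sum_inr j (F : 'I_5 + 'I_m -> V) :
  \sum_b F b = F (inr j) + \sum_(b | wheel (inr j) b) F b.
Proof.
rewrite (bigD1 (inr j))//=; congr (_ + _); apply: eq_bigl => -[k|k] //=.
by rewrite eq_sym.
Qed.

Lemma c5_nbsum (F : 'I_5 -> V) :
  [/\ \sum_(k | c5adj q0 k) F k = F q1 + F q4, \sum_(k | c5adj q1 k) F k = F q0 + F q2,
      \sum_(k | c5adj q2 k) F k = F q1 + F q3, \sum_(k | c5adj q3 k) F k = F q2 + F q4 &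
      \sum_(k | c5adj q4 k) F k = F q0 + F q3].
Proof. by split; rewrite big_mkcond sum5 /c5adj /= ?addr0 ?add0r. Qed.

End WheelSums.

Lemma csize_recolor n m (c : 'I_n -> 'I_5 + 'I_m) v t b : c v != t ->
  csize (recolor c v t) b = (csize c b + (b == t) - (b == c v))%N.
Proof.
move=> vt; rewrite /csize.
have [->|bt] := eqVneq b t.
  rewrite eq_sym (negbTE vt) subn0 (cardsD1 v) inE /recolor eqxx eqxx addnC; congr (_ + _)%N.
  by apply: eq_card => w; rewrite !inE; have [->|] := eqVneq w v; rewrite // (negbTE vt).
rewrite addn0; have [->|bv] := eqVneq b (c v).
  rewrite [in RHS](cardsD1 v) inE eqxx addKn; apply: eq_card => w; rewrite !inE /recolor.
  by have [->|] := eqVneq w v; rewrite // eq_sym (negbTE vt).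
rewrite subn0; apply: eq_card => w; rewrite !inE /recolor; have [->|//] := eqVneq w v.
by rewrite eq_sym (negbTE bt) eq_sym (negbTE bv).
Qed.

(** * Class sizes of an optimal blow-up *)

Definition surj n m (c : 'I_n -> 'I_5 + 'I_m) := forall a, exists v, c v = a.

Definition opt (R : realType) n m (c : 'I_n -> 'I_5 + 'I_m) := surj c /\
  forall c' : 'I_n -> 'I_5 + 'I_m, surj c' -> spec_rad R (blow c') <= spec_rad R (blow c).

Definition c5_normal n m (c : 'I_n -> 'I_5 + 'I_m) :=
  [/\ csize c (inl q0) = 1%N, csize c (inl q1) = 1%N & csize c (inl q4) = 1%N].

Section Sizes.
Variables (R : realType) (n m : nat) (c : 'I_n -> 'I_5 + 'I_m).
Hypothesis m0 : (0 < m)%N.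
Hypothesis c_opt : opt R c.
Hypothesis c_normal : c5_normal c.
Local Notation rho := (spec_rad R (blow c)).
Hypothesis rho_big : 2 * n%:R <= 3 * rho + 3.
Hypothesis n_big : (60 * (m + 3) <= n)%N.
Local Notation al := (csize c (inl q3)).
Local Notation be := (csize c (inl q2)).
Local Notation nu j := (csize c (inr j)).

Let c_surj : surj c. Proof. by case: c_opt. Qed.

Lemma class_size_total : (3 + al + be + \sum_j nu j)%N = n.
Proof.
have := class_sum c (fun=> 1 : R).
rewrite wheel_sum sum5; have [-> -> ->] := c_normal.
rewrite sumr_const card_ord !mulr1 => h; apply/eqP; rewrite -(eqr_nat R) h.
rewrite !natrD natr_sum; apply/eqP; under [in RHS]eq_bigr do rewrite mulr1.
ring.
Qed.

Let be_gt0 : (0 < be)%N. Proof. exact: csize_gt0. Qed.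
Let al_gt0 : (0 < al)%N. Proof. exact: csize_gt0. Qed.
Let nu_gt0 j : (0 < nu j)%N. Proof. exact: csize_gt0. Qed.

Lemma rho_large : 5 <= rho.
Proof.
have : 180%:R <= n%:R :> R by rewrite ler_nat (leq_trans _ n_big)// mulnDr leq_addl.
by have := rho_big; lra.
Qed.

Lemma normal_perron : exists xi : 'I_5 + 'I_m -> R,
  let w := xi (inl q0) in let s := xi (inl q1) in let b := xi (inl q2) in
  let a := xi (inl q3) in let r := xi (inl q4) in
  let tau := \sum_j (nu j)%:R * xi (inr j) in
  let sigma := tau + w + s + r + al%:R * a + be%:R * b in
  [/\ class_eqs rho w s b a r tau al%:R be%:R,
      forall j, 0 < xi (inr j) /\ (rho + (nu j)%:R) * xi (inr j) = sigma &
      forall d t, (1 < csize c d)%N -> d != t -> wheel d t -> rho * xi t <= (rho + 1) * xi d].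
Proof.
have [xi [rho0 xi0 xiE]] := blow_perron R m0 c_surj.
exists xi => w s b a r tau sigma; have [z0 z1 z4] := c_normal.
have tau0 : 0 < tau.
  rewrite /tau (bigD1 (Ordinal m0))//= ltr_pwDl//.
    by rewrite mulr_gt0 ?ltr0n.
  by apply: sumr_ge0 => j _; rewrite mulr_ge0// ltW.
have [e0 e1 e2 e3 e4] := c5_nbsum (fun k => (csize c (inl k))%:R * xi (inl k)).
split=> //.
- split; [exact: xi0|exact: xi0|exact: xi0|exact: xi0|exact: xi0|exact: tau0|exact: rho_large|by rewrite ler1n|by rewrite ler1n|..].
  + by rewrite xiE wheel_sum_inl e0 z1 z4 !mul1r -/tau /s /r; ring.
  + by rewrite xiE wheel_sum_inl e1 z0 !mul1r -/tau /w /b; ring.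
  + by rewrite xiE wheel_sum_inl e2 z1 !mul1r -/tau /a /s; ring.
  + by rewrite xiE wheel_sum_inl e3 z4 !mul1r -/tau /r /b; ring.
  + by rewrite xiE wheel_sum_inl e4 z0 !mul1r -/tau /w /a; ring.
- move=> j; split=> //.
  have := wheel_sum_inr j (fun b => (csize c b)%:R * xi b); rewrite -xiE wheel_sum sum5.
  rewrite z0 z1 z4 -/tau !mul1r /sigma /w /s /b /a /r => h.
  rewrite mulrDl [RHS](_ : _ = (csize c (inr j))%:R * xi (inr j) + rho * xi (inr j)).
    by ring.
  by rewrite -h; ring.
- move=> d t sd dt wdt.
  have [_ cmax] := c_opt.
  by have [+ _] := move_vertex c_surj cmax xi0 xiE sd dt; rewrite wdt.
Qed.

Lemma cycle_lt_hub j : (1 < al)%N -> (al < nu j)%N.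
Proof.
move=> al2; rewrite ltnNge; apply/negP => h.
have [xi [eqs ht mv]] := normal_perron; have [xj0 Ej] := ht j.
apply: (no_move_to_class eqs _ _ xj0 _ Ej _).
- by rewrite ler1n.
- by rewrite ler_nat.
- rewrite (bigD1 j)//= lerDl sumr_ge0// => k _.
  by rewrite mulr_ge0// ltW//; case: (ht k).
- exact: (mv (inl q3) (inr j) al2).
Qed.

Lemma cycle_balanced : (al <= be.+1)%N.
Proof.
rewrite leqNgt; apply/negP => h.
have al2 : (1 < al)%N by rewrite (leq_ltn_trans be_gt0)// ltnW.
have [xi [eqs ht mv]] := normal_perron.
apply: (no_unbalanced_pair eqs _ _ (mv (inl q3) (inl q2) al2 isT isT)).
  by rewrite -natrD ler_nat addn2.
(* A hub is larger than class 3, so twice al is below n, which is at most about 3/2 rho; this yields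
   al <= 3/4 rho. *)
have h1 : (al + al.+1 + 4 <= n)%N.
  have := class_size_total; have := cycle_lt_hub (Ordinal m0) al2; have := be_gt0.
  by rewrite (bigD1 (Ordinal m0))//=; clear; lia.
move: h1; rewrite -(ler_nat R) !natrD -natr1; have := rho_big; lra.
Qed.

Lemma hub_le_weak j : (nu j <= al + 9)%N.
Proof.
have [nj1|nj2] := leqP (nu j) 1; first by rewrite (leq_trans nj1)// (leq_trans al_gt0)// leq_addr.
have [xi [eqs ht mv]] := normal_perron; have [xj0 Ej] := ht j.
have [h1 h2] : (nu j + 4 <= n)%N /\ (al + 4 <= n)%N.
  have := class_size_total; have := be_gt0; have := nu_gt0 j; have := al_gt0.
  by rewrite (bigD1 j)//=; clear; lia.
rewrite -(ler_nat R) natrD; apply: (class_le_al eqs xj0 _ _ _ Ej (mv (inr j) (inl q3) nj2 isT isT)).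
- by rewrite ler1n.
- by move: h1; rewrite -(ler_nat R) natrD; have := rho_big; have := rho_large; lra.
- by move: h2; rewrite -(ler_nat R) natrD; have := rho_big; have := rho_large; lra.
Qed.

Lemma cycle_large : (be <= al.+1)%N -> (40 <= al)%N.
Proof.
move=> hb; have : (\sum_j nu j <= m * (al + 9))%N.
  apply: (@leq_trans (\sum_(j < m) (al + 9))); first by apply: leq_sum => j _; exact: hub_le_weak.
  by rewrite sum_nat_const card_ord.
have := class_size_total; move: n_big hb; move: (\sum_j _)%N al be => S x y; clear; nia.
Qed.

(** A surplus of 3 is borderline to first order, so the old Perron vector is too crude a test. The
    vector [z] keeps its values except [xi'] and [a'], chosen so that with the old rho all classes
    have the same residual D, reduced by E at the classes 0 and 1. The Rayleigh bound then
    contradicts [shift_class]. *)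
Lemma hub_le j : (be <= al.+1)%N -> (nu j <= al.+2)%N.
Proof.
move=> hb; rewrite leqNgt; apply/negP => hj; have al40 := cycle_large hb.
have [xi [eqs ht mv]] := normal_perron; have [xj0 Ej] := ht j.
set w := xi (inl q0) in eqs ht Ej *; set s := xi (inl q1) in eqs ht Ej *.
set b := xi (inl q2) in eqs ht Ej *; set a := xi (inl q3) in eqs ht Ej *.
set r := xi (inl q4) in eqs ht Ej *.
set tau := \sum_j _ in eqs ht Ej *; set sigma := tau + w + s + r + al%:R * a + be%:R * b in Ej ht *.
have [v cv] := c_surj (inr j).
have nj2 : (1 < csize c (c v))%N by rewrite cv; apply: leq_trans hj.
have vt : c v != inl q3 by rewrite cv.
pose c' := recolor c v (inl q3).
have c's : surj c' := recolor_surj c_surj (inl q3) nj2.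
have [z0 z1 z4] := c_normal.
have sz d := @csize_recolor n m c v (inl q3) d vt; rewrite cv -/c' in sz.
pose xi' := sigma / (rho + (nu j)%:R - 1); pose a' := (sigma - w - s) / (rho + al%:R + 1).
pose E := (al%:R + 1) * a' - al%:R * a; pose D := E - ((nu j)%:R * xi (inr j) - ((nu j)%:R - 1) * xi').
have key : E * (w + s) < D * (sigma + D).
  apply: (shift_class eqs xj0 _ _ _ _ Ej (erefl xi') (erefl a') (erefl E) (erefl D)).
  - by rewrite -natrD ler_nat addn3.
  - by rewrite ler_nat; have := cycle_balanced; move: al40; clear; lia.
  - by rewrite natr1 ler_nat cycle_balanced.
  - by rewrite natr1 ler_nat.
pose z (d : 'I_5 + 'I_m) := if d == inl q3 then a' else if d == inr j then xi' else xi d.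
have sj : (csize c' (inr j))%:R = (nu j)%:R - 1 :> R.
  by rewrite sz eqxx addn0 natrB.
have sa : (csize c' (inl q3))%:R = al%:R + 1 :> R by rewrite sz eqxx subn0 natrD.
have so d : d != inl q3 -> d != inr j -> csize c' d = csize c d.
  by move=> /negbTE d1 /negbTE d2; rewrite sz d1 d2 addn0 subn0.
have zq : [/\ z (inl q0) = w, z (inl q1) = s, z (inl q2) = b, z (inl q3) = a' & z (inl q4) = r] by [].
have zj : z (inr j) = xi' by rewrite /z /= eqxx.
have zk k : k != j -> z (inr k) = xi (inr k).
  by move=> kj; rewrite /z /=; case: eqP => // -[] /eqP; rewrite (negbTE kj).
have sk k : k != j -> csize c' (inr k) = nu k.
  by move=> kj; rewrite so//; apply: contra kj => /eqP[->].
have s0 : csize c' (inl q0) = 1%N by rewrite so.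
have s1 : csize c' (inl q1) = 1%N by rewrite so.
have s2 : csize c' (inl q2) = be by rewrite so.
have s4 : csize c' (inl q4) = 1%N by rewrite so.
have Tz : \sum_k (csize c' (inr k))%:R * z (inr k) =
    tau - ((nu j)%:R * xi (inr j) - ((nu j)%:R - 1) * xi').
  rewrite (bigD1 j)//= sj zj /tau [in RHS](bigD1 j)//=.
  rewrite (eq_bigr (fun k => (nu k)%:R * xi (inr k))); last by move=> k kj; rewrite sk ?zk.
  by ring.
have [eqw eqs1 eqb eqa eqr] : [/\ rho * w = tau + s + r, rho * s = tau + w + be%:R * b,
   rho * b = tau + s + al%:R * a, (rho + al%:R) * a = sigma - w - s & rho * r = tau + w + al%:R * a].
  by case: (eqs) => *; split=> //; rewrite (class_eqs_a eqs).
have rl := rho_large.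
have eqa' : (rho + al%:R + 1) * a' = sigma - w - s.
  by rewrite /a' mulrC divfK// gt_eqF//; have := ler0n R al; lra.
have eqj' : (rho + (nu j)%:R - 1) * xi' = sigma.
  by rewrite /xi' mulrC divfK// gt_eqF//; have := ler0n R (nu j); lra.
have tot : \sum_d (csize c' d)%:R * z d = sigma + D.
  rewrite wheel_sum sum5 Tz s0 s1 s2 s4 sa; have [-> -> -> -> ->] := zq.
  by rewrite /D /E /sigma; ring.
pose nb d := \sum_(t | wheel d t) (csize c' t)%:R * z t.
have [e0 e1 e2 e3 e4] := c5_nbsum (fun k => (csize c' (inl k))%:R * z (inl k)).
have res d : nb d - rho * z d = D - (if (d == inl q0) || (d == inl q1) then E else 0).
  case: d => [k|k]; last first.
    have := wheel_sum_inr k (fun d => (csize c' d)%:R * z d); rewrite tot -/(nb _) => h.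
    have -> : nb (inr k) = sigma + D - (csize c' (inr k))%:R * z (inr k) by rewrite h; ring.
    have [->|kj] := eqVneq k j; first by rewrite sj zj /= subr0 -eqj'; ring.
    by rewrite sk// zk//= subr0; have [_ <-] := ht k; ring.
  rewrite /nb wheel_sum_inl Tz; have := zq => -[w0 w1 w2 w3 w4].
  have kE (k' : 'I_5) : k = k' -> k == k' by move=> ->.
  have [kk|[kk|[kk|[kk|kk]]]] : k = q0 \/ k = q1 \/ k = q2 \/ k = q3 \/ k = q4.
    by case: k {kE} => [[|[|[|[|[|//]]]]] ?]; do ?[by left; apply: val_inj | right]; apply: val_inj.
  - by rewrite kk e0 s1 s4 w0 w1 w4 /= eqw /D; ring.
  - by rewrite kk e1 s0 s2 w0 w1 w2 /= eqs1 /D; ring.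
  - by rewrite kk e2 s1 sa w1 w2 w3 /= eqb /D /E; ring.
  - rewrite kk e3 s2 s4 w2 w3 w4 /=.
    have -> : rho * a' = sigma - w - s - (al%:R + 1) * a' by rewrite -eqa'; ring.
    by rewrite /D /E /sigma; ring.
  - by rewrite kk e4 s0 sa w0 w3 w4 /= eqr /D /E; ring.
have ray := class_rayleigh c's z.
have [_ cmax] := c_opt.
have q0' : 0 <= \sum_d (csize c' d)%:R * z d ^+ 2.
  by apply: sumr_ge0 => d _; rewrite mulr_ge0// sqr_ge0.
have {}ray : \sum_d (csize c' d)%:R * (z d * nb d) <= rho * \sum_d (csize c' d)%:R * z d ^+ 2.
  by apply: le_trans ray _; rewrite ler_wpM2r// cmax.
have : \sum_d (csize c' d)%:R * (z d * (nb d - rho * z d)) <= 0.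
  rewrite (eq_bigr (fun d => (csize c' d)%:R * (z d * nb d) - rho * ((csize c' d)%:R * z d ^+ 2))).
    by rewrite sumrB -mulr_sumr subr_le0.
  by move=> d _; ring.
rewrite (eq_bigr (fun d => D * ((csize c' d)%:R * z d) -
   E * (if (d == inl q0) || (d == inl q1) then (csize c' d)%:R * z d else 0))); last first.
  by move=> d _; rewrite res; case: ifP => _; ring.
rewrite sumrB -!mulr_sumr tot -big_mkcond /=.
rewrite (bigD1 (inl q0))//= (bigD1 (inl q1))//= big1 ?addr0; last first.
  by move=> d /andP[/andP[/orP[->|->]]]; rewrite ?andbF.
have [-> -> _ _ _] := zq; rewrite s0 s1 !mul1r => h.
by move: key; rewrite ltNge -subr_le0 h.
Qed.

End Sizes.

(** * Uniqueness of the optimal blow-up *)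

Lemma spec_rad_ext (R : realType) n (e1 e2 : rel 'I_n) : e1 =2 e2 -> spec_rad R e1 = spec_rad R e2.
Proof.
move=> E; rewrite /spec_rad; congr (last _ (rootsR (char_poly _))).
by apply/matrixP => i j; rewrite !mxE E.
Qed.

(** The Perron vector of [e] gives the inequality. In case of equality it is also one of the
    blow-up, hence positive, and an edge absent from [e] would break an eigenvalue equation. *)
Lemma subgraph_blow (R : realType) n m (e : rel 'I_n) (c : 'I_n -> 'I_5 + 'I_m) :
  (0 < m)%N -> surj c -> symmetric e -> irreflexive e -> subrel e (blow c) ->
  spec_rad R e <= spec_rad R (blow c) /\
  (spec_rad R e = spec_rad R (blow c) -> e =2 blow c).
Proof.
move=> m0 c_surj es ei sub; have n0 := blow_n0 c_surj.
have [x [x0 x1 xe]] := perron R es ei n0.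
have le : qform e x <= qform (blow c) x.
  apply: ler_sum => u _; rewrite ler_wpM2l// /nbsum [leRHS](bigID (e u)) /=.
  rewrite (eq_bigl (e u)) ?lerDl ?sumr_ge0// => w; apply/andP/idP => [[]//|uw].
  by split=> //; exact: sub.
have qe : qform e x = spec_rad R e by rewrite (qform_eigen xe) x1 mulr1.
have ray := rayleigh (@blow_sym _ _ c) (@blow_irr _ _ c) n0 x.
rewrite x1 mulr1 in ray; split; first by rewrite -qe (le_trans le).
move=> eq; have qb : qform (blow c) x = spec_rad R (blow c).
  by apply/eqP; rewrite eq_le ray -eq -qe.
have xb : forall v, nbsum (blow c) x v = spec_rad R (blow c) * x v.
  by apply: rayleigh_eq; rewrite ?x1 ?mulr1//; [exact: blow_sym|exact: blow_irr].
have [|_ xpos] := blow_eigen_pos m0 c_surj x0 _ xb; first by rewrite x1 oner_neq0.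
move=> u v; apply/idP/idP; first exact: sub.
move=> uv; apply/negPn/negP => nuv; have := xb u; rewrite -eq -xe /nbsum.
rewrite (bigID (e u)) /= (eq_bigl (e u)); last first.
  by move=> w; apply/andP/idP => [[]//|uw]; split=> //; exact: sub.
rewrite [X in _ + X](bigD1 v) /=; last by rewrite uv.
move/eqP; rewrite addrC -subr_eq0 addrK => /eqP h.
have : 0 < x v + \sum_(i | blow c u i && ~~ e u i && (i != v)) x i.
  by rewrite ltr_pwDl// sumr_ge0.
by rewrite h ltxx.
Qed.

Lemma equicount_perm (V : finType) n (f g : 'I_n -> V) :
  (forall a, #|[set i | f i == a]| = #|[set i | g i == a]|) ->
  exists s : {perm 'I_n}, forall i, g (s i) = f i.
Proof.
move=> h; have : perm_eq [tuple f i | i < n] [tuple g i | i < n].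
  apply/allP => a _ /=; apply/eqP; rewrite !count_map /=.
  have E (k : 'I_n -> V) : count (preim k (pred1 a)) (enum 'I_n) = #|[set i | k i == a]|.
    by rewrite -sum1_count big_enum_cond -sum1_card; apply: eq_bigl => i; rewrite !inE.
  by rewrite -enumT; move: (E f) (E g); rewrite h => -> ->.
move=> /tuple_permP[s es]; exists s => i.
by have := congr1 (fun t : n.-tuple V => tnth t i) (val_inj es); rewrite !tnth_mktuple.
Qed.

Lemma blow_iso n m (c d : 'I_n -> 'I_5 + 'I_m) : (forall a, csize c a = csize d a) ->
  graph_iso (blow c) (blow d).
Proof.
move=> h; have [s hs] := equicount_perm h.
by exists s; split=> [|x y]; [exists (s^-1)%g; [exact: permK|exact: permKV]|rewrite /blow !hs].
Qed.

Section Relabel.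
Variables (R : realType) (n m : nat) (f : 'I_5 + 'I_m -> 'I_5 + 'I_m).
Hypotheses (f_inj : injective f) (f_wheel : forall a b, wheel (f a) (f b) = wheel a b).
Variable c : 'I_n -> 'I_5 + 'I_m.

Lemma relabel_blow : blow (f \o c) =2 blow c.
Proof. by move=> u v; rewrite /blow /= f_wheel. Qed.

Lemma relabel_csize a : csize (f \o c) (f a) = csize c a.
Proof. by apply: eq_card => v; rewrite !inE /= (inj_eq f_inj). Qed.

Lemma relabel_opt : opt R c -> opt R (f \o c).
Proof.
move=> [cs cm]; split.
  move=> a; have [v cv] := cs (invF f_inj a); exists v.
  by rewrite /= cv f_invF.
by move=> c' c's; rewrite (spec_rad_ext R relabel_blow); exact: cm.
Qed.

End Relabel.

Definition rot5 (k i : 'I_5) : 'I_5 := Ordinal (ltn_pmod (i + (5 - k)) (isT : (0 < 5)%N)).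
Definition refl5 (i : 'I_5) : 'I_5 := Ordinal (ltn_pmod (5 - i) (isT : (0 < 5)%N)).

Definition on_cycle m (g : 'I_5 -> 'I_5) (a : 'I_5 + 'I_m) : 'I_5 + 'I_m :=
  match a with inl i => inl (g i) | inr j => inr j end.
Definition on_hubs m (g : 'I_m -> 'I_m) (a : 'I_5 + 'I_m) : 'I_5 + 'I_m :=
  match a with inl i => inl i | inr j => inr (g j) end.

Lemma rot5_adj k i j : c5adj (rot5 k i) (rot5 k j) = c5adj i j.
Proof.
by case: k i j => [[|[|[|[|[|//]]]]] ?] [[|[|[|[|[|//]]]]] ?] [[|[|[|[|[|//]]]]] ?].
Qed.

Lemma rot5_inj k : injective (rot5 k).
Proof.
move=> i j /(congr1 val) /= h; apply: val_inj; move: h.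
by case: k i j => [[|[|[|[|[|//]]]]] ?] [[|[|[|[|[|//]]]]] ?] [[|[|[|[|[|//]]]]] ?].
Qed.

Lemma refl5_adj i j : c5adj (refl5 i) (refl5 j) = c5adj i j.
Proof. by case: i j => [[|[|[|[|[|//]]]]] ?] [[|[|[|[|[|//]]]]] ?]. Qed.

Lemma refl5_inj : injective refl5.
Proof.
move=> i j /(congr1 val) /= h; apply: val_inj; move: h.
by case: i j => [[|[|[|[|[|//]]]]] ?] [[|[|[|[|[|//]]]]] ?].
Qed.

Lemma on_cycle_wheel m g : (forall i j, c5adj (g i) (g j) = c5adj i j) ->
  forall a b : 'I_5 + 'I_m, wheel (on_cycle g a) (on_cycle g b) = wheel a b.
Proof. by move=> h [i|i] [j|j] //=. Qed.

Lemma on_cycle_inj m g : injective g -> injective (@on_cycle m g).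
Proof. by move=> gi [i|i] [j|j] //= [E]; first [rewrite (gi _ _ E)|rewrite E]. Qed.

Lemma on_hubs_wheel m (g : 'I_m -> 'I_m) : injective g ->
  forall a b : 'I_5 + 'I_m, wheel (on_hubs g a) (on_hubs g b) = wheel a b.
Proof. by move=> gi [i|i] [j|j] //=; rewrite (inj_eq gi). Qed.

Lemma on_hubs_inj m (g : 'I_m -> 'I_m) : injective g -> injective (on_hubs g).
Proof. by move=> gi [i|i] [j|j] //= [E]; first [rewrite (gi _ _ E)|rewrite E]. Qed.

Section Normalise.
Variables (R : realType) (n m : nat).
Hypothesis m0 : (0 < m)%N.

(** By [c5_classes] the cycle classes with more than one vertex are pairwise adjacent, so they fit
    into two consecutive positions; a rotation moves the other three to 4, 0, 1. *)
Lemma opt_normalise (c : 'I_n -> 'I_5 + 'I_m) : opt R c ->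
  exists c' : 'I_n -> 'I_5 + 'I_m, [/\ opt R c', c5_normal c' & blow c' =2 blow c].
Proof.
move=> c_opt; have [cs cm] := c_opt.
have [xi [rho0 xi0 xiE]] := blow_perron R m0 cs.
have sep i j : i != j -> ~~ c5adj i j -> (csize c (inl i) <= 1)%N || (csize c (inl j) <= 1)%N.
  exact: (c5_classes cs cm rho0 xi0 xiE).
(* [rot5 q4] and [rot5 q1] are the successor and the predecessor on the cycle. *)
have [k [k0 k1 k4]] : exists k : 'I_5, [/\ (csize c (inl k) <= 1)%N,
    (csize c (inl (rot5 q4 k)) <= 1)%N & (csize c (inl (rot5 q1 k)) <= 1)%N].
  have s02 := sep q0 q2 isT isT; have s13 := sep q1 q3 isT isT.
  have s24 := sep q2 q4 isT isT; have s30 := sep q3 q0 isT isT.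
  have s41 := sep q4 q1 isT isT.
  have r4 : [/\ rot5 q4 q0 = q1, rot5 q4 q1 = q2, rot5 q4 q2 = q3, rot5 q4 q3 = q4 & rot5 q4 q4 = q0].
    by split; apply: val_inj.
  have r1 : [/\ rot5 q1 q0 = q4, rot5 q1 q1 = q0, rot5 q1 q2 = q1, rot5 q1 q3 = q2 & rot5 q1 q4 = q3].
    by split; apply: val_inj.
  have [r40 r41 r42 r43 r44] := r4; have [r10 r11 r12 r13 r14] := r1.
  have : [|| [&& csize c (inl q0) <= 1, csize c (inl q1) <= 1 & csize c (inl q4) <= 1],
     [&& csize c (inl q1) <= 1, csize c (inl q2) <= 1 & csize c (inl q0) <= 1],
     [&& csize c (inl q2) <= 1, csize c (inl q3) <= 1 & csize c (inl q1) <= 1],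
     [&& csize c (inl q3) <= 1, csize c (inl q4) <= 1 & csize c (inl q2) <= 1] |
     [&& csize c (inl q4) <= 1, csize c (inl q0) <= 1 & csize c (inl q3) <= 1]]%N.
    move: s02 s13 s24 s30 s41.
    by do 5![case: (_ <= 1)%N].
  move=> /orP[/and3P[]|/orP[/and3P[]|/orP[/and3P[]|/orP[]/and3P[]]]] h1 h2 h3.
  - by exists q0; rewrite r40 r10.
  - by exists q1; rewrite r41 r11.
  - by exists q2; rewrite r42 r12.
  - by exists q3; rewrite r43 r13.
  - by exists q4; rewrite r44 r14.
pose f := @on_cycle m (rot5 k).
have fi : injective f by apply/on_cycle_inj/rot5_inj.
have fw := on_cycle_wheel (rot5_adj k) : forall a b : 'I_5 + 'I_m, wheel (f a) (f b) = wheel a b.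
exists (f \o c); split; [exact: relabel_opt|split|exact: relabel_blow].
- have <- : f (inl k) = inl q0.
    by congr inl; apply: val_inj; case: (k) => [[|[|[|[|[|//]]]]] ?].
  by rewrite relabel_csize//; apply/eqP; rewrite eqn_leq k0 csize_gt0.
- have <- : f (inl (rot5 q4 k)) = inl q1.
    by congr inl; apply: val_inj; case: (k) => [[|[|[|[|[|//]]]]] ?].
  by rewrite relabel_csize//; apply/eqP; rewrite eqn_leq k1 csize_gt0.
- have <- : f (inl (rot5 q1 k)) = inl q4.
    by congr inl; apply: val_inj; case: (k) => [[|[|[|[|[|//]]]]] ?].
  by rewrite relabel_csize//; apply/eqP; rewrite eqn_leq k4 csize_gt0.
Qed.

(** The reflection fixes class 0 and swaps the classes 2 and 3, so bounds on class 3 carry over to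
    class 2. *)
Lemma opt_reflect (c : 'I_n -> 'I_5 + 'I_m) : opt R c -> c5_normal c ->
  let c' := @on_cycle m refl5 \o c in
  [/\ opt R c', c5_normal c', blow c' =2 blow c &
    [/\ csize c' (inl q2) = csize c (inl q3), csize c' (inl q3) = csize c (inl q2) &
        forall j, csize c' (inr j) = csize c (inr j)]].
Proof.
move=> c_opt [z0 z1 z4] c'.
have fi : injective (@on_cycle m refl5) by apply/on_cycle_inj/refl5_inj.
have fw := on_cycle_wheel refl5_adj : forall a b : 'I_5 + 'I_m, _ = wheel a b.
have E i : csize c' (inl (refl5 i)) = csize c (inl i).
  exact: (relabel_csize fi c (inl i)).
have r i (j : 'I_5) : refl5 i = j :> nat -> csize c' (inl j) = csize c (inl i).
  by move=> h; rewrite -E; congr (csize c' (inl _)); apply: val_inj.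
split; [exact: relabel_opt| |exact: relabel_blow|].
  by split; [rewrite (r q0)|rewrite (r q4)|rewrite (r q1)].
split; [by rewrite (r q3)|by rewrite (r q2)|move=> j].
exact: (relabel_csize fi c (inr j)).
Qed.

End Normalise.

Lemma card_ord_lt m t : (t <= m)%N -> #|[set j : 'I_m | (j < t)%N]| = t.
Proof.
move=> tm; rewrite -sum1_card (eq_bigl (fun j : 'I_m => (j < t)%N)); last by move=> j; rewrite inE.
by rewrite (big_ord_narrow tm) sum1_card card_ord.
Qed.

(* Class sizes of Y_p(n), p = m + 2: one vertex in each of the classes 0, 1, 4 of the 5-cycle,
   and the Turan sizes for n - 1 after restoring u1 and u2 to the classes 3 and 2. *)
Definition ysize n m (d : 'I_5 + 'I_m) : nat :=
  match d with
  | inl i => if i == q3 then (n.-1 %/ m.+2).-1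
             else if i == q2 then (n.-1 %/ m.+2 + (m < n.-1 %% m.+2)).-1 else 1%N
  | inr j => (n.-1 %/ m.+2 + (j < n.-1 %% m.+2))%N
  end.

Lemma sum_two_valued (I : finType) (f : I -> nat) k : (forall i, k <= f i <= k.+1)%N ->
  (\sum_i f i = #|I| * k + #|[set i | f i == k.+1]|)%N.
Proof.
move=> h; have -> : (#|I| * k = \sum_(i : I) k)%N by rewrite sum_nat_const.
rewrite -sum1_card [X in (_ + X)%N]big_mkcond /= -big_split /=; apply: eq_bigr => i _.
rewrite inE; have := h i; case: (f i =P k.+1) => [->|/eqP]; first by rewrite addn1.
by rewrite addn0 => n1 /andP[k1 k2]; apply/eqP; rewrite eqn_leq k1 -ltnS ltn_neqAle n1 k2.
Qed.

Section Balanced.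
Variables (R : realType) (n m : nat).
Hypothesis m0 : (0 < m)%N.
Hypothesis n_big : (60 * (m + 3) <= n)%N.

(** Returning u1 and u2 to the classes 3 and 2 gives p classes of sizes al+1 and al+2, which is the
    division of n-1 by p. The hubs are then permuted so that the larger ones come first, as in
    [ysize]. *)
Lemma balanced_tsize (c : 'I_n -> 'I_5 + 'I_m) : opt R c -> c5_normal c ->
  (csize c (inl q3) <= csize c (inl q2) <= (csize c (inl q3)).+1)%N ->
  (forall j, (csize c (inl q3)).+1 <= csize c (inr j) <= (csize c (inl q3)).+2)%N ->
  (forall j, csize c (inl q2) < csize c (inr j))%N ->
  exists c' : 'I_n -> 'I_5 + 'I_m,
    [/\ opt R c', blow c' =2 blow c & forall d, csize c' d = ysize n d].
Proof.
move=> c_opt c_norm hb hn hbn; set al := csize c (inl q3) in hb hn.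
set be := csize c (inl q2) in hb hbn.
have := class_size_total R c_norm; rewrite -/al -/be.
rewrite (sum_two_valued hn) card_ord; set cnt := #|_| => sz.
have cntm : (cnt <= m)%N by rewrite -[X in (_ <= X)%N]card_ord max_card.
have full : (al < be)%N -> cnt = m.
  move=> lt; rewrite /cnt -[RHS]card_ord -cardsT; apply: eq_card => j; rewrite !inE.
  apply/eqP; have := hn j; have := hbn j; move: lt; clear; lia.
(* The number of classes of size al+2, hence the remainder of n-1 modulo p. *)
pose t := (be - al + cnt)%N.
have tm : (t < m.+2)%N by rewrite /t; move: hb cntm; clear; lia.
have nE : n.-1 = (al.+1 * m.+2 + t)%N by rewrite /t; move: sz hb; clear; lia.
have dE : (n.-1 %/ m.+2)%N = al.+1 by rewrite nE divnMDl// divn_small// addn0.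
have rE : (n.-1 %% m.+2)%N = t by rewrite nE modnMDl modn_small.
have cE : #|[set j : 'I_m | (j < t)%N]| = cnt.
  have [lt|ge] := ltnP al be.
    rewrite (full lt) (_ : [set j : 'I_m | _] = setT) ?cardsT ?card_ord//.
    apply/setP => j; rewrite !inE (leq_trans (ltn_ord j))// /t (full lt); exact: leq_addl.
  by rewrite /t (_ : (be - al)%N = 0%N) ?add0n ?card_ord_lt//; apply/eqP; rewrite subn_eq0.
have [s hs] : exists s : {perm 'I_m}, forall j, (csize c (inr (s j)) == al.+2) = (j < t)%N.
  apply: (equicount_perm (f := fun j : 'I_m => (j < t)%N) (g := fun j => csize c (inr j) == al.+2)).
  have ct : #|[set j : 'I_m | (j < t)%N]| = #|[set j | csize c (inr j) == al.+2]| by rewrite cE.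
  case.
    transitivity #|[set j : 'I_m | (j < t)%N]|; first by apply: eq_card => j; rewrite !inE eqb_id.
    by rewrite ct; apply: eq_card => j; rewrite !inE eqb_id.
  transitivity #|~: [set j : 'I_m | (j < t)%N]|.
    by apply: eq_card => j; rewrite !inE eqbF_neg.
  transitivity #|~: [set j | csize c (inr j) == al.+2]|; first by rewrite [LHS]cardsCs [RHS]cardsCs !setCK ct.
  by apply: eq_card => j; rewrite !inE eqbF_neg.
pose f := @on_hubs m (s^-1)%g.
have si : injective (s^-1)%g by exact: perm_inj.
have fi : injective f by exact: on_hubs_inj.
have fw := on_hubs_wheel si : forall a b : 'I_5 + 'I_m, wheel (f a) (f b) = wheel a b.
exists (f \o c); split; [exact: relabel_opt|exact: relabel_blow|].
have [z0 z1 z4] := c_norm.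
case=> [i|j]; last first.
  have -> : inr j = f (inr (s j)) by rewrite /f /= permK.
  rewrite relabel_csize //= dE rE permK.
  have := hn (s j); rewrite -hs; case: eqP => [->|/eqP ne]; first by rewrite addn1.
  by rewrite addn0 => /andP[h1 h2]; apply/eqP; rewrite eqn_leq h1 -ltnS ltn_neqAle ne h2.
have -> : csize (f \o c) (inl i) = csize c (inl i) by exact: (relabel_csize fi c (inl i)).
rewrite /= dE rE; case: i => [[|[|[|[|[|//]]]]] hi] /=.
- by transitivity (csize c (inl q0)); [congr (csize c (inl _)); apply: val_inj|exact: z0].
- by transitivity (csize c (inl q1)); [congr (csize c (inl _)); apply: val_inj|exact: z1].
- transitivity be; first by congr (csize c (inl _)); apply: val_inj.
  rewrite -[RHS]/((al.+1 + (m < t)).-1)%N.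
  move: cntm full hb; rewrite /t; clear; lia.
- by transitivity al => //; congr (csize c (inl _)); apply: val_inj.
- by transitivity (csize c (inl q4)); [congr (csize c (inl _)); apply: val_inj|exact: z4].
Qed.

Lemma opt_tsize (c : 'I_n -> 'I_5 + 'I_m) : opt R c ->
  2 * n%:R <= 3 * spec_rad R (blow c) + 3 ->
  exists c' : 'I_n -> 'I_5 + 'I_m,
    [/\ opt R c', blow c' =2 blow c & forall d, csize c' d = ysize n d].
Proof.
move=> c_opt hrho.
(* Up to reflection class 3 is the smaller of the two. The bounds for the reflected blow-up then
   compare class 2 with class 3 and with the hubs. *)
have facts (d : 'I_n -> 'I_5 + 'I_m) : opt R d -> c5_normal d -> blow d =2 blow c ->
    (csize d (inl q3) <= csize d (inl q2))%N ->
    exists c' : 'I_n -> 'I_5 + 'I_m,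
      [/\ opt R c', blow c' =2 blow c & forall a, csize c' a = ysize n a].
  move=> d_opt d_norm dc le.
  have rd : 2 * n%:R <= 3 * spec_rad R (blow d) + 3 by rewrite (spec_rad_ext R dc).
  have [d'_opt d'_norm d'd [e2 e3 ej]] := opt_reflect d_opt d_norm.
  have rd' := rd; rewrite -(spec_rad_ext R d'd) in rd'.
  have h1 := cycle_balanced m0 d'_opt d'_norm rd' n_big; rewrite e2 e3 in h1.
  have a40 := cycle_large m0 d_opt d_norm rd n_big h1.
  have h2 j := cycle_lt_hub m0 d_opt d_norm rd n_big j (leq_trans (isT : 1 < 40)%N a40).
  have h3 j := hub_le m0 d_opt d_norm rd n_big j h1.
  have h4 j : (csize d (inl q2) < csize d (inr j))%N.
    have := cycle_lt_hub m0 d'_opt d'_norm rd' n_big j; rewrite e3 ej; apply.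
    by apply: leq_trans le; apply: leq_trans a40.
  have [||c' [c'_opt c'd c's]] := balanced_tsize d_opt d_norm _ _ h4.
  - by rewrite le h1.
  - by move=> j; rewrite h2 h3.
  - by exists c'; split=> // u v; rewrite c'd dc.
have [d [d_opt d_norm dc]] := opt_normalise m0 c_opt.
have [le|/ltnW le] := leqP (csize d (inl q3)) (csize d (inl q2)); first exact: (facts d).
have [d'_opt d'_norm d'd [e2 e3 ej]] := opt_reflect d_opt d_norm.
apply: (facts _ d'_opt d'_norm); last by rewrite e2 e3.
by move=> u v; rewrite d'd dc.
Qed.

End Balanced.

(** * The graph Y *)

Lemma count_modn N p j : (j < p)%N ->
  (\sum_(x < N) (x %% p == j) = N %/ p + (j < N %% p))%N.
Proof.
move=> jp; elim: N => [|N IH]; first by rewrite big_ord0 div0n mod0n.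
have p0 : (0 < p)%N by exact: leq_ltn_trans jp.
rewrite big_ord_recr /= {}IH modnS divnS//.
have rp : (N %% p < p)%N by rewrite ltn_mod.
have -> : (p %| N.+1)%N = ((N %% p).+1 == p)%N.
  rewrite {1}(divn_eq N p) -addnS dvdn_addr ?dvdn_mull//.
  apply/idP/eqP => [/dvdn_leq h|->//]; apply/eqP; rewrite eqn_leq rp /=; exact: h.
move: (N %% p)%N (N %/ p)%N rp => r k rp.
case: (r.+1 =P p) => h /=; first by rewrite ?ltn0; case: (ltngtP j r) => h2; move: jp; lia.
by rewrite ltnS; case: (ltngtP j r) => h2; lia.
Qed.

Section ExtremalGraph.
Variables (m N : nat).
Hypothesis m0 : (0 < m)%N.
Hypothesis N_big : (2 * m.+2 <= N)%N.

(** Reads Y as a blow-up: u0, u1, u2 are the classes 0, 1, 4, the rest of T_1 and of T_2 are the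
    classes 3 and 2, and T_3, ..., T_p are the hubs. *)
Definition cY (x : 'I_N.+1) : 'I_5 + 'I_m :=
  if x == N :> nat then inl q0 else if x == m.+1 :> nat then inl q1 else
  if x == m :> nat then inl q4 else if (x %% m.+2 == m.+1)%N then inl q3 else
  if (x %% m.+2 == m)%N then inl q2 else inr (insubd (Ordinal m0) (x %% m.+2)%N).

Lemma cY_cases (x : 'I_N.+1) :
  [\/ cY x = inl q0 /\ x = N :> nat,
      [/\ cY x = inl q1, x <> N :> nat, x = m.+1 :> nat & x %% m.+2 = m.+1]%N,
      [/\ cY x = inl q4, x <> N :> nat, x = m :> nat & x %% m.+2 = m]%N |
   [\/ [/\ cY x = inl q3, x <> N :> nat, x <> m.+1 :> nat & x <> m :> nat] /\ x %% m.+2 = m.+1,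
       [/\ cY x = inl q2, x <> N :> nat, x <> m.+1 :> nat & x <> m :> nat] /\ x %% m.+2 = m |
       [/\ x <> N :> nat, x <> m.+1 :> nat & x <> m :> nat] /\
       exists2 j : 'I_m, cY x = inr j & x %% m.+2 = j]%N].
Proof.
rewrite /cY; case: eqP => x0; first by apply: Or41.
case: eqP => x1; first by apply: Or42; split=> //; rewrite x1 modn_small.
case: eqP => x2; first by apply: Or43; split=> //; rewrite x2 modn_small.
case: eqP => x3; first by apply: Or44; apply: Or31.
case: eqP => x4; first by apply: Or44; apply: Or32.
have lt : (x %% m.+2 < m)%N.
  by have : (x %% m.+2 < m.+2)%N; [rewrite ltn_mod|move: x3 x4; lia].
apply: Or44; apply: Or33; split=> //; exists (insubd (Ordinal m0) (x %% m.+2)%N) => //.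
by rewrite val_insubd lt.
Qed.

Lemma Y_adj_blow : @Y_adj m.+2 N.+1 =2 blow cY.
Proof.
move=> x y; rewrite /blow /Y_adj -[m.+2.-1]/m.+1 -[m.+2.-2]/m -[N.+1.-1]/N.
case: (cY_cases x) => [[-> x0]|[-> x0 x1 xm]|[-> x0 x1 xm]|[[[-> x0 x1 x2] xm]|[[-> x0 x1 x2] xm]|[[x0 x1 x2] [i -> xm]]]];
case: (cY_cases y) => [[-> y0]|[-> y0 y1 ym]|[-> y0 y1 ym]|[[[-> y0 y1 y2] ym]|[[-> y0 y1 y2] ym]|[[y0 y1 y2] [j -> ym]]]];
rewrite /wheel ?xm ?ym -?val_eqE; try have hi := ltn_ord i; try have hj := ltn_ord j;
try (match goal with |- _ = c5adj ?a ?b =>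
  let v := eval compute in (c5adj a b) in change (c5adj a b) with v end);
repeat (case: (@eqP nat _ _) => ? //=); lia.
Qed.

Lemma residue_class_card j : (j < m.+2)%N ->
  (#|[set x : 'I_N.+1 | (x != N :> nat) && (x %% m.+2 == j)]| = N %/ m.+2 + (j < N %% m.+2))%N.
Proof.
move=> jm; rewrite -(count_modn _ jm) -sum1_card big_mkcond /= big_ord_recr /= inE eqxx addn0.
apply: eq_bigr => x _; rewrite inE /= neq_ltn ltn_ord /=.
by case: eqP.
Qed.

Lemma csize_cY d : csize cY d = ysize N.+1 d.
Proof.
have NN : (m.+2 < N)%N by move: m0 N_big; lia.
have cE k : cY k = d -> k \in [set v | cY v == d] by move=> h; rewrite inE h.
pose x0 : 'I_N.+1 := ord_max.
have h1 : (m.+1 < N.+1)%N by move: NN; lia.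
have h2 : (m < N.+1)%N by move: NN; lia.
pose x1 := Ordinal h1; pose x2 := Ordinal h2.
have single (x : 'I_N.+1) : (forall v, (cY v == d) = (v == x)) -> csize cY d = 1%N.
  by move=> h; rewrite /csize (_ : [set v | cY v == d] = [set x]) ?cards1//; apply/setP => v; rewrite !inE h.
have minus1 (x : 'I_N.+1) k : (k < m.+2)%N -> (x != N :> nat) && (x %% m.+2 == k)%N ->
    (forall v : 'I_N.+1, (cY v == d) = [&& v != x, v != N :> nat & v %% m.+2 == k]%N) ->
    csize cY d = (N %/ m.+2 + (k < N %% m.+2)).-1.
  move=> km xk h; rewrite -(residue_class_card km) (cardsD1 x) inE xk add1n /csize.
  by apply: eq_card => v; rewrite !inE h.
case: d cE single minus1 => [i|j] _ single minus1; last first.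
  rewrite /ysize /= -(residue_class_card (j := j)); last by rewrite (leq_trans (ltn_ord j))// !leqW.
  apply: eq_card => v; rewrite !inE; have hj := ltn_ord j.
  case: (cY_cases v) => [[-> y0]|[-> y0 y1 ->]|[-> y0 y1 ->]|[[[-> y0 y1 y2] ->]|[[-> y0 y1 y2] ->]|[[y0 y1 y2] [i -> ->]]]];
  rewrite /= ?y0 ?eqxx//=; try by apply/esym; rewrite -[RHS]/false; apply/negP => /andP[_ /eqP]; lia.
  by rewrite (_ : (inr i == inr j :> 'I_5 + 'I_m) = (i == j :> nat)) // (introN eqP y0).
have vE (v : 'I_N.+1) (x : 'I_N.+1) : (v == x) = (v == x :> nat) by [].
have kq (k : 'I_5) : [\/ k = q0, k = q1, k = q4 | k = q3 \/ k = q2].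
  case: k => [[|[|[|[|[|//]]]]] hk]; [apply: Or41|apply: Or42|apply: Or44; right|apply: Or44; left|apply: Or43];
  exact: val_inj.
case: (kq i) single minus1 => [->|->|->|[->|->]] single minus1; rewrite /ysize -[N.+1.-1]/N /=.
- apply: (single x0) => v; rewrite vE /=.
  by case: (cY_cases v) => [[-> y0]|[-> y0 y1 _]|[-> y0 y1 _]|[[[-> y0 y1 y2] _]|[[-> y0 y1 y2] _]|[[y0 y1 y2] [k -> _]]]];
     first [rewrite -[LHS]/true; apply/esym/eqP; rewrite /=; lia|rewrite -[LHS]/false; apply/esym/negP => /eqP /=; lia].
- apply: (single x1) => v; rewrite vE /=.
  by case: (cY_cases v) => [[-> y0]|[-> y0 y1 _]|[-> y0 y1 _]|[[[-> y0 y1 y2] _]|[[-> y0 y1 y2] _]|[[y0 y1 y2] [k -> _]]]];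
     first [rewrite -[LHS]/true; apply/esym/eqP; rewrite /=; lia|rewrite -[LHS]/false; apply/esym/negP => /eqP /=; lia].
- apply: (single x2) => v; rewrite vE /=.
  by case: (cY_cases v) => [[-> y0]|[-> y0 y1 _]|[-> y0 y1 _]|[[[-> y0 y1 y2] _]|[[-> y0 y1 y2] _]|[[y0 y1 y2] [k -> _]]]];
     first [rewrite -[LHS]/true; apply/esym/eqP; rewrite /=; lia|rewrite -[LHS]/false; apply/esym/negP => /eqP /=; lia].
- rewrite (minus1 x1 m.+1) //=.
  + by rewrite (_ : (m.+1 < N %% m.+2)%N = false) ?addn0//; apply/negbTE; rewrite -leqNgt -ltnS ltn_mod.
  + by rewrite modn_small// eqxx andbT; apply/eqP; lia.
  move=> v; rewrite vE /=.
  by case: (cY_cases v) => [[-> y0]|[-> y0 y1 ->]|[-> y0 y1 ->]|[[[-> y0 y1 y2] ->]|[[-> y0 y1 y2] ->]|[[y0 y1 y2] [k -> ->]]]];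
    try have hk := ltn_ord k;
    first [rewrite -[LHS]/true; apply/esym/and3P; split; apply/eqP; rewrite /=; lia|rewrite -[LHS]/false; apply/esym/negP => /and3P[/eqP /= ? /eqP ? /eqP ?]; lia].
- rewrite (minus1 x2 m) //=.
  + by rewrite modn_small// eqxx andbT; apply/eqP; lia.
  move=> v; rewrite vE /=.
  by case: (cY_cases v) => [[-> y0]|[-> y0 y1 ->]|[-> y0 y1 ->]|[[[-> y0 y1 y2] ->]|[[-> y0 y1 y2] ->]|[[y0 y1 y2] [k -> ->]]]];
    try have hk := ltn_ord k;
    first [rewrite -[LHS]/true; apply/esym/and3P; split; apply/eqP; rewrite /=; lia|rewrite -[LHS]/false; apply/esym/negP => /and3P[/eqP /= ? /eqP ? /eqP ?]; lia].
Qed.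

Lemma cY_surj : surj cY.
Proof.
move=> a; have : (0 < csize cY a)%N.
  have q2N : (2 <= N %/ m.+2)%N by rewrite leq_divRL.
  rewrite csize_cY /ysize -[N.+1.-1]/N; case: a => [i|j]; last by move: q2N; lia.
  by move: q2N; case: ifP => _; [lia|case: ifP => _; lia].
by move=> /card_gt0P[v]; rewrite inE => /eqP; exists v.
Qed.

Lemma cY_normal : c5_normal cY.
Proof. by split; rewrite csize_cY. Qed.

End ExtremalGraph.

(** * A lower bound for the spectral radius of Y *)

Section TestVector.
Variables (R : realType) (n m : nat) (c : 'I_n -> 'I_5 + 'I_m).
Hypotheses (c_surj : surj c) (c_normal : c5_normal c).
Local Notation al := (csize c (inl q3))%:R.
Local Notation be := (csize c (inl q2))%:R.
Local Notation nu j := (csize c (inr j))%:R.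
Local Notation tau := (\sum_j nu j).
Local Notation N := (n%:R - 1).

(** The test vector is 1 except for t at the vertex of class 0; with t near the Perron entry of that
    vertex it reaches the constant in [loss]. *)
Lemma test_vector (t : R) :
  2 * t * (tau + 2) + N ^+ 2 - (al + 1) ^+ 2 - (be + 1) ^+ 2 - \sum_j nu j ^+ 2 - 2 <=
  spec_rad R (blow c) * (N + t ^+ 2).
Proof.
have [z0 z1 z4] := c_normal.
pose z (d : 'I_5 + 'I_m) : R := if d == inl q0 then t else 1.
have nE : n%:R = 3 + al + be + tau :> R.
  by rewrite -natr_sum -!natrD (class_size_total R c_normal).
have h := class_rayleigh c_surj z.
have [e0 e1 e2 e3 e4] := c5_nbsum (fun k => (csize c (inl k))%:R * z (inl k)).
have Tz : \sum_j nu j * z (inr j) = tau by apply: eq_bigr => j _; rewrite mulr1.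
have tot : \sum_d (csize c d)%:R * z d = 2 + t + al + be + tau.
  by rewrite wheel_sum sum5 z0 z1 z4 Tz /z /=; ring.
have hub j : \sum_(d | wheel (inr j) d) (csize c d)%:R * z d = 2 + t + al + be + tau - nu j.
  by rewrite -tot (wheel_sum_inr j) /z /=; ring.
move: h; rewrite !wheel_sum !sum5 !wheel_sum_inl e0 e1 e2 e3 e4 z0 z1 z4 Tz.
have -> : \sum_j nu j * (z (inr j) * \sum_(d | wheel (inr j) d) (csize c d)%:R * z d) =
   tau * (2 + t + al + be + tau) - \sum_j nu j ^+ 2 :> R.
  by rewrite mulr_suml -sumrB; apply: eq_bigr => j _; rewrite hub /z /=; ring.
have -> : \sum_j nu j * z (inr j) ^+ 2 = tau :> R by apply: eq_bigr => j _; rewrite /z /=; ring.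
rewrite /z /=.
rewrite nE; move: (\sum_j nu j ^+ 2) => S.
have -> : 1 * t ^+ 2 + 1 * 1 ^+ 2 + be * 1 ^+ 2 + al * 1 ^+ 2 + 1 * 1 ^+ 2 + tau =
   3 + al + be + tau - 1 + t ^+ 2 by ring.
apply: le_trans; rewrite le_eqVlt; apply/orP; left; apply/eqP; ring.
Qed.

End TestVector.

(** For t = 1 - k one has 1 - (2k - k^2) = t^2, so the claim is essentially rho >= (1 - 1/p)(N +
    t^2), and the summand k/20 pays for bounded errors once N is large. *)
Lemma test_vector_bound (R : realFieldType) (P N k t rho tau Sq : R) : 3 <= P ->
  k * (P - 1) = 1 -> t = 1 - k -> 20 * (P ^+ 2 + 3 * P) <= N ->
  (P - 2) * N <= P * (tau + 2) -> P * Sq <= N ^+ 2 + P ^+ 2 / 4 ->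
  2 * t * (tau + 2) + N ^+ 2 - Sq - 2 <= rho * (N + t ^+ 2) ->
  (P - 1) * (N + 1 - (2 * k - k ^+ 2 + k / 20)) <= P * rho.
Proof.
move=> P3 kP tE Nbig htau hSq hrho.
have k0 : 0 < k by rewrite -(pmulr_lgt0 _ (_ : 0 < P - 1)) ?kP//; clear -P3; lra.
have k1 : k <= 1 / 2.
  have : k * 2 <= k * (P - 1) by rewrite ler_wpM2l ?(ltW k0)//; clear -P3; lra.
  by rewrite kP; clear; lra.
have t0 : 0 <= t by clear -tE k1; lra.
have t1 : t <= 1 by clear -tE k0; lra.
have tP : (P - 1) * t = P - 2 by rewrite tE mulrBr mulrC [_ * k]mulrC kP; clear; ring.
have PP0 : 0 <= P ^+ 2 by exact: sqr_ge0.
have N0 : 0 < N by clear -P3 Nbig PP0; lra.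
have t2 : 0 <= t ^+ 2 <= 1 by rewrite sqr_ge0 expr_le1.
have D0 : 0 < N + t ^+ 2 by case/andP: t2 => h _; clear -h N0; lra.
rewrite (_ : N + 1 - (2 * k - k ^+ 2 + k / 20) = N + t ^+ 2 - k / 20); last by rewrite tE; clear; field.
rewrite -(ler_pM2r D0).
have h1 : P * (2 * t * (tau + 2) + N ^+ 2 - Sq - 2) <= P * rho * (N + t ^+ 2).
  by rewrite -[leRHS]mulrA ler_wpM2l//; clear -P3; lra.
apply: le_trans h1.
have h2 : 2 * t * ((P - 1) * t * N) <= 2 * t * (P * (tau + 2)).
  by rewrite tP ler_wpM2l// mulr_ge0.
have h3 : (P - 1) * t ^+ 4 <= P - 1.
  rewrite -[leRHS]mulr1 ler_wpM2l//; first by clear -P3; lra.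
  by rewrite exprn_ile1.
have E : (P - 1) * (N + t ^+ 2 - k / 20) * (N + t ^+ 2) =
   (P - 1) * (N ^+ 2 + 2 * t ^+ 2 * N + t ^+ 4) - (k * (P - 1)) * (N + t ^+ 2) / 20.
  by clear; field.
rewrite E kP; case/andP: t2 => t20 _.
by clear -h2 h3 hSq Nbig t20 P3 PP0; lra.
Qed.

Lemma cY_spec_rad (R : realType) (m N : nat) (m0 : (0 < m)%N) :
  (20 * (m.+2 ^ 2 + 3 * m.+2) <= N)%N ->
  (m.+2%:R - 1) * (N.+1%:R - loss R m.+2) <= m.+2%:R * spec_rad R (blow (@cY m N m0)).
Proof.
move=> Nbig.
have N2 : (2 * m.+2 <= N)%N by move: Nbig; rewrite expnS expn1; nia.
have K2 : (2 <= N %/ m.+2)%N by rewrite leq_divRL.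
pose K : R := (N %/ m.+2)%:R; pose P : R := m.+2%:R.
have P3 : 3 <= P by rewrite ler_nat.
have alE : (csize (@cY m N m0) (inl q3))%:R + 1 = K :> R.
  by rewrite csize_cY// natr1 /ysize /= prednK// (leq_trans _ K2).
have beE : (csize (@cY m N m0) (inl q2))%:R + 1 = K + (m < N %% m.+2)%:R :> R.
  by rewrite csize_cY// natr1 /ysize /= prednK ?natrD// (leq_trans _ (leq_addr _ _))// (leq_trans _ K2).
have nuE j : (csize (@cY m N m0) (inr j))%:R = K + (j < N %% m.+2)%:R :> R.
  by rewrite csize_cY// /ysize natrD.
(* On the two values K and K+1 the square is a linear function, so the sum of squares of the class
   sizes depends only on their total. *)
have sq (b : bool) : (K + b%:R) ^+ 2 = (2 * K + 1) * (K + b%:R) - K * (K + 1).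
  by case: b => /=; ring.
have := test_vector (cY_surj m0 N2) (cY_normal m0 N2) (1 - 1 / (P - 1)).
rewrite alE beE; set tau := \sum_j _; set S := \sum_j _.
set b := (m < N %% m.+2)%N in beE *.
have tot : K + (K + b%:R) + tau = N%:R.
  have := class_size_total R (cY_normal m0 N2).
  rewrite -beE -alE /tau -natr_sum !natr1 -!natrD => h; congr (_%:R).
  by apply/eqP; rewrite -eqSS; apply/eqP; rewrite -[RHS]h; ring.
have SE : S = (2 * K + 1) * tau - m%:R * (K * (K + 1)).
  rewrite /S (eq_bigr (fun j => (2 * K + 1) * (csize (@cY m N m0) (inr j))%:R - K * (K + 1))); last first.
    by move=> j _; rewrite nuE sq.
  by rewrite sumrB -mulr_sumr sumr_const card_ord -[_ *+ m]mulr_natl.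
have PK : P * K <= N%:R by rewrite -natrM ler_nat mulnC leq_divM.
have PE : P = m%:R + 2 by rewrite -[RHS]natrD addn2.
have NE : N.+1%:R - 1 = N%:R :> R by rewrite -natr1 addrK.
rewrite NE => h.
have b1 : (b%:R : R) <= 1 by rewrite (ler_nat _ _ 1) leq_b1.
rewrite -[N.+1%:R]natr1 /loss /=.
apply: (test_vector_bound (t := 1 - 1 / (P - 1)) (tau := tau) (N := N%:R)
  (Sq := K ^+ 2 + (K + b%:R) ^+ 2 + S) P3 _ (erefl _)).
- by rewrite div1r mulVf// gt_eqF//; lra.
- by rewrite -natrX -!natrM -natrD -natrM ler_nat.
- have : P * tau = P * N%:R - 2 * (P * K) - P * b%:R by rewrite -tot; ring.
  have : P * b%:R <= P by rewrite ler_piMr//; lra.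
  by move: PK; lra.
- have -> : K ^+ 2 + (K + b%:R) ^+ 2 + S = (2 * K + 1) * N%:R - P * (K * (K + 1)).
    by rewrite SE -tot PE sq; ring.
  rewrite -subr_ge0.
  have -> : N%:R ^+ 2 + P ^+ 2 / 4 - P * ((2 * K + 1) * N%:R - P * (K * (K + 1))) =
     (N%:R - P * K - P / 2) ^+ 2 by field.
  exact: sqr_ge0.
- by apply: le_trans h; rewrite le_eqVlt; apply/orP; left; apply/eqP; ring.
Qed.

(** * Existence of an optimal blow-up and the conclusion *)

Lemma opt_exists (R : realType) n m (d : 'I_n -> 'I_5 + 'I_m) : surj d ->
  exists c : 'I_n -> 'I_5 + 'I_m, opt R c.
Proof.
move=> ds; pose srj (c : {ffun 'I_n -> 'I_5 + 'I_m}) := [forall a, exists v, c v == a].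
have srjP (c : {ffun 'I_n -> 'I_5 + 'I_m}) : reflect (surj c) (srj c).
  apply: (iffP forallP) => [h a|h a]; first by have /existsP[v /eqP] := h a; exists v.
  by apply/existsP; have [v cv] := h a; exists v; apply/eqP.
have fE (c : 'I_n -> 'I_5 + 'I_m) : blow [ffun v => c v] =2 blow c by move=> u v; rewrite /blow !ffunE.
have sE (c : 'I_n -> 'I_5 + 'I_m) : surj c -> surj [ffun v => c v].
  by move=> h a; have [v cv] := h a; exists v; rewrite ffunE.
have d0 : srj [ffun v => d v] by apply/srjP/sE.
pose F (c : {ffun 'I_n -> 'I_5 + 'I_m}) := spec_rad R (blow c).
case: (@Order.TotalTheory.arg_maxP _ _ _ [ffun v => d v] srj F d0) => c /srjP cs cmax.
exists c; split=> // c' c's.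
by have := cmax _ (introT (srjP _) (sE _ c's)); rewrite /F (spec_rad_ext R (fE c')).
Qed.

Theorem theorem1p4 (R : realType) (p q : nat) :
  (3 <= p)%N -> (1 <= q)%N ->
  exists N : nat, forall (n : nat), (N <= n)%N ->
    forall e : rel 'I_n, simple_graph e ->
      non_partite e p ->
      ~ contains_subgraph (@B_adj p q) e ->
      spec_rad R e <= spec_rad R (@Y_adj p n) /\
      (spec_rad R e = spec_rad R (@Y_adj p n) <-> graph_iso e (@Y_adj p n)).
Proof.
case: p => [|[|m]]// m1 _; have m0 : (0 < m)%N by [].
have [N0 hom] := wheel_hom R q m1.
exists (N0 + (20 * (m.+2 ^ 2 + 3 * m.+2) + 60 * (m + 3))).+1 => n.
case: n => // N; rewrite ltnS => Nbig e e_simple np nB.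
have Nhom : (N0 <= N.+1)%N by rewrite leqW// (leq_trans (leq_addr _ _) Nbig).
have N20 : (20 * (m.+2 ^ 2 + 3 * m.+2) <= N)%N.
  by apply: leq_trans Nbig; rewrite addnCA leq_addr.
have N60 : (60 * (m + 3) <= N.+1)%N.
  by rewrite leqW// (leq_trans _ Nbig)// addnA leq_addl.
have N2 : (2 * m.+2 <= N)%N by move: N20; rewrite expnS expn1; clear; nia.
have [ei' es] := e_simple.
have ei : irreflexive e by move=> x; apply/negbTE.
pose cy := @cY m N m0; have cys : surj cy := cY_surj m0 N2.
have YE : @Y_adj m.+2 N.+1 =2 blow cy := Y_adj_blow m0 N2.
have rY : spec_rad R (@Y_adj m.+2 N.+1) = spec_rad R (blow cy) := spec_rad_ext R YE.
have lbY : (m.+2%:R - 1) * (N.+1%:R - loss R m.+2) <= m.+2%:R * spec_rad R (blow cy).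
  exact: cY_spec_rad.
(* Every optimum is a copy of Y; as an optimum exists, [cy] is itself optimal. *)
have isoY (c : 'I_N.+1 -> 'I_5 + 'I_m) : opt R c -> graph_iso (blow c) (blow cy) /\ spec_rad R (blow c) = spec_rad R (blow cy).
  move=> c_opt.
  (* From rho >= (1 - 1/p)(n - 1) and p >= 3. *)
  have rc : 2 * N.+1%:R <= 3 * spec_rad R (blow c) + 3.
    have [_ cmx] := c_opt; have := cmx cy cys; have := loss_le1 R m1; have P3 : (3 : R) <= m.+2%:R by rewrite ler_nat.
    have n0 : 0 <= N%:R :> R by exact: ler0n.
    move: lbY; rewrite -[N.+1%:R]natr1; move: (loss _ _) (spec_rad R (blow cy)) (spec_rad R (blow c)) => l x y.
    move: (m.+2%:R : R) P3 => P P3; move: (N%:R : R) n0 => M M0 h l1 xy.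
    have h1 : (P - 1) * M <= P * y.
      apply: le_trans (_ : P * x <= _); last by rewrite ler_wpM2l//; lra.
      by apply: le_trans h; rewrite ler_wpM2l//; lra.
    have h2 : 2 * (P * M) <= 3 * (P * y).
      apply: le_trans (_ : 3 * ((P - 1) * M) <= _); last by rewrite ler_wpM2l.
      have : 0 <= (P - 3) * M by rewrite mulr_ge0//; lra.
      by lra.
    have : P * (2 * M) <= P * (3 * y) by move: h2; lra.
    by rewrite ler_pM2l//; lra.
  have [c' [c'_opt c'c c's]] := opt_tsize m0 N60 c_opt rc.
  have iso : graph_iso (blow c') (blow cy) by apply: blow_iso => a; rewrite c's csize_cY.
  have iso' : graph_iso (blow c) (blow cy).
    by have [f [fb fe]] := iso; exists f; split=> // u v; rewrite fe c'c.
  split=> //; apply: spec_rad_iso iso' => //; try exact: blow_sym; exact: blow_irr.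
have [c0 c0_opt] := opt_exists R cys.
have [_ rc0] := isoY _ c0_opt.
have cymax (c : 'I_N.+1 -> 'I_5 + 'I_m) : surj c -> spec_rad R (blow c) <= spec_rad R (blow cy).
  by move=> cs; have [_ cmx] := c0_opt; rewrite -rc0; exact: cmx.
have isoR : graph_iso e (@Y_adj m.+2 N.+1) -> spec_rad R e = spec_rad R (blow cy).
  move=> [f [fb fe]]; apply: spec_rad_iso => //; [exact: blow_sym|exact: blow_irr|].
  by exists f; split=> // x y; rewrite -YE fe.
rewrite rY.
have [lt|ge] := ltP (spec_rad R e) (spec_rad R (blow cy)).
  split; first exact: ltW.
  by split=> [h|/isoR//]; rewrite h ltxx in lt.
have [|h hh] := hom _ Nhom e e_simple np nB.
  by apply: le_trans lbY _; rewrite ler_wpM2l.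
have hs : surj h := wheel_hom_surj np hh.
have [le eq] := subgraph_blow R m0 hs es ei hh.
have leY := cymax _ hs.
split; first exact: le_trans leY.
split=> [E|/isoR//].
(* Equality propagates through [e], [blow h] and [cy], so [h] is optimal and [e] is the whole of
   [blow h]. *)
have hE : spec_rad R e = spec_rad R (blow h) by apply/eqP; rewrite eq_le le E leY.
have h_opt : opt R h by split=> // c' c's; rewrite -hE E cymax.
have [[f [fb fe]] _] := isoY _ h_opt.
by exists f; split=> // x y; rewrite YE fe (eq hE).
Qed.
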